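(* Consider a smooth two-dimensional system $\dot x=f(x;\alpha)$, $x\in\mathbb{R}^2$, $\alpha\in\mathbb{R}$, undergoing a codimension one Hopf bifurcation at $\alpha=\alpha^*$ (in the sense given in the context), inducing an oscillatory (limit cycle) solution $x(t)=x(t;\alpha)$ of period $T=T(\alpha)$ for $\alpha\in\tilde I_{\alpha^*}$ surrounding an equilibrium $x_0(\alpha)$. Let $\langle x\rangle_\alpha=\frac1T\int_0^T x(t)\,dt$ for $\alpha\in\tilde I_{\alpha^*}$ and $\langle x\rangle_\alpha=x_0(\alpha)$ for $\alpha\in I_{\alpha^*}$. Then, as $\alpha\to\alpha^*$, $$\langle x\rangle_\alpha-x_0(\alpha)=\begin{cases}K(\alpha)\,\mu(\alpha)+\mathcal{O}(\mu(\alpha)^2), & \alpha\in\tilde I_{\alpha^*},\\ 0, & \alpha\in I_{\alpha^*},\end{cases}$$ where the vector $K(\alpha)\in\mathbb{R}^2$ is $$K=-\operatorname{Re}\Big(\frac{2g_{11}}{\bar\lambda\,\operatorname{Re}(c_1)}\Big)\operatorname{Re}(q)+\operatorname{Im}\Big(\frac{2g_{11}}{\bar\lambda\,\operatorname{Re}(c_1)}\Big)\operatorname{Im}(q),$$ with $\lambda=\lambda(\alpha)$, $q=q(\alpha)$, $g_{11}=g_{11}(\alpha)$ and $c_1=c_1(\alpha)$ as defined in the context.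
   Context: Setting. $x_0(\alpha)$ is an equilibrium, $f(x_0(\alpha);\alpha)=0$, existing for $\alpha$ in an open interval containing $\alpha^*$. Write $f(x_0(\alpha)+x;\alpha)=A(\alpha)x+F(x;\alpha)$, where $A(\alpha)$ is the Jacobian matrix of $f$ in $x$ at $x_0(\alpha)$ and $F$ is the nonlinear part (with $F$ and its first $x$-derivatives vanishing at $x=0$). Eigenvalues. $A(\alpha)$ has eigenvalues $\lambda(\alpha)=\mu(\alpha)+i\omega(\alpha)$ and $\bar\lambda(\alpha)$, with $\mu,\omega$ real and $\omega(\alpha)>0$. Inner product and eigenvectors. $\langle u,v\rangle=\bar u_1v_1+\bar u_2v_2$ on $\mathbb{C}^2$. The vectors $q=q(\alpha),p=p(\alpha)\in\mathbb{C}^2$ satisfy $Aq=\lambda q$, $p^TA=\bar\lambda p^T$, $\langle p,q\rangle=1$ (hence $\langle p,\bar q\rangle=0$). Tensors. For $m=1,2$, with all partial derivatives of $F_m$ in $x$ evaluated at $x=0$, $$B_m(x,y)=\sum_{j,k=1}^2(\partial_{jk}F_m)\,x_ky_j,\qquad C_m(x,y,u)=\sum_{j,k,\ell=1}^2(\partial_{\ell jk}F_m)\,x_ky_ju_\ell,$$ extended multilinearly to complex arguments, so that $F(x)=\frac1{2!}B(x,x)+\frac1{3!}C(x,x,x)+\mathcal{O}(\|x\|^4)$. Coefficients. $$g_{20}=\langle p,B(q,q)\rangle,\quad g_{11}=\langle p,B(q,\bar q)\rangle,\quad g_{02}=\langle p,B(\bar q,\bar q)\rangle,\quad g_{21}=\langle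 p,C(q,q,\bar q)\rangle,$$ $$c_1=\frac{2\lambda+\bar\lambda}{2|\lambda|^2}\,g_{20}g_{11}+\frac1\lambda|g_{11}|^2+\frac{1}{2(2\lambda-\bar\lambda)}|g_{02}|^2+\frac12 g_{21}.$$ Codimension one Hopf bifurcation at $\alpha^*$ means: $\mu(\alpha^* )=0$, $\omega(\alpha^* )>0$, $\mu'(\alpha^* )\ne0$, and $\operatorname{Re}(c_1)\neq0$. In this case, on one side of $\alpha^*$ (and close to $\alpha^*$) there is a single limit cycle surrounding $x_0(\alpha)$ whose amplitude grows from zero at $\alpha^*$ and whose period is near $2\pi/\omega$. $\tilde I_{\alpha^*}$ denotes the one-sided interval of parameter values for which this cycle exists, with the boundary point $\alpha^*$ included (at $\alpha^*$ the cycle has amplitude zero and is understood as the equilibrium); $I_{\alpha^*}$ is its complement. The solution $x(t)$ is this limit cycle and $T$ its period, $x(t+T)=x(t)$. The bifurcation may be supercritical or subcritical. *)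

(* Defs.v *)
From HB Require Import structures.
From mathcomp Require Import all_boot all_order all_algebra.
From mathcomp Require Import all_classical all_reals all_analysis.
From mathcomp Require Import complex.

Set Implicit Arguments.
Unset Strict Implicit.
Unset Printing Implicit Defensive.

Import Order.TTheory GRing.Theory Num.Theory.
Import numFieldNormedType.Exports.

Local Open Scope classical_set_scope.
Local Open Scope ring_scope.
Local Open Scope complex_scope.

(* On a finite-dimensional V, g is C^(n+1) iff it is Frechet differentiable
   everywhere and all its directional derivatives are C^n. *)
Fixpoint Cn (R : realType) (V W : normedModType R) (n : nat) (g : V -> W) :
    Prop :=
  if n is n'.+1 then
    (forall x, differentiable g x) /\ (forall v, Cn n' ('D_v g))
  else continuous g.

Definition smooth (R : realType) (V W : normedModType R) (g : V -> W) : Prop :=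
  forall n, Cn n g.

(* Joint smoothness in the state and the parameter. *)
Definition smooth_family (R : realType) (f : 'cV[R]_2 -> R -> 'cV[R]_2) : Prop :=
  smooth (fun X : ('cV[R]_2 * R)%type => f X.1 X.2).

Definition partial (R : realType) (j : 'I_2) (g : 'cV[R]_2 -> R) :
    'cV[R]_2 -> R :=
  'D_(delta_mx j 0 : 'cV[R]_2) g.

Definition jacobian_mx (R : realType) (h : 'cV[R]_2 -> 'cV[R]_2)
    (x : 'cV[R]_2) : 'M[R]_2 :=
  \matrix_(m, j) partial j (fun y => h y m 0) x.

(* F, in h (c + x) = A x + F x with A the Jacobian matrix of h at c. *)
Definition nonlinear_part (R : realType) (h : 'cV[R]_2 -> 'cV[R]_2)
    (c : 'cV[R]_2) : 'cV[R]_2 -> 'cV[R]_2 :=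
  fun x => h (c + x) - jacobian_mx h c *m x.

Definition Bform (R : realType) (F : 'cV[R]_2 -> 'cV[R]_2)
    (x y : 'cV[R[i]]_2) : 'cV[R[i]]_2 :=
  \col_m \sum_(j < 2) \sum_(k < 2)
     (partial j (partial k (fun w => F w m 0)) 0)%:C * x k 0 * y j 0.

Definition Cform (R : realType) (F : 'cV[R]_2 -> 'cV[R]_2)
    (x y u : 'cV[R[i]]_2) : 'cV[R[i]]_2 :=
  \col_m \sum_(j < 2) \sum_(k < 2) \sum_(l < 2)
     (partial l (partial j (partial k (fun w => F w m 0))) 0)%:C
       * x k 0 * y j 0 * u l 0.

Definition conjv (R : realType) (u : 'cV[R[i]]_2) : 'cV[R[i]]_2 :=
  map_mx (@conjc R) u.

(* Antilinear in the first argument. *)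
Definition inner (R : realType) (u v : 'cV[R[i]]_2) : R[i] :=
  \sum_(k < 2) (u k 0)^* * v k 0.

Section Coefficients.
Context (R : realType) (F : 'cV[R]_2 -> 'cV[R]_2).
Context (lambda : R[i]) (q p : 'cV[R[i]]_2).

Definition g20 : R[i] := inner p (Bform F q q).
Definition g11 : R[i] := inner p (Bform F q (conjv q)).
Definition g02 : R[i] := inner p (Bform F (conjv q) (conjv q)).
Definition g21 : R[i] := inner p (Cform F q q (conjv q)).

Definition c1 : R[i] :=
  (2 * lambda + lambda^*) / (2 * `|lambda| ^+ 2) * g20 * g11
  + lambda^-1 * `|g11| ^+ 2
  + (2 * (2 * lambda - lambda^*))^-1 * `|g02| ^+ 2
  + 2^-1 * g21.

Definition Kvec : 'cV[R]_2 :=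
  let w := 2 * g11 / (lambda^* * (complex.Re c1)%:C) in
  - complex.Re w *: map_mx (@complex.Re R) q
  + complex.Im w *: map_mx (@complex.Im R) q.

End Coefficients.

(* The complex eigendata of a real matrix A: eigenvalues lambda and its
   conjugate, right eigenvector q, adjoint eigenvector p, <p, q> = 1. *)
Definition eigendata (R : realType) (A : 'M[R]_2) (lambda : R[i])
    (q p : 'cV[R[i]]_2) : Prop :=
  let AC := map_mx (real_complex R) A in
  [/\ eigenvalue AC lambda, eigenvalue AC lambda^*,
      AC *m q = lambda *: q, p^T *m AC = lambda^* *: p^T & inner p q = 1].

Definition hopf_codim1 (R : realType) (mu omega : R -> R) (c : R -> R[i])
    (alphas : R) : Prop :=
  [/\ mu alphas = 0, 0 < omega alphas, derivable mu alphas 1,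
      derive1 mu alphas != 0 & complex.Re (c alphas) != 0].

(* T is the least period; in particular x is not constant. *)
Definition periodic_solution (R : realType) (h : 'cV[R]_2 -> 'cV[R]_2)
    (x : R -> 'cV[R]_2) (T : R) : Prop :=
  [/\ 0 < T,
      forall t : R, is_derive t 1 x (h (x t)),
      forall t, x (t + T) = x t
    & forall s, 0 < s < T -> exists t, x (t + s) <> x t].

(* An isolated periodic orbit. *)
Definition limit_cycle (R : realType) (h : 'cV[R]_2 -> 'cV[R]_2)
    (x : R -> 'cV[R]_2) (T : R) : Prop :=
  periodic_solution h x T /\
  exists2 e : R, 0 < e &
    forall y S, periodic_solution h y S ->
      (forall t, exists s, `|y t - x s| < e) -> range y = range x.

(* The simple closed curve x surrounds c iff its winding number around c is
   1 or -1; theta is a continuous choice of the polar angle of x - c. *)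
Definition surrounds (R : realType) (x : R -> 'cV[R]_2) (T : R)
    (c : 'cV[R]_2) : Prop :=
  exists rho theta : R -> R,
    [/\ continuous theta,
        forall t, 0 < rho t,
        forall t, x t - c = \col_(i < 2)
          (rho t * (if i == 0 then cos (theta t) else sin (theta t)))
      & `|theta T - theta 0| = 2 * pi].

(* A nondegenerate interval with endpoint a, lying on one side of a. *)
Definition one_sided_interval (R : realType) (a : R) (I : set R) : Prop :=
  [/\ is_interval I, I a, exists2 b, I b & b <> a
    & (forall b, I b -> a <= b) \/ (forall b, I b -> b <= a)].

(* The cycles x alpha born at alphas, with periods T alpha, for alpha in the
   one-sided interval I; at alphas itself the cycle is the equilibrium. *)
Definition hopf_cycles (R : realType) (f : 'cV[R]_2 -> R -> 'cV[R]_2)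
    (x0 : R -> 'cV[R]_2) (omega : R -> R) (alphas : R) (I : set R)
    (x : R -> R -> 'cV[R]_2) (T : R -> R) : Prop :=
  [/\ forall alpha, I alpha -> alpha != alphas ->
        limit_cycle (f ^~ alpha) (x alpha) (T alpha) /\
        surrounds (x alpha) (T alpha) (x0 alpha),
      0 < T alphas /\ (forall t, x alphas t = x0 alphas),
      forall e : R, 0 < e -> \forall alpha \near within I (nbhs alphas),
        forall t, `|x alpha t - x0 alpha| < e
    & (fun alpha => T alpha - 2 * pi / omega alpha)
        @ within I (alphas^') --> 0].

Definition time_average (R : realType) (x : R -> 'cV[R]_2) (T : R) :
    'cV[R]_2 :=
  T^-1 *: \col_i (\int[@lebesgue_measure R]_(t in `[0, T]) x t i 0).

Definition mean_state (R : realType) (x0 : R -> 'cV[R]_2) (I : set R)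
    (x : R -> R -> 'cV[R]_2) (T : R -> R) (alpha : R) : 'cV[R]_2 :=
  if alpha \in I then time_average (x alpha) (T alpha) else x0 alpha.

(* Main.v *)
Require Import Defs.
From HB Require Import structures.
From mathcomp Require Import all_boot all_order all_algebra.
From mathcomp Require Import all_classical all_reals all_analysis.
From mathcomp Require Import complex.
From mathcomp Require Import ring lra.

Set Implicit Arguments.
Unset Strict Implicit.
Unset Printing Implicit Defensive.

Import Order.TTheory GRing.Theory Num.Theory.
Import numFieldNormedType.Exports.

Local Open Scope classical_set_scope.
Local Open Scope ring_scope.
Local Open Scope complex_scope.

(** Write y for the deviation of the cycle from the equilibrium and
z = <p, y> for its complex coordinate, so that y = z q + conj (z q) and
z' = lambda z + n with n = g20/2 z^2 + g11 |z|^2 + g02/2 conj(z)^2 + ...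
Since the mean of y is twice the real part of q times the mean of z, only the
mean of z has to be computed.  The proof extracts it from the identities that
say that the derivative of z^j conj(z)^k has mean zero over a period.

Let M j k be the mean of z^j conj(z)^k over a period, and let eps be
proportional to |z| at time 0.  The identities read
(j lambda + k conj lambda) M j k = - mean of the terms caused by n
(moment_identity).

- For j <> k the factor stays away from 0, so that M j k = O(eps^(j+k+1)).
  A form of odd degree consists of monomials with j <> k and hence has a mean
  one order smaller than its size (bigo_odd_form); this improves the bound to
  O(eps^(j+k+2)) when j + k is even.
- The pair (1, 0) gives lambda (M 1 0) = - g11 (M 1 1) + O(eps^4).
- The pairs (1, 1), (2, 1) and (0, 3) are three equations for M 1 1, M 2 1,
  M 0 3 and M 2 2.  Elimination of M 2 1 and M 0 3 leaves
  mu (M 1 1) + Re(c1) (M 2 2) = O(|mu| eps^4 + eps^6), which is where the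
  first Lyapunov coefficient comes from (hopf_coefficient_algebra,
  bigo_amplitude).
- A Gronwall estimate keeps |z|^2 between two multiples of eps^2, and its
  derivative is O(|mu| eps^2 + eps^3).  Hence M 2 2 is close to (M 1 1)^2 and
  mu + Re(c1) (M 1 1) = O(|mu| eps^2 + eps^4) (amplitude_balance).

As Re(c1) does not vanish and eps tends to 0, this forces eps^2 = O(|mu|), then
M 1 1 = - mu / Re(c1) + O(mu^2) and
M 1 0 = mu g11 / (lambda Re(c1)) + O(mu^2).  Because lambda + conj lambda = 2 mu,
the factor 1 / lambda may be replaced with - 1 / conj lambda, and this is the
formula for K (bigo_mean).

The vector K is unchanged when q is multiplied by s and p by 1 / conj s
(Kvec_scale), so q may be taken with first entry 1.  The coefficients of z' are
then explicit functions of the parameter, continuous at the bifurcation point,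
and the Taylor remainders are uniform in the parameter (taylor_expansion). *)

Local Notation normc := ComplexField.Normc.normc.

(** * Taylor estimates on a segment and symmetry of second derivatives *)

Section Calculus.
Context {R : realType} {V : normedModType R}.
Implicit Types (g : V -> R) (a u v : V).

Lemma is_derive_line g a v (s : R) : differentiable g (a + s *: v) ->
  is_derive s 1 (fun r : R => g (a + r *: v)) ('D_v g (a + s *: v)).
Proof.
move=> dg.
have dl : is_derive s 1 (fun r : R => a + r *: v) v.
  have h := @is_deriveD R R V (cst a) (fun r : R => r *: v) s 1 0 v.
  rewrite -[X in is_derive _ _ _ X]add0r.
  apply: h; have hd := is_diff_scalel s v.
  have hh : differentiable (fun r : R => r *: v) s by apply: ex_diff.
  have := derivableP (diff_derivable hh : derivable _ s 1).
  by rewrite deriveE // diff_val scale1r.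
have dd : differentiable (fun r : R => a + r *: v) s.
  by apply/derivable1_diffP; apply: ex_derive.
have dc : differentiable (g \o (fun r : R => a + r *: v)) s.
  exact: differentiable_comp.
have := derivableP (diff_derivable dc : derivable _ s 1).
rewrite deriveE // diff_comp //= -(deriveE _ dd) derive_val -deriveE //.
Qed.

(** Consecutive functions are derivatives of one another, and the mean value
theorem lowers the order by one. *)
Lemma taylor_bound n (phi : nat -> R -> R) (B : R) :
  (forall i (s : R), (i < n)%N -> is_derive s 1 (phi i) (phi i.+1 s)) ->
  (forall s : R, 0 <= s <= 1 -> `|phi n s| <= B) ->
  forall s : R, 0 <= s <= 1 ->
    `|phi 0%N s - \sum_(i < n) phi i 0 * s ^+ i / i`!%:R| <= B.
Proof.
elim: n phi => [|n IH] phi dphi bphi s s01.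
  by rewrite big_ord0 subr0; exact: bphi.
pose psi (r : R) := phi 0%N r - \sum_(i < n.+1) phi i 0 * r ^+ i / i`!%:R.
pose dpsi (r : R) := phi 1%N r - \sum_(i < n) phi i.+1 0 * r ^+ i / i`!%:R.
have psiD (r : R) : is_derive r 1 psi (dpsi r).
  rewrite /psi /dpsi.
  apply: is_deriveB; first exact: dphi.
  have -> : (fun r : R => \sum_(i < n.+1) phi i 0 * r ^+ i / i`!%:R) =
     \sum_(i < n.+1) (fun r : R => phi i 0 * r ^+ i / i`!%:R).
    by apply/funext => x; rewrite fct_sumE.
  have -> : \sum_(i < n) phi i.+1 0 * r ^+ i / i`!%:R =
     \sum_(i < n.+1) (phi i 0 / i`!%:R) *: (i%:R * r ^+ i.-1).
    rewrite big_ord_recl /= !mul0r scaler0 add0r; apply: eq_bigr => i _.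
    rewrite /bump /= add1n factS natrM scalerAl mulrAC; congr (_ * _).
    rewrite /GRing.scale /= invfM.
    by rewrite -mulrA; congr (_ * _); rewrite mulrAC mulVf ?mul1r// pnatr_eq0.
  apply: is_derive_sum => i.
  have -> : (fun r0 : R => phi i 0 * r0 ^+ i / i`!%:R) =
     (phi i 0 / i`!%:R) \*: (fun r : R => r ^+ i).
    by apply/funext => x /=; rewrite mulrAC.
  apply: is_deriveZ.
  apply: DeriveDef; first exact: exprn_derivable.
  by rewrite exp_derive /GRing.scale /= mulr1.
have psi0 : psi 0 = 0.
  rewrite /psi big_ord_recl /= expr0 fact0 !divr1 mulr1 big1 ?addr0 ?subrr//.
  by move=> i _; rewrite /bump /= expr0n /= mulr0 mul0r.
case/andP: (s01) => s0 s1.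
have [c cs] : exists2 c, c \in `[0, s] & psi s - psi 0 = dpsi c * (s - 0).
  apply: MVT_segment => // x.
  apply: continuous_subspaceT => y.
  by apply: differentiable_continuous; apply/derivable1_diffP; apply: ex_derive.
rewrite psi0 !subr0 => eps.
rewrite -/(psi s) eps.
move: cs; rewrite in_itv /= => /andP[c0 cs].
have bd : `|dpsi c| <= B.
  apply: (IH (fun i => phi i.+1)) => [i r ni|r r01|].
  - exact: dphi.
  - exact: bphi.
  - by rewrite c0 (le_trans cs).
rewrite normrM (ger0_norm s0) -[B]mulr1; apply: ler_pM => //.
Qed.

(** The left-hand side is unchanged when x and y are exchanged, while the
right-hand side differentiates along x first; comparing the two readings at
scale h is what makes mixed derivatives commute. *)
Lemma double_difference g a x y (h : R) : (forall b, differentiable g b) ->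
  (forall b, differentiable ('D_x g) b) -> 0 < h ->
  exists c d : R, [/\ 0 <= c <= h, 0 <= d <= h &
   g (a + h *: x + h *: y) - g (a + h *: x) - g (a + h *: y) + g a =
   h ^+ 2 * 'D_y ('D_x g) (a + c *: x + d *: y)].
Proof.
move=> dg dx h0.
pose phi (s : R) := g (a + h *: y + s *: x) - g (a + s *: x).
have dphi (s : R) : is_derive s 1 phi
    ('D_x g (a + h *: y + s *: x) - 'D_x g (a + s *: x)).
  by apply: is_deriveB; apply: is_derive_line; exact: dg.
have cphi : {within `[0, h], continuous phi}.
  apply: continuous_subspaceT => s; apply: differentiable_continuous.
  by apply/derivable1_diffP; apply: ex_derive.
have [c cs e1] := MVT_segment (ltW h0) (fun s _ => dphi s) cphi.
pose psi (s : R) := 'D_x g (a + c *: x + s *: y).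
have dpsi (s : R) : is_derive s 1 psi ('D_y ('D_x g) (a + c *: x + s *: y)).
  by apply: is_derive_line; exact: dx.
have cpsi : {within `[0, h], continuous psi}.
  apply: continuous_subspaceT => s; apply: differentiable_continuous.
  by apply/derivable1_diffP; apply: ex_derive.
have [d ds e2] := MVT_segment (ltW h0) (fun s _ => dpsi s) cpsi.
exists c, d; split; first by move: cs; rewrite in_itv.
  by move: ds; rewrite in_itv.
move: e1 e2; rewrite /phi /psi !scale0r !addr0 !subr0.
rewrite (addrAC a (h *: y) (c *: x)) (addrAC a (h *: y) (h *: x)) => e1 e2.
by rewrite e2 in e1; move: e1; set A := g _; set B := g _; set C := g _;
   set D := g _; lra.
Qed.

(** Both iterated derivatives come from the same second difference, so they take
a common value at points arbitrarily near a; continuity does the rest. *)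
Lemma mixed_derivatives_meet g a u v (r : R) : Cn 2 g -> 0 < r ->
  exists b b', [/\ ball a r b, ball a r b' &
    'D_v ('D_u g) b = 'D_u ('D_v g) b'].
Proof.
case=> dg Hg r0.
have [du _] := Hg u; have [dv _] := Hg v.
pose h := r / (`|u| + `|v| + 1).
have k0 : 0 < `|u| + `|v| + 1 by rewrite ltr_wpDl// addr_ge0.
have h0 : 0 < h by rewrite divr_gt0.
have small x y (c d : R) : `|x| + `|y| = `|u| + `|v| ->
   0 <= c <= h -> 0 <= d <= h -> ball a r (a + c *: x + d *: y).
  move=> xy /andP[c0 ch] /andP[d0 dh]; rewrite -ball_normE /=.
  rewrite -addrA opprD addrA subrr add0r normrN (le_lt_trans (ler_normD _ _))//.
  rewrite !normrZ (ger0_norm c0) (ger0_norm d0).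
  apply: (@le_lt_trans _ _ (h * (`|x| + `|y|))).
    by rewrite mulrDr lerD// ler_wpM2r.
  have : h * (`|x| + `|y| + 1) = r by rewrite xy divfK// gt_eqF.
  by rewrite mulrDr mulr1 => <-; rewrite ltrDl.
have [c [d [ch dh e1]]] := double_difference a v dg du h0.
have [c' [d' [ch' dh' e2]]] := double_difference a u dg dv h0.
exists (a + c *: u + d *: v), (a + c' *: v + d' *: u).
split; [exact: small|apply: small => //; exact: addrC|].
have alg (k P Q A B C D E : R) : 0 < k -> A - C - D + E = k * P ->
  B - D - C + E = k * Q -> A = B -> P = Q.
  by move=> k00 E1 E2 E3; apply: (mulfI (lt0r_neq0 k00));
     rewrite -E1 -E2 E3 (addrAC B).
apply: (alg _ _ _ _ _ _ _ _ (exprn_gt0 2 h0) e1 e2).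
by rewrite (addrAC a).
Qed.

Lemma continuous_meet_eq (P Q : V -> R) a :
  {for a, continuous P} -> {for a, continuous Q} ->
  (forall r : R, 0 < r -> exists b b', [/\ ball a r b, ball a r b' & P b = Q b']) ->
  P a = Q a.
Proof.
move=> cP cQ meet.
apply/eqP; rewrite -subr_eq0 -normr_le0; apply/ler_addgt0Pr => e e0.
have e20 : 0 < e / 2 by rewrite divr_gt0.
move/cvgrPdist_lt : cP => /(_ _ e20) /nbhs_ballP[r1 /= r10 H1].
move/cvgrPdist_lt : cQ => /(_ _ e20) /nbhs_ballP[r2 /= r20 H2].
have r0 : 0 < Num.min r1 r2 by rewrite lt_min r10.
have [b [b' [ab ab' bb']]] := meet _ r0.
have b1 : `|Q a - Q b'| < e / 2.
  by apply: H2; apply: le_ball ab'; rewrite ge_min lexx orbT.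
have b2 : `|P a - P b| < e / 2.
  by apply: H1; apply: le_ball ab; rewrite ge_min lexx.
rewrite add0r [e]splitr (le_trans (ler_distD (P b) _ _))//.
by rewrite ltW// ltrD// bb' distrC.
Qed.

Lemma derive_swap g a u v : Cn 2 g -> 'D_u ('D_v g) a = 'D_v ('D_u g) a.
Proof.
move=> g2; apply: (@continuous_meet_eq ('D_u ('D_v g)) ('D_v ('D_u g))).
- by case: g2 => _ Hg; have [_ cv] := Hg v; exact: cv.
- by case: g2 => _ Hg; have [_ cu] := Hg u; exact: cu.
- by move=> r r0; apply: mixed_derivatives_meet.
Qed.

End Calculus.

(** * Taylor expansion in the state variable, uniformly in the base point *)

Lemma sum_ord2 (M : nmodType) (F : 'I_2 -> M) : \sum_(j < 2) F j = F 0 + F 1.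
Proof.
rewrite !big_ord_recl big_ord0 addr0; congr (_ + F _); exact: val_inj.
Qed.

Lemma ord2P (i : 'I_2) : i = 0 \/ i = 1.
Proof.
by case: i => [[|[|//]] Hi]; [left|right]; exact: val_inj.
Qed.

Section StateSpace.
Context {R : realType}.
Local Notation X := ('cV[R]_2 * R)%type.
Implicit Types (g : X -> R) (a : X) (x : 'cV[R]_2).

Definition state_dir x : X := (x, 0).
Definition state_axis (j : 'I_2) : X := state_dir (delta_mx j 0).

Lemma state_dirE x : state_dir x = \sum_(j < 2) x j 0 *: state_axis j.
Proof.
rewrite /state_axis /state_dir !big_ord_recl big_ord0 addr0.
congr pair; last by rewrite /= !scaler0 addr0.
rewrite /=; apply/matrixP => i k; rewrite ord1 !mxE /=.
by case: i => [[|[|//]] Hi]; rewrite /= ?mulr0 ?mulr1 ?addr0 ?add0r;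
   congr (x _ _); apply: val_inj.
Qed.

Lemma derive_state g a x : differentiable g a ->
  'D_(state_dir x) g a = \sum_(j < 2) x j 0 * 'D_(state_axis j) g a.
Proof.
move=> dg; rewrite state_dirE deriveE// linear_sum; apply: eq_bigr => j _.
by rewrite linearZ /= -deriveE.
Qed.

Lemma axis_derive_subproof : {D : 'I_2 -> (X -> R) -> X -> R |
  forall j g, D j g = 'D_(state_axis j) g}.
Proof. by exists (fun j g => 'D_(state_axis j) g). Qed.

(** Kept abstract behind axis_deriveE, so that the limit which defines a
directional derivative is never unfolded. *)
Definition axis_derive : 'I_2 -> (X -> R) -> X -> R := sval axis_derive_subproof.

Lemma axis_deriveE j g : axis_derive j g = 'D_(state_axis j) g.
Proof. exact: (svalP axis_derive_subproof). Qed.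

Lemma Cn_axis_derive n j g : Cn n.+1 g -> Cn n (axis_derive j g).
Proof. by rewrite axis_deriveE => -[_]; exact. Qed.

(** The value at x of the degree d form whose coefficients are the iterated
derivatives of g at a, without the factor 1 / d!. *)
Fixpoint taylor_term d g a x : R :=
  if d is d'.+1 then
    \sum_(j < 2) x j 0 * taylor_term d' (axis_derive j g) a x
  else g a.

Lemma taylor_termS d g a x : taylor_term d.+1 g a x =
  x 0 0 * taylor_term d (axis_derive 0 g) a x +
  x 1 0 * taylor_term d (axis_derive 1 g) a x.
Proof. exact: sum_ord2. Qed.

Lemma is_derive_taylor_term d g a x (s : R) : Cn d.+1 g ->
  is_derive s 1 (fun r : R => taylor_term d g (a + r *: state_dir x) x)
    (taylor_term d.+1 g (a + s *: state_dir x) x).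
Proof.
elim: d g => [|d IH] g.
  move=> [dg _] /=.
  have := is_derive_line (dg (a + s *: state_dir x)).
  rewrite derive_state//.
  by under [X in _ -> is_derive _ _ _ X]eq_bigr do rewrite axis_deriveE.
move=> gn.
have -> : (fun r : R => taylor_term d.+1 g (a + r *: state_dir x) x) =
   \sum_(j < 2) (x j 0 \*: (fun r : R => taylor_term d (axis_derive j g) (a + r *: state_dir x) x)).
  by apply/funext => r; rewrite fct_sumE /=.
apply: is_derive_sum => j; apply: is_deriveZ.
by apply: IH; exact: Cn_axis_derive.
Qed.

Lemma Cn_component (V : normedModType R) n (f : V -> 'cV[R]_2) (m : 'I_2) :
  Cn n f -> Cn n (fun v => f v m 0).
Proof.
elim: n f => [|n IH] f /=.
  move=> cf v; apply: (@continuous_comp _ _ _ f (fun M : 'cV[R]_2 => M m 0)).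
    exact: cf.
  exact: coord_continuous.
move=> [df Hf]; split=> [v|u].
  by apply: (@differentiable_comp _ _ _ _ f (fun M : 'cV[R]_2 => M m 0));
    [exact: df|exact: differentiable_coord].
have -> : 'D_u (fun v => f v m 0) = (fun v => 'D_u f v m 0).
  apply/funext => v; rewrite derive_mx ?mxE//.
  exact: diff_derivable.
exact/IH/Hf.
Qed.

Lemma is_derive_coord (u : R -> 'cV[R]_2) (t : R) du (m : 'I_2) :
  is_derive t 1 u du -> is_derive t 1 (fun s => u s m 0) (du m 0).
Proof.
move=> [dru <-]; apply: DeriveDef; first by move/derivable_mxP : dru; exact.
by rewrite derive_mx// mxE.
Qed.

Lemma coord_le_norm x (j : 'I_2) : `|x j 0| <= `|x|.
Proof.
rewrite [leRHS]/Num.Def.normr/= mx_normrE.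
exact: (le_bigmax _ (fun i : 'I_2 * 'I_1 => `|x i.1 i.2|) (j, 0)).
Qed.

Lemma norm_le_coords (v : 'cV[R]_2) : `|v| <= `|v 0 0| + `|v 1 0|.
Proof.
rewrite [leLHS]/Num.Def.normr/= mx_normrE.
apply: bigmax_le => [|[i j] _ /=]; first by rewrite addr_ge0.
rewrite (ord1 j).
by case: (ord2P i) => ->; rewrite ?lerDl ?lerDr.
Qed.

Lemma norm_two_terms (x0 x1 t0 t1 N C0 C1 M : R) :
  `|x0| <= N -> `|x1| <= N -> `|t0| <= C0 * M -> `|t1| <= C1 * M ->
  `|x0 * t0 + x1 * t1| <= (C0 + C1) * (N * M).
Proof.
move=> xN0 xN1 tC0 tC1; rewrite (le_trans (ler_normD _ _))//.
by rewrite !normrM mulrDl lerD// mulrCA ler_pM.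
Qed.

Lemma taylor_term_bound d g a : Cn d g -> exists2 C : R, 0 <= C &
  \forall b \near a, forall x, `|taylor_term d g b x| <= C * `|x| ^+ d.
Proof.
elim: d g => [|d IH] g.
  move=> cg; exists (`|g a| + 1); first by rewrite addr_ge0.
  have /cvgrPdist_lt/(_ _ ltr01) := cg a.
  apply: filterS => b gb x; rewrite expr0 mulr1 /= ltW//.
  by rewrite -ltrBlDl (le_lt_trans (lerB_dist _ _))// distrC.
move=> gn.
have H j : exists2 C : R, 0 <= C & \forall b \near a, forall x,
   `|taylor_term d (axis_derive j g) b x| <= C * `|x| ^+ d.
  by apply: IH; exact: Cn_axis_derive.
have [C0 C00 H0] := H 0; have [C1 C10 H1] := H 1.
exists (C0 + C1); first exact: addr_ge0.
apply: filterS2 H0 H1 => b H0 H1 x; rewrite taylor_termS exprS.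
exact: (norm_two_terms (coord_le_norm _ _) (coord_le_norm _ _) (H0 x) (H1 x)).
Qed.

Lemma CnS (V : normedModType R) n (f : V -> R) : Cn n.+1 f -> Cn n f.
Proof.
elim: n f => [|n IH] f [df Hf].
  by move=> v; apply: differentiable_continuous; exact: df.
by split=> // v; apply: IH; exact: Hf.
Qed.

Lemma Cn_le (V : normedModType R) m n (f : V -> R) : (m <= n)%N -> Cn n f -> Cn m f.
Proof.
move=> mn; rewrite -(subnKC mn); elim: (n - m)%N => [|k IH]; first by rewrite addn0.
by rewrite addnS => /CnS.
Qed.

Lemma norm_state_dir x : `|state_dir x| = `|x|.
Proof. by rewrite /state_dir prod_normE /= normr0; apply/max_idPl. Qed.

(** The base point b varies along with x: in the application it is the
equilibrium, which moves with the parameter, and the constant must not depend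
on the parameter. *)
Lemma taylor_expansion n g a : Cn n g -> exists C r : R, [/\ 0 <= C, 0 < r &
  forall b x, `|a - b| < r -> `|x| < r ->
  `|g (b + state_dir x) - \sum_(d < n) taylor_term d g b x / d`!%:R|
     <= C * `|x| ^+ n].
Proof.
move=> gn; have [C C0] := taylor_term_bound a gn.
move=> /nbhs_ballP[r /= r0 HC].
exists C, (r / 2); split=> // [|b x ab xr]; first by rewrite divr_gt0.
have H (s : R) : 0 <= s <= 1 ->
    `|taylor_term n g (b + s *: state_dir x) x| <= C * `|x| ^+ n.
  move=> /andP[s0 s1]; apply: HC; rewrite -ball_normE /=.
  rewrite opprD addrA [r]splitr (le_lt_trans (ler_normB _ _))// ltr_leD//.
  rewrite normrZ norm_state_dir ger0_norm// (le_trans _ (ltW xr))//.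
  by rewrite ler_piMl.
have Hd i (s : R) : (i < n)%N ->
    is_derive s 1 (fun r : R => taylor_term i g (b + r *: state_dir x) x)
    (taylor_term i.+1 g (b + s *: state_dir x) x).
  move=> ni; apply: is_derive_taylor_term.
  exact: Cn_le gn.
have b0 : b + 0 *: state_dir x = b by rewrite scale0r addr0.
have := @taylor_bound R n
  (fun i r => taylor_term i g (b + r *: state_dir x) x) _ Hd H 1.
rewrite ler01 lexx scale1r => /(_ isT).
rewrite /= b0; under eq_bigr do rewrite expr1n mulr1.
by apply.
Qed.

End StateSpace.

(** * Means over an interval *)

Section Mean.
Context {R : realType} (T : R) (T_gt0 : 0 < T).
Implicit Types f g : R -> R.

Definition mean f : R := T^-1 * \int[@lebesgue_measure R]_(t in `[0, T]) f t.

Lemma integrable_itv f : continuous f ->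
  (@lebesgue_measure R).-integrable `[0, T] (EFin \o f).
Proof.
move=> cf; apply: continuous_compact_integrable; first exact: segment_compact.
exact: continuous_subspaceT.
Qed.

Lemma meanD f g : continuous f -> continuous g ->
  mean (fun t => f t + g t) = mean f + mean g.
Proof.
by move=> cf cg; rewrite /mean RintegralD ?mulrDr//; exact: integrable_itv.
Qed.

Lemma meanZ (c : R) f : continuous f -> mean (fun t => c * f t) = c * mean f.
Proof.
by move=> cf; rewrite /mean RintegralZl// 1?mulrCA//; exact: integrable_itv.
Qed.

Lemma mean_cst (c : R) : mean (fun=> c) = c.
Proof.
rewrite /mean Rintegral_cst//= lebesgue_measure_itv/= lte_fin T_gt0 oppr0 addr0.
by rewrite mulrCA mulVf ?mulr1 ?gt_eqF.
Qed.

Lemma mean_le f g : continuous f -> continuous g ->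
  (forall t, 0 <= t <= T -> f t <= g t) -> mean f <= mean g.
Proof.
move=> cf cg fg; rewrite /mean; apply: ler_wpM2l.
  by rewrite invr_ge0 ltW.
apply: le_Rintegral; [by []|exact: integrable_itv|exact: integrable_itv|].
by move=> t /=; rewrite in_itv /=; exact: fg.
Qed.

Lemma mean_bound f (B : R) : continuous f -> (forall t, 0 <= t <= T -> `|f t| <= B) ->
  `|mean f| <= B.
Proof.
move=> cf fB.
have cB (c : R) : continuous (fun _ : R => c) by exact: cst_continuous.
rewrite ler_norml -{1}(mean_cst (- B)) -{2}(mean_cst B).
by apply/andP; split; apply: mean_le => // t /fB; rewrite ler_norml => /andP[].
Qed.

(** The fundamental theorem of calculus: periodic functions have derivatives
of mean zero. *)
Lemma mean_derive0 f g : (forall t : R, is_derive t 1 f (g t)) -> continuous g ->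
  f T = f 0 -> mean g = 0.
Proof.
move=> fg cg fT.
have cf : continuous f.
  move=> t; apply: differentiable_continuous; apply/derivable1_diffP.
  exact: ex_derive.
rewrite /mean /Rintegral (@continuous_FTC2 _ _ f)//.
- by rewrite fT -EFinB subrr mulr0.
- exact: continuous_subspaceT.
- split=> [t _||]; first exact: ex_derive.
  + exact/cvg_at_right_filter/cf.
  + exact/cvg_at_left_filter/cf.
- by move=> t _; rewrite derive1E derive_val.
Qed.

End Mean.

(** * Complex-valued functions of time *)

Section ComplexCalculus.
Context {R : realType}.
Implicit Types (x y : R[i]) (f g : R -> R[i]).
Local Notation Re := (@complex.Re R).
Local Notation Im := (@complex.Im R).

Lemma Re_add x y : Re (x + y) = Re x + Re y. Proof. by case: x y => ? ? []. Qed.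
Lemma Im_add x y : Im (x + y) = Im x + Im y. Proof. by case: x y => ? ? []. Qed.
Lemma Re_mul x y : Re (x * y) = Re x * Re y - Im x * Im y.
Proof. by case: x y => ? ? []. Qed.
Lemma Im_mul x y : Im (x * y) = Re x * Im y + Im x * Re y.
Proof. by case: x y => ? ? []. Qed.
Lemma Re_conjc x : Re x^*%C = Re x. Proof. by case: x. Qed.
Lemma Im_conjc x : Im x^*%C = - Im x. Proof. by case: x. Qed.

Lemma normc_ge0 x : 0 <= normc x.
Proof. by case: x => a b; exact: sqrtr_ge0. Qed.

Lemma normc_conj x : normc x^*%C = normc x.
Proof. by case: x => a b /=; rewrite sqrrN. Qed.

Lemma normc_sqr x : normc x ^+ 2 = Re x ^+ 2 + Im x ^+ 2.
Proof. by case: x => a b /=; rewrite sqr_sqrtr// addr_ge0 ?sqr_ge0. Qed.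

Lemma normcr (a : R) : normc a%:C = `|a|.
Proof. by rewrite /= expr0n addr0 sqrtr_sqr. Qed.

Lemma normr_Re_le x : `|Re x| <= normc x.
Proof.
rewrite -sqrtr_sqr -[normc x]ger0_norm ?normc_ge0// -[leRHS]sqrtr_sqr normc_sqr.
by rewrite ler_wsqrtr// lerDl sqr_ge0.
Qed.

Lemma normr_Im_le x : `|Im x| <= normc x.
Proof.
rewrite -sqrtr_sqr -[normc x]ger0_norm ?normc_ge0// -[leRHS]sqrtr_sqr normc_sqr.
by rewrite ler_wsqrtr// lerDr sqr_ge0.
Qed.

Lemma normc_le x : normc x <= `|Re x| + `|Im x|.
Proof.
rewrite -[leLHS]ger0_norm ?normc_ge0// -[leLHS]sqrtr_sqr normc_sqr.
rewrite -[leRHS]ger0_norm ?addr_ge0// -[leRHS]sqrtr_sqr ler_wsqrtr//.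
by rewrite sqrrD !real_normK ?num_real// lerD2r lerDl mulrn_wge0 ?mulr_ge0.
Qed.

Definition ccontinuous f :=
  continuous (fun t => Re (f t)) /\ continuous (fun t => Im (f t)).

Lemma ccontinuous_cst x : ccontinuous (fun=> x).
Proof. by split; exact: cst_continuous. Qed.

Lemma ccontinuousD f g : ccontinuous f -> ccontinuous g ->
  ccontinuous (fun t => f t + g t).
Proof.
move=> [rf mf] [rg mg]; split=> t.
  by under eq_fun do rewrite Re_add; apply: cvgD; [exact: rf|exact: rg].
by under eq_fun do rewrite Im_add; apply: cvgD; [exact: mf|exact: mg].
Qed.

Lemma ccontinuousM f g : ccontinuous f -> ccontinuous g ->
  ccontinuous (fun t => f t * g t).
Proof.
move=> [rf mf] [rg mg]; split=> t.
  under eq_fun do rewrite Re_mul.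
  by apply: cvgB; apply: cvgM;
    [exact: rf|exact: rg|exact: mf|exact: mg].
under eq_fun do rewrite Im_mul.
by apply: cvgD; apply: cvgM;
    [exact: rf|exact: mg|exact: mf|exact: rg].
Qed.

Lemma ccontinuousJ f : ccontinuous f -> ccontinuous (fun t => (f t)^*%C).
Proof.
move=> [rf mf]; split=> t.
  by under eq_fun do rewrite Re_conjc; exact: rf.
by under eq_fun do rewrite Im_conjc; apply: cvgN; exact: mf.
Qed.

Lemma ccontinuousX f n : ccontinuous f -> ccontinuous (fun t => f t ^+ n).
Proof.
move=> cf; elim: n => [|n IH]; first exact: ccontinuous_cst.
by under eq_fun do rewrite exprS; exact: ccontinuousM.
Qed.

(** Componentwise, like continuity and means of complex functions: the calculus of
real functions then applies directly. *)
Definition is_cderive (t : R) f x :=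
  is_derive t 1 (fun s => Re (f s)) (Re x) /\
  is_derive t 1 (fun s => Im (f s)) (Im x).

Lemma is_cderive_cst (t : R) x : is_cderive t (fun=> x) 0.
Proof. by split; exact: is_derive_cst. Qed.

Lemma is_cderiveM (t : R) f g x y : is_cderive t f x -> is_cderive t g y ->
  is_cderive t (fun s => f s * g s) (x * g t + f t * y).
Proof.
move=> [rf mf] [rg mg]; split.
  under eq_fun do rewrite Re_mul.
  have h := is_deriveB (is_deriveM rf rg) (is_deriveM mf mg).
  apply: is_derive_eq h _.
  by rewrite Re_add !Re_mul /GRing.scale /=; ring.
under eq_fun do rewrite Im_mul.
have h := is_deriveD (is_deriveM rf mg) (is_deriveM mf rg).
apply: is_derive_eq h _.
by rewrite Im_add !Im_mul /GRing.scale /=; ring.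
Qed.

Lemma is_cderiveJ (t : R) f x : is_cderive t f x ->
  is_cderive t (fun s => (f s)^*%C) x^*%C.
Proof.
move=> [rf mf]; split.
  by under eq_fun do rewrite Re_conjc; rewrite Re_conjc.
by under eq_fun do rewrite Im_conjc; rewrite Im_conjc; exact: is_deriveN.
Qed.

Lemma is_cderiveX (t : R) f x n : is_cderive t f x ->
  is_cderive t (fun s => f s ^+ n) (n%:R * f t ^+ n.-1 * x).
Proof.
move=> df; elim: n => [|n IH].
  by rewrite !mul0r; exact: is_cderive_cst.
under eq_fun do rewrite exprS.
have -> : n.+1%:R * f t ^+ n.+1.-1 * x =
   x * f t ^+ n + f t * (n%:R * f t ^+ n.-1 * x).
  by case: n {IH} => [|n]; rewrite ?expr0 /= -?natr1 ?exprS; ring.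
exact: is_cderiveM.
Qed.

Lemma is_cderiveR (t : R) (u : R -> R) (du : R) : is_derive t 1 u du ->
  is_cderive t (fun s => (u s)%:C) du%:C.
Proof. by split=> //=; exact: is_derive_cst. Qed.

Lemma is_cderiveD (t : R) f g x y : is_cderive t f x -> is_cderive t g y ->
  is_cderive t (fun s => f s + g s) (x + y).
Proof.
move=> [rf mf] [rg mg]; split.
  by under eq_fun do rewrite Re_add; rewrite Re_add; exact: is_deriveD.
by under eq_fun do rewrite Im_add; rewrite Im_add; exact: is_deriveD.
Qed.

Lemma ccontinuousR (u : R -> R) : continuous u -> ccontinuous (fun s => (u s)%:C).
Proof. by split=> //= t; exact: cvg_cst. Qed.

Lemma is_derive_sqr_normc (u : R -> R[i]) (t : R) du : is_cderive t u du ->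
  is_derive t 1 (fun s => normc (u s) ^+ 2) (2 * Re ((u t)^*%C * du)).
Proof.
move=> [ru mu].
have h := is_deriveD (is_deriveM ru ru) (is_deriveM mu mu).
have -> : (fun s => normc (u s) ^+ 2) =
    (fun s => Re (u s)) * (fun s => Re (u s)) + (fun s => Im (u s)) * (fun s => Im (u s)).
  by apply/funext => s; rewrite normc_sqr !expr2.
apply: is_derive_eq h _.
by rewrite Re_mul Re_conjc Im_conjc /GRing.scale /=; ring.
Qed.

Lemma is_cderive_continuous f g : (forall t, is_cderive t f (g t)) -> ccontinuous f.
Proof.
by move=> df; split=> t; apply: differentiable_continuous;
  apply/derivable1_diffP; case: (df t) => [? ?]; apply: ex_derive.
Qed.

End ComplexCalculus.

Section ComplexMean.
Context {R : realType} (T : R) (T_gt0 : 0 < T).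
Implicit Types (x y : R[i]) (f g : R -> R[i]).
Local Notation Re := (@complex.Re R).
Local Notation Im := (@complex.Im R).

Definition cmean f : R[i] :=
  mean T (fun t => Re (f t)) +i* mean T (fun t => Im (f t)).

Lemma cmeanD f g : ccontinuous f -> ccontinuous g ->
  cmean (fun t => f t + g t) = cmean f + cmean g.
Proof.
move=> [rf mf] [rg mg]; rewrite /cmean.
have -> : (fun t => Re (f t + g t)) = (fun t => Re (f t) + Re (g t)).
  by apply/funext => t; rewrite Re_add.
have -> : (fun t => Im (f t + g t)) = (fun t => Im (f t) + Im (g t)).
  by apply/funext => t; rewrite Im_add.
by rewrite !meanD.
Qed.

Lemma cmeanZ x f : ccontinuous f -> cmean (fun t => x * f t) = x * cmean f.
Proof.
move=> [rf mf]; rewrite /cmean.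
have cZ c (h : R -> R) : continuous h -> continuous (fun t => c * h t).
  by move=> ch t; apply: cvgM; [exact: cvg_cst|exact: ch].
have -> : (fun t => Re (x * f t)) =
    (fun t => Re x * Re (f t) + (- Im x) * Im (f t)).
  by apply/funext => t; rewrite Re_mul mulNr.
have -> : (fun t => Im (x * f t)) = (fun t => Re x * Im (f t) + Im x * Re (f t)).
  by apply/funext => t; rewrite Im_mul.
rewrite !meanD ?meanZ//; try exact: cZ.
by case: x => a b /=; rewrite mulNr.
Qed.

Lemma cmeanJ f : ccontinuous f -> cmean (fun t => (f t)^*%C) = (cmean f)^*%C.
Proof.
move=> [rf mf]; rewrite /cmean /=.
have -> : (fun t => Re (f t)^*%C) = (fun t => Re (f t)).
  by apply/funext => t; rewrite Re_conjc.
have -> : (fun t => Im (f t)^*%C) = (fun t => -1 * Im (f t)).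
  by apply/funext => t; rewrite Im_conjc mulN1r.
by rewrite meanZ// mulN1r.
Qed.

Lemma cmean_bound f (B : R) : ccontinuous f ->
  (forall t, 0 <= t <= T -> normc (f t) <= B) -> normc (cmean f) <= 2 * B.
Proof.
move=> [rf mf] fB; rewrite (le_trans (normc_le _))//= mulr_natl mulr2n.
rewrite lerD// mean_bound// => t /fB; apply: le_trans.
  exact: normr_Re_le.
exact: normr_Im_le.
Qed.

Lemma cmean_derive0 f g : (forall t, is_cderive t f (g t)) -> ccontinuous g ->
  f T = f 0 -> cmean g = 0.
Proof.
move=> fg [rg mg] fT; rewrite /cmean.
have -> : mean T (fun t => Re (g t)) = 0.
  by apply: (mean_derive0 T_gt0 (fun t => proj1 (fg t)) rg); rewrite fT.
have -> // : mean T (fun t => Im (g t)) = 0.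
by apply: (mean_derive0 T_gt0 (fun t => proj2 (fg t)) mg); rewrite fT.
Qed.

End ComplexMean.

(** * Growth of functions controlled by their derivative *)

Section Estimates.
Context {R : realType}.

Lemma le_oscillation (f df : R -> R) (T B : R) :
  (forall t : R, is_derive t 1 f (df t)) ->
  (forall t, 0 <= t <= T -> `|df t| <= B) ->
  forall t, 0 <= t <= T -> `|f t - f 0| <= T * B.
Proof.
move=> fdf dfB t /andP[t0 tT].
have cf : {within `[0, t], continuous f}.
  apply: continuous_subspaceT => s; apply: differentiable_continuous.
  by apply/derivable1_diffP; apply: ex_derive.
have [c] := MVT_segment t0 (fun s _ => fdf s) cf.
rewrite in_itv /= subr0 => /andP[c0 ct] ->.
rewrite normrM mulrC (ger0_norm t0) ler_pM//.
by apply: dfB; rewrite c0 (le_trans ct).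
Qed.

Lemma normc_oscillation (f df : R -> R[i]) (T B : R) : 0 <= T ->
  (forall t : R, is_cderive t f (df t)) ->
  (forall t, 0 <= t <= T -> normc (df t) <= B) ->
  forall t, 0 <= t <= T -> normc (f t - f 0) <= 2 * (T * B).
Proof.
move=> T0 fdf dfB t tT; rewrite (le_trans (normc_le _))// mulr_natl mulr2n.
have -> : complex.Re (f t - f 0) = complex.Re (f t) - complex.Re (f 0).
  by case: (f t) (f 0) => ? ? [].
have -> : complex.Im (f t - f 0) = complex.Im (f t) - complex.Im (f 0).
  by case: (f t) (f 0) => ? ? [].
apply: lerD.
  apply: (@le_oscillation (fun t => complex.Re (f t)) (fun t => complex.Re (df t))) tT.
    by move=> s; case: (fdf s).
  by move=> s sT; rewrite (le_trans (normr_Re_le _))// dfB.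
apply: (@le_oscillation (fun t => complex.Im (f t)) (fun t => complex.Im (df t))) tT.
  by move=> s; case: (fdf s).
by move=> s sT; rewrite (le_trans (normr_Im_le _))// dfB.
Qed.

(** Both f t * expR t and f t * expR (- t) are monotone.  The two-sided estimate
prevents the cycle from coming much closer to the equilibrium than eps. *)
Lemma gronwall (f df : R -> R) (T : R) :
  (forall t : R, is_derive t 1 f (df t)) ->
  (forall t, 0 <= t <= T -> `|df t| <= f t) ->
  forall t, 0 <= t <= T -> f t <= expR T * f 0 /\ f 0 <= expR T * f t.
Proof.
move=> fdf dff t /andP[t0 tT].
have T0 : 0 <= T by exact: le_trans tT.
pose g (s : R) := f s * expR (- s); pose h (s : R) := f s * expR s.
have dg (s : R) : is_derive s 1 g ((df s - f s) * expR (- s)).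
  have dN : is_derive s 1 (fun x : R => expR (- x)) (- expR (- s)).
    have := @is_derive1_comp _ expR -%R s _ _ (is_derive_expR (- s)) (is_deriveNid s 1).
    by rewrite mulrN1.
  have := is_deriveM (fdf s) dN.
  move=> H; apply: is_derive_eq H _; rewrite /GRing.scale /=; ring.
have dh (s : R) : is_derive s 1 h ((df s + f s) * expR s).
  have := is_deriveM (fdf s) (is_derive_expR s).
  move=> H; apply: is_derive_eq H _; rewrite /GRing.scale /=; ring.
have ct (k dk : R -> R) : (forall s : R, is_derive s 1 k (dk s)) ->
    {within `[0, T], continuous k}.
  move=> kdk; apply: continuous_subspaceT => s; apply: differentiable_continuous.
  by apply/derivable1_diffP; apply: ex_derive.
have T1 : 1 <= expR T by rewrite -expR0 ler_expR.
have tT' : expR t <= expR T by rewrite ler_expR.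
have fp s : 0 <= s <= T -> 0 <= f s by move=> /dff; exact: le_trans.
have f0 : 0 <= f 0 by apply: fp; rewrite lexx.
have ft : 0 <= f t by apply: fp; rewrite t0.
split.
  have : g t <= g 0.
    apply: (@ler0_derive1_nincr _ g 0 T) => //; try exact: (ct _ _ dg).
    move=> s; rewrite in_itv /= => /andP[/ltW s0 /ltW sT].
    rewrite derive1E derive_val pmulr_lle0 ?expR_gt0// subr_le0.
    by rewrite (le_trans (ler_norm _))// dff// s0.
  rewrite /g oppr0 expR0 mulr1 expRN ler_pdivrMr ?expR_gt0// => H.
  by rewrite (le_trans H)// mulrC ler_wpM2r.
have : h 0 <= h t.
  apply: (@ger0_derive1_ndecr _ h 0 T) => //; try exact: (ct _ _ dh).
  move=> s; rewrite in_itv /= => /andP[/ltW s0 /ltW sT].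
  rewrite derive1E derive_val pmulr_lge0 ?expR_gt0// -lerBlDr sub0r.
  by rewrite lerNl (le_trans (ler_norm _))// normrN dff// s0.
rewrite /h expR0 mulr1 => H.
by rewrite (le_trans H)// mulrC ler_wpM2r.
Qed.

End Estimates.

(** In |m| <= |mu| + K |mu| e + K e^2 the last term is at most half of kk e, hence
at most half of |m|, and can be absorbed in the left-hand side. *)
Lemma amplitude_le (R : realFieldType) (K mu m e kk : R) :
  0 < kk -> 0 <= K -> 0 <= e <= 1 -> kk * e <= `|m| ->
  `|mu + m| <= K * (`|mu| * e + e ^+ 2) -> 2 * K * e <= kk ->
  e <= 2 * (1 + K) / kk * `|mu|.
Proof.
move=> kk0 K0 /andP[e0 e1] km mm es; rewrite mulrAC ler_pdivlMr//.
have : `|m| <= `|mu| + `|mu + m|.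
  by rewrite -[X in `|X| <= _](addKr mu) (le_trans (ler_normD _ _))// normrN.
have M0 : 0 <= `|mu| by [].
move: km mm M0; set M := `|mu|; set Y := `|m|; set X := `|mu + m|.
move=> km mm M0 tri.
have h1 : K * (M * e) <= K * M.
  by apply: ler_wpM2l => //; exact: ler_piMr.
have h2 : (2 * K * e) * e <= kk * e by apply: ler_wpM2r.
nra.
Qed.

(** * Orders of magnitude along a family of periodic functions *)

Section BigO.
Context {R : realType} (F : set_system R) {FF : Filter F} (T : R -> R).
Implicit Types (f : R -> R -> R[i]) (g : R -> R).

(** The bound is uniform in t over one period; a quantity that depends on the
parameter only is a function that ignores t. *)
Definition bigo f g := exists2 C : R, 0 <= C &
  \forall a \near F, forall t, 0 <= t <= T a -> normc (f a t) <= C * g a.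

Lemma bigo_ext f1 f2 g :
  (\forall a \near F, forall t, 0 <= t <= T a -> f1 a t = f2 a t) ->
  bigo f1 g -> bigo f2 g.
Proof.
move=> f12 [C C0 H]; exists C => //.
by apply: filterS2 f12 H => a f12 H t tT; rewrite -f12// H.
Qed.

Lemma bigo_le f g1 g2 : (\forall a \near F, g1 a <= g2 a) ->
  bigo f g1 -> bigo f g2.
Proof.
move=> g12 [C C0 H]; exists C => //.
apply: filterS2 g12 H => a g12 H t tT.
by rewrite (le_trans (H _ tT))// ler_wpM2l.
Qed.

Lemma bigoD f1 f2 g : bigo f1 g -> bigo f2 g ->
  bigo (fun a t => f1 a t + f2 a t) g.
Proof.
move=> [C1 C10 H1] [C2 C20 H2]; exists (C1 + C2); first exact: addr_ge0.
apply: filterS2 H1 H2 => a H1 H2 t tT.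
by rewrite mulrDl (le_trans (le_normcD _ _))// lerD// ?H1 ?H2.
Qed.

Lemma bigoM f1 f2 g1 g2 : bigo f1 g1 -> bigo f2 g2 ->
  bigo (fun a t => f1 a t * f2 a t) (fun a => g1 a * g2 a).
Proof.
move=> [C1 C10 H1] [C2 C20 H2]; exists (C1 * C2); first exact: mulr_ge0.
apply: filterS2 H1 H2 => a H1 H2 t tT.
by rewrite mulrACA ComplexField.Normc.normcM ler_pM ?normc_ge0 ?H1 ?H2.
Qed.

Lemma bigo_cst (c : R[i]) : bigo (fun _ _ => c) (fun=> 1).
Proof.
exists (normc c); first exact: normc_ge0.
by apply: filterE => a t _; rewrite mulr1.
Qed.

Lemma bigo0 g : (\forall a \near F, 0 <= g a) -> bigo (fun _ _ => 0) g.
Proof.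
move=> g0; exists 0 => //; apply: filterS g0 => a g0 t _.
by rewrite ComplexField.Normc.normc0 mul0r.
Qed.

Lemma bigoMl c f g : bigo c (fun=> 1) -> bigo f g ->
  bigo (fun a t => c a t * f a t) g.
Proof.
move=> c1 fg; have [C C0 H] := bigoM c1 fg; exists C => //.
by apply: filterS H => a H t tT; rewrite -[g a]mul1r H.
Qed.

Lemma bigoZ (c : R[i]) f g : bigo f g -> bigo (fun a t => c * f a t) g.
Proof. exact/bigoMl/bigo_cst. Qed.

Lemma bigoN f g : bigo f g -> bigo (fun a t => - f a t) g.
Proof.
move=> /(bigoZ (-1)); apply: bigo_ext.
by apply: filterE => a t _; rewrite mulN1r.
Qed.

Lemma bigoB f1 f2 g : bigo f1 g -> bigo f2 g ->
  bigo (fun a t => f1 a t - f2 a t) g.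
Proof. by move=> ? ?; apply: bigoD => //; exact: bigoN. Qed.

Lemma bigoJ f g : bigo f g -> bigo (fun a t => (f a t)^*%C) g.
Proof.
move=> [C C0 H]; exists C => //.
by apply: filterS H => a H t tT; rewrite normc_conj H.
Qed.

Lemma bigoX f g n : bigo f g -> bigo (fun a t => f a t ^+ n) (fun a => g a ^+ n).
Proof.
move=> fg; elim: n => [|n IH].
  by under eq_fun do under eq_fun do rewrite expr0; exact: bigo_cst.
under eq_fun do under eq_fun do rewrite exprS.
by under [X in bigo _ X]eq_fun do rewrite exprS; exact: bigoM.
Qed.

Lemma bigo_cmean f g : (\forall a \near F, 0 < T a) ->
  (\forall a \near F, ccontinuous (f a)) ->
  bigo f g -> bigo (fun a _ => cmean (T a) (f a)) g.
Proof.
move=> T0 cf [C C0 H]; exists (2 * C); first exact: mulr_ge0.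
apply: filterS3 T0 cf H => a T0 cf H t _.
by rewrite -mulrA; apply: cmean_bound.
Qed.

End BigO.

(** * Moments of a small periodic orbit *)

(** Here r and s are the defects of the moment equations (2, 1) and (0, 3), with
the multiples of mu removed: what remains in front of m21 and m03 is i w and
- i w.  The combination on the right solves these equations for m21 and m03 and
substitutes the result in the equation (1, 1); its coefficient of m22 is the
first Lyapunov coefficient at mu = 0. *)
Lemma hopf_coefficient_algebra (R : realType) (A B C D m21 m03 m22 m11 : R[i])
    (mu w : R) :
  let lam := mu +i* w in
  let W := A * m21 + B * m21^*%C + C * m03 + D * m22 in
  let r := (2 * lam + lam^*%C) * m21 + (2 * B + A^*%C) * m22 - 3 * mu%:C * m21 in
  let s := lam^*%C * m03 + C^*%C * m22 - mu%:C * m03 in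
  w != 0 -> m22^*%C = m22 ->
  mu%:C * m11 + (complex.Re D - complex.Im (A * B) / w)%:C * m22 =
  2^-1%:C * ((lam + lam^*%C) * m11 + (W + W^*%C)) -
  2^-1%:C * (('i * w^-1%:C) *
    ((B + A^*%C) * r^*%C - (A + B^*%C) * r + (C * s - C^*%C * s^*%C))).
Proof.
move=> lam W r s w0 m22R; rewrite {}/r {}/s {}/W {}/lam.
case: m22 m22R => n1 n2 [] n2E.
have {n2E} -> : n2 = 0 by lra.
rewrite -!(rmorph_nat (real_complex R)).
case: A B C D m21 m03 m11 => [A1 A2] [B1 B2] [C1 C2] [D1 D2] [p1 p2] [q1 q2] [m1 m2].
apply/eqP; rewrite eq_complex /=; apply/andP; split; apply/eqP; field; exact: w0.
Qed.

Section Moments.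
Context {R : realType} (F : set_system R) {FF : Filter F} (T : R -> R).
Context (z : R -> R -> R[i]) (lam : R -> R[i]) (eps : R -> R).
Local Notation bigo := (bigo F T).
Implicit Types (f n : R -> R -> R[i]) (g : R -> R).

Hypothesis T_gt0 : \forall a \near F, 0 < T a.
Hypothesis eps01 : \forall a \near F, 0 <= eps a <= 1.
Hypothesis z_eps : bigo z eps.
Hypothesis z_per : \forall a \near F, z a (T a) = z a 0.
Hypothesis z_cont : \forall a \near F, ccontinuous (z a).

Lemma bigo_eps_le f (i j : nat) : (i <= j)%N ->
  bigo f (fun a => eps a ^+ j) -> bigo f (fun a => eps a ^+ i).
Proof.
move=> ij; apply: bigo_le; apply: filterS eps01 => a /andP[e0 e1].
exact: ler_wiXn2l.
Qed.

Definition monomial j k a t := z a t ^+ j * (z a t)^*%C ^+ k.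
Definition moment j k a := cmean (T a) (monomial j k a).

Lemma bigo_monomial j k : bigo (monomial j k) (fun a => eps a ^+ (j + k)).
Proof.
under [X in bigo _ X]eq_fun do rewrite exprD.
by apply: bigoM; apply: bigoX => //; exact: bigoJ.
Qed.

Lemma ccontinuous_monomial j k a : ccontinuous (z a) -> ccontinuous (monomial j k a).
Proof.
move=> cz; apply: ccontinuousM; apply: ccontinuousX => //.
exact: ccontinuousJ.
Qed.

Lemma monomialJ (c : R[i]) j k a t :
  (c * monomial j k a t)^*%C = c^*%C * monomial k j a t.
Proof.
rewrite /monomial rmorphM /=; congr (_ * _).
by rewrite rmorphM !rmorphXn /= conjcK mulrC.
Qed.

Lemma ccontinuous_monomials (c1 c2 c3 c4 : R[i]) j1 k1 j2 k2 j3 k3 j4 k4 a :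
  ccontinuous (z a) ->
  ccontinuous (fun t => c1 * monomial j1 k1 a t + c2 * monomial j2 k2 a t +
    c3 * monomial j3 k3 a t + c4 * monomial j4 k4 a t).
Proof.
move=> cz.
have cc (c : R[i]) j k : ccontinuous (fun t => c * monomial j k a t).
  by apply: ccontinuousM;
    [exact: ccontinuous_cst|exact: ccontinuous_monomial].
apply: ccontinuousD (cc _ _ _).
apply: ccontinuousD (cc _ _ _).
exact: ccontinuousD (cc _ _ _) (cc _ _ _).
Qed.

Lemma momentJ j k : \forall a \near F, (moment j k a)^*%C = moment k j a.
Proof.
apply: filterS z_cont => a cz; rewrite /moment -cmeanJ.
  congr cmean; apply/funext => t.
  by rewrite /monomial rmorphM !rmorphXn /= conjcK mulrC.
exact: ccontinuous_monomial.
Qed.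

(** Homogeneous polynomials of degree d in z and its conjugate, with coefficients
that are bounded functions of the parameter.  The inductive presentation gives
structural induction without naming coefficients; the last rule is closure
under equality along the filter. *)
Inductive hform : nat -> (R -> R -> R[i]) -> Prop :=
| hform_coef (c : R -> R[i]) : bigo (fun a _ => c a) (fun=> 1) ->
    hform 0 (fun a _ => c a)
| hform_z d f : hform d f -> hform d.+1 (fun a t => z a t * f a t)
| hform_zbar d f : hform d f -> hform d.+1 (fun a t => (z a t)^*%C * f a t)
| hform_add d f1 f2 : hform d f1 -> hform d f2 ->
    hform d (fun a t => f1 a t + f2 a t)
| hform_ext d f1 f2 : (\forall a \near F, forall t, f1 a t = f2 a t) ->
    hform d f1 -> hform d f2.

Lemma bigo_form d f : hform d f -> bigo f (fun a => eps a ^+ d).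
Proof.
elim=> {d f} [c|d f _ IH|d f _ IH|d f1 f2 _ IH1 _ IH2|d f1 f2 f12 _ IH].
- by under [X in _ -> bigo _ X]eq_fun do rewrite expr0.
- by under [X in bigo _ X]eq_fun do rewrite exprS; exact: bigoM.
- by under [X in bigo _ X]eq_fun do rewrite exprS; apply: bigoM => //; exact: bigoJ.
- exact: bigoD.
- by apply: bigo_ext IH; apply: filterS f12 => a f12 t _.
Qed.

Lemma ccontinuous_form d f : hform d f -> \forall a \near F, ccontinuous (f a).
Proof.
elim=> {d f} [c _|d f _ IH|d f _ IH|d f1 f2 _ IH1 _ IH2|d f1 f2 f12 _ IH].
- by apply: filterE => a; exact: ccontinuous_cst.
- by apply: filterS2 z_cont IH => a; exact: ccontinuousM.
- by apply: filterS2 z_cont IH => a cz; apply: ccontinuousM; exact: ccontinuousJ.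
- by apply: filterS2 IH1 IH2 => a; exact: ccontinuousD.
- by apply: filterS2 f12 IH => a /funext <-.
Qed.

Lemma hformZ d f (c : R -> R[i]) : bigo (fun a _ => c a) (fun=> 1) -> hform d f ->
  hform d (fun a t => c a * f a t).
Proof.
move=> bc; elim=> {d f} [c' bc'|d f _ IH|d f _ IH|d f1 f2 _ IH1 _ IH2|d f1 f2 f12 _ IH].
- by apply: hform_coef; exact: bigoMl.
- apply: hform_ext (hform_z IH); apply: filterE => a t; ring.
- apply: hform_ext (hform_zbar IH); apply: filterE => a t; ring.
- apply: hform_ext (hform_add IH1 IH2); apply: filterE => a t; ring.
- by apply: hform_ext IH; apply: filterS f12 => a f12 t; rewrite f12.
Qed.

Lemma hform_scale d f (c : R[i]) : hform d f -> hform d (fun a t => c * f a t).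
Proof. exact/hformZ/bigo_cst. Qed.

Lemma hformJ d f : hform d f -> hform d (fun a t => (f a t)^*%C).
Proof.
elim=> {d f} [c' bc'|d f _ IH|d f _ IH|d f1 f2 _ IH1 _ IH2|d f1 f2 f12 _ IH].
- by apply: hform_coef; exact: bigoJ.
- by apply: hform_ext (hform_zbar IH); apply: filterE => a t; rewrite rmorphM.
- by apply: hform_ext (hform_z IH); apply: filterE => a t; rewrite rmorphM /= conjcK.
- by apply: hform_ext (hform_add IH1 IH2); apply: filterE => a t; rewrite rmorphD.
- by apply: hform_ext IH; apply: filterS f12 => a f12 t; rewrite f12.
Qed.

Lemma hform_monomialM j k d f : hform d f ->
  hform (j + k + d) (fun a t => monomial j k a t * f a t).
Proof.
move=> fd; elim: j => [|j IH].
  elim: k => [|k IH].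
    apply: hform_ext fd; apply: filterE => a t.
    by rewrite /monomial !expr0 !mul1r.
  rewrite add0n addSn; apply: hform_ext (hform_zbar IH); apply: filterE => a t.
  by rewrite /monomial !expr0 exprS; ring.
rewrite !addSn; apply: hform_ext (hform_z IH); apply: filterE => a t.
by rewrite /monomial exprS; ring.
Qed.

Lemma hform_monomial j k (c : R -> R[i]) : bigo (fun a _ => c a) (fun=> 1) ->
  hform (j + k) (fun a t => c a * monomial j k a t).
Proof.
move=> bc; rewrite -[(j + k)%N]addn0.
apply: hform_ext (hform_monomialM j k (hform_coef bc)); apply: filterE => a t.
by rewrite mulrC.
Qed.

Lemma hform0 d : hform d (fun _ _ => 0).
Proof.
rewrite -[d]addn0; apply: hform_ext (hform_monomial d 0 (bigo_cst T 0)).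
by apply: filterE => a t; rewrite mul0r.
Qed.

(** The derivative of the monomial along z' = lam z + n, except for the linear
term, which only multiplies the monomial by j lam + k (conj lam). *)
Definition monomial_drift j k n a t :=
  j%:R * (monomial j.-1 k a t * n a t) +
  k%:R * (monomial j k.-1 a t * (n a t)^*%C).

Lemma monomial_driftD j k n1 n2 a t :
  monomial_drift j k (fun a t => n1 a t + n2 a t) a t =
  monomial_drift j k n1 a t + monomial_drift j k n2 a t.
Proof. by rewrite /monomial_drift rmorphD /=; ring. Qed.

Lemma hform_drift j k m n : hform m.+1 n -> hform (j + k + m) (monomial_drift j k n).
Proof.
move=> nm; apply: hform_add.
  case: j => [|j].
    by apply: hform_ext (hform0 _); apply: filterE => a t; rewrite mul0r.
  by rewrite !addSn -addnS; apply: hform_scale; exact: hform_monomialM.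
case: k => [|k].
  by apply: hform_ext (hform0 _); apply: filterE => a t; rewrite mul0r.
by rewrite addnS !addSn -addnS; apply/hform_scale/hform_monomialM/hformJ.
Qed.

Lemma bigo_drift j k m n : bigo n (fun a => eps a ^+ m.+1) ->
  bigo (monomial_drift j k n) (fun a => eps a ^+ (j + k + m)).
Proof.
move=> nm; have e0 i : \forall a \near F, 0 <= eps a ^+ i.
  by apply: filterS eps01 => a /andP[? _]; exact: exprn_ge0.
apply: bigoD.
  case: j => [|j].
    by apply: bigo_ext (bigo0 _ (e0 _)); apply: filterE => a t _; rewrite mul0r.
  apply: bigoZ; rewrite !addSn -addnS /=.
  under [X in bigo _ X]eq_fun do rewrite exprD.
  by apply: bigoM => //; exact: bigo_monomial.
case: k => [|k].
  by apply: bigo_ext (bigo0 _ (e0 _)); apply: filterE => a t _; rewrite mul0r.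
apply: bigoZ; rewrite addnS !addSn -addnS /=.
under [X in bigo _ X]eq_fun do rewrite exprD.
by apply: bigoM; [exact: bigo_monomial|exact: bigoJ].
Qed.

Lemma ccontinuous_drift j k n a : ccontinuous (z a) -> ccontinuous (n a) ->
  ccontinuous (monomial_drift j k n a).
Proof.
move=> cz cn; apply: ccontinuousD; apply: ccontinuousM.
- exact: ccontinuous_cst.
- by apply: ccontinuousM => //; exact: ccontinuous_monomial.
- exact: ccontinuous_cst.
- apply: ccontinuousM; first exact: ccontinuous_monomial.
  exact: ccontinuousJ.
Qed.

Context (n : R -> R -> R[i]).
Hypothesis n_cont : \forall a \near F, ccontinuous (n a).
Hypothesis ode : \forall a \near F, forall t,
  is_cderive t (z a) (lam a * z a t + n a t).

(** The monomial is periodic, so its derivative has mean zero. *)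
Lemma moment_identity j k : \forall a \near F,
  (j%:R * lam a + k%:R * (lam a)^*%C) * moment j k a =
  - cmean (T a) (monomial_drift j k n a).
Proof.
apply: filterS2 (filterI T_gt0 z_per) (filterI (filterI z_cont n_cont) ode).
move=> a [T0 zT] [[cz cn] dz]; apply/eqP; rewrite -addr_eq0; apply/eqP.
have cm := ccontinuous_monomial j k cz.
rewrite /moment -cmeanZ// -cmeanD//; last exact: ccontinuous_drift.
  apply: (@cmean_derive0 _ _ T0 (monomial j k a)) => [t||].
  - have := is_cderiveM (is_cderiveX j (dz t)) (is_cderiveX k (is_cderiveJ (dz t))).
    congr is_cderive; rewrite rmorphD rmorphM /= /monomial_drift /monomial.
    case: j {cm} => [|j]; case: k => [|k]; rewrite /= ?expr0 ?exprS; ring.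
  - by apply: ccontinuousD; [apply: ccontinuousM => //; exact: ccontinuous_cst|
      exact: ccontinuous_drift].
  - by rewrite /monomial zT.
by apply: ccontinuousM => //; exact: ccontinuous_cst.
Qed.

Context (w0 : R).
Hypothesis w0_gt0 : 0 < w0.
Hypothesis lam_gap : \forall a \near F, w0 <= complex.Im (lam a).

(** The imaginary part is (j - k) times that of lam. *)
Lemma resonance_gap j k : j != k ->
  \forall a \near F, w0 <= normc (j%:R * lam a + k%:R * (lam a)^*%C).
Proof.
move=> jk; apply: filterS lam_gap => a wa.
apply: le_trans (normr_Im_le _).
have -> : complex.Im (j%:R * lam a + k%:R * (lam a)^*%C) =
    (j%:R - k%:R) * complex.Im (lam a).
  rewrite -!(rmorph_nat (real_complex R)).
  by case: (lam a) => x y /=; ring.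
have wa0 : 0 <= complex.Im (lam a) by apply: le_trans wa; exact: ltW.
rewrite normrM (ger0_norm wa0) (le_trans wa)// ler_peMl//.
wlog jk' : j k jk / (k < j)%N.
  move=> H; case: (ltngtP j k) jk => // jk _; last by apply: H; rewrite // gtn_eqF.
  by rewrite distrC; apply: H; rewrite // gtn_eqF.
by rewrite -natrB ?(ltnW jk')// normr_nat ler1n subn_gt0.
Qed.

Lemma resonance_neq0 j k : j != k ->
  \forall a \near F, j%:R * lam a + k%:R * (lam a)^*%C != 0.
Proof.
move=> jk; apply: filterS (resonance_gap jk) => a.
by apply: contraTneq => ->; rewrite ComplexField.Normc.normc0 -ltNge.
Qed.

Lemma bigo_resonance j k : j != k ->
  bigo (fun a _ => (j%:R * lam a + k%:R * (lam a)^*%C)^-1) (fun=> 1).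
Proof.
move=> jk; exists w0^-1; first by rewrite invr_ge0 ltW.
apply: filterS (resonance_gap jk) => a wa t _; rewrite mulr1.
rewrite ComplexField.Normc.normcV lef_pV2 ?posrE//.
exact: lt_le_trans wa.
Qed.

Lemma bigo_solve j k g : j != k ->
  bigo (fun a _ => (j%:R * lam a + k%:R * (lam a)^*%C) * moment j k a) g ->
  bigo (fun a _ => moment j k a) g.
Proof.
move=> jk /(bigoMl (bigo_resonance jk)); apply: bigo_ext.
by apply: filterS (resonance_neq0 jk) => a l0 t _; rewrite mulKf.
Qed.

(* The equation is z' = lam z + n, where n is split into its quadratic, cubic and
quartic forms n4 and a remainder n5 of size eps^5.  Knowing that n4 is a form,
and not only that it is small, lets the odd form rule apply to it. *)
Context (A B C D30 D21 D12 D03 : R -> R[i]) (n4 n5 : R -> R -> R[i]).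
Hypothesis A_bd : bigo (fun a _ => A a) (fun=> 1).
Hypothesis B_bd : bigo (fun a _ => B a) (fun=> 1).
Hypothesis C_bd : bigo (fun a _ => C a) (fun=> 1).
Hypothesis D30_bd : bigo (fun a _ => D30 a) (fun=> 1).
Hypothesis D21_bd : bigo (fun a _ => D21 a) (fun=> 1).
Hypothesis D12_bd : bigo (fun a _ => D12 a) (fun=> 1).
Hypothesis D03_bd : bigo (fun a _ => D03 a) (fun=> 1).

Definition quadratic a t :=
  A a * monomial 2 0 a t + B a * monomial 1 1 a t + C a * monomial 0 2 a t.
Definition cubic a t :=
  D30 a * monomial 3 0 a t + D21 a * monomial 2 1 a t +
  D12 a * monomial 1 2 a t + D03 a * monomial 0 3 a t.

Lemma quadraticJ a t : (quadratic a t)^*%C = (A a)^*%C * monomial 0 2 a t +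
  (B a)^*%C * monomial 1 1 a t + (C a)^*%C * monomial 2 0 a t.
Proof. by rewrite /quadratic !rmorphD /= !monomialJ. Qed.

Hypothesis n4_form : hform 4 n4.
Hypothesis n5_bd : bigo n5 (fun a => eps a ^+ 5).
Hypothesis n_split : \forall a \near F, forall t,
  n a t = quadratic a t + (cubic a t + (n4 a t + n5 a t)).

Lemma hform_quadratic : hform 2 quadratic.
Proof.
exact: hform_add (hform_add (hform_monomial 2 0 A_bd) (hform_monomial 1 1 B_bd))
  (hform_monomial 0 2 C_bd).
Qed.

Lemma hform_cubic : hform 3 cubic.
Proof.
exact: hform_add (hform_add (hform_add (hform_monomial 3 0 D30_bd)
  (hform_monomial 2 1 D21_bd)) (hform_monomial 1 2 D12_bd)) (hform_monomial 0 3 D03_bd).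
Qed.

Lemma bigo_tail4 : bigo (fun a t => n4 a t + n5 a t) (fun a => eps a ^+ 4).
Proof. by apply: bigoD; [exact: bigo_form|exact: bigo_eps_le n5_bd]. Qed.

Lemma bigo_tail3 : bigo (fun a t => cubic a t + (n4 a t + n5 a t))
  (fun a => eps a ^+ 3).
Proof.
by apply: bigoD; [exact/bigo_form/hform_cubic|exact: bigo_eps_le bigo_tail4].
Qed.

Lemma n_eps2 : bigo n (fun a => eps a ^+ 2).
Proof.
apply: (@bigo_ext _ F _ T (fun a t => quadratic a t + (cubic a t + (n4 a t + n5 a t)))).
  by apply: filterS n_split => a H t _; rewrite H.
by apply: bigoD; [exact/bigo_form/hform_quadratic|exact: bigo_eps_le bigo_tail3].
Qed.

Lemma tail4_cont : \forall a \near F, ccontinuous (fun t => n4 a t + n5 a t).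
Proof.
apply: filterS3 n_split n_cont
  (filterI (ccontinuous_form hform_quadratic) (ccontinuous_form hform_cubic)).
move=> a H cn [c2 c3].
have -> : (fun t => n4 a t + n5 a t) =
    (fun t => n a t + (-1 * quadratic a t + -1 * cubic a t)).
  by apply/funext => t; rewrite H; ring.
apply: ccontinuousD => //; apply: ccontinuousD; apply: ccontinuousM => //;
  exact: ccontinuous_cst.
Qed.

Lemma bigo_moment j k : j != k -> bigo (fun a _ => moment j k a)
  (fun a => eps a ^+ (j + k + 1)).
Proof.
move=> jk; apply: bigo_solve => //.
have H : bigo (fun a _ => - cmean (T a) (monomial_drift j k n a))
    (fun a => eps a ^+ (j + k + 1)).
  apply: bigoN; apply: bigo_cmean => //; last exact/bigo_drift/n_eps2.
  by apply: filterS2 z_cont n_cont => a; exact: ccontinuous_drift.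
by apply: bigo_ext H; apply: filterS (moment_identity j k) => a ->.
Qed.

(** Induction on the form moves its factors z and conj z into the monomial; in the
end j + k is odd, so that j differs from k and bigo_moment gains one order. *)
Lemma bigo_odd_form_monomial j k d f : hform d f -> odd (j + k + d) ->
  bigo (fun a _ => cmean (T a) (fun t => monomial j k a t * f a t))
    (fun a => eps a ^+ (j + k + d).+1).
Proof.
move=> fd; elim: fd j k => {d f} [c bc|d f _ IH|d f _ IH|d f1 f2 fd1 IH1 fd2 IH2|d f1 f2 f12 _ IH] j k.
- rewrite addn0 => jk.
  have jNk : j != k by apply: contraTneq jk => ->; rewrite addnn odd_double.
  rewrite -addn1; apply: bigo_ext (bigoMl bc (bigo_moment jNk)).
  apply: filterS z_cont => a cz t _.
  rewrite /moment -cmeanZ; last exact: ccontinuous_monomial.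
  by congr cmean; apply/funext => s; rewrite mulrC.
- rewrite addnS -!addSn => jk; apply: bigo_ext (IH j.+1 k jk).
  apply: filterE => a t _; congr cmean; apply/funext => s.
  by rewrite /monomial exprS; ring.
- rewrite addnS -addSn -addnS => jk; apply: bigo_ext (IH j k.+1 jk).
  apply: filterE => a t _; congr cmean; apply/funext => s.
  by rewrite /monomial exprS; ring.
- move=> jk; apply: bigo_ext (bigoD (IH1 _ _ jk) (IH2 _ _ jk)).
  apply: filterS3 z_cont (ccontinuous_form fd1) (ccontinuous_form fd2).
  move=> a cz c1 c2 t _; have cm := ccontinuous_monomial j k cz.
  rewrite -cmeanD; try exact: ccontinuousM.
  by congr cmean; apply/funext => s; rewrite mulrDr.
- move=> jk; apply: bigo_ext (IH _ _ jk).
  by apply: filterS f12 => a /funext ->.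
Qed.

Lemma bigo_odd_form d f : hform d f -> odd d ->
  bigo (fun a _ => cmean (T a) (f a)) (fun a => eps a ^+ d.+1).
Proof.
move=> fd od; apply: bigo_ext (bigo_odd_form_monomial (j := 0) (k := 0) fd od).
apply: filterE => a t _; congr cmean; apply/funext => s.
by rewrite /monomial !expr0 !mul1r.
Qed.

Lemma cmean_drift_split j k : \forall a \near F,
  cmean (T a) (monomial_drift j k n a) =
  cmean (T a) (monomial_drift j k quadratic a) +
  (cmean (T a) (monomial_drift j k cubic a) +
   cmean (T a) (monomial_drift j k (fun a t => n4 a t + n5 a t) a)).
Proof.
apply: filterS3 (filterI z_cont n_split)
  (filterI (ccontinuous_form hform_quadratic) (ccontinuous_form hform_cubic))
  tail4_cont.
move=> a [cz H] [c2 c3] c4.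
have d2 := ccontinuous_drift j k cz c2; have d3 := ccontinuous_drift j k cz c3.
have d4 := ccontinuous_drift j k cz (n := fun a t => n4 a t + n5 a t) c4.
rewrite -!cmeanD//; last exact: ccontinuousD.
congr cmean; apply/funext => t; rewrite -!monomial_driftD.
by rewrite /monomial_drift H.
Qed.

(** The quadratic terms produce a form of odd degree, whose mean is one order
smaller than its size; all other terms are of that order already. *)
Lemma bigo_even_moment j k : j != k -> ~~ odd (j + k) ->
  bigo (fun a _ => moment j k a) (fun a => eps a ^+ (j + k + 2)).
Proof.
move=> jk ejk; apply: bigo_solve => //.
have ejk1 : odd (j + k + 1) by rewrite addn1.
have q2 : bigo (fun a _ => cmean (T a) (monomial_drift j k quadratic a))
    (fun a => eps a ^+ (j + k + 2)).
  rewrite addn2 -addn1; apply: bigo_odd_form; first exact/hform_drift/hform_quadratic.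
  exact: ejk1.
have q3 : bigo (fun a _ => cmean (T a) (monomial_drift j k cubic a))
    (fun a => eps a ^+ (j + k + 2)).
  apply: bigo_cmean => //.
    by apply: filterS2 z_cont (ccontinuous_form hform_cubic) => a; exact: ccontinuous_drift.
  exact/bigo_drift/bigo_form/hform_cubic.
have q4 : bigo (fun a _ => cmean (T a)
    (monomial_drift j k (fun a t => n4 a t + n5 a t) a))
    (fun a => eps a ^+ (j + k + 2)).
  apply: (@bigo_eps_le _ _ (j + k + 3)%N); first by rewrite leq_add2l.
  apply: bigo_cmean => //; last exact/bigo_drift/bigo_tail4.
  apply: filterS2 z_cont tail4_cont => a cz c4.
  exact: (ccontinuous_drift j k cz (n := fun a t => n4 a t + n5 a t) c4).
apply: bigo_ext (bigoN (bigoD q2 (bigoD q3 q4))).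
by apply: filterS2 (moment_identity j k) (cmean_drift_split j k) => a -> ->.
Qed.

(** For odd j + k the quadratic terms have even degree and do contribute; it is
the cubic terms that have odd degree and drop out. *)
Lemma bigo_odd_moment_equation j k : odd (j + k) ->
  bigo (fun a _ => (j%:R * lam a + k%:R * (lam a)^*%C) * moment j k a +
    cmean (T a) (monomial_drift j k quadratic a))
    (fun a => eps a ^+ (j + k + 3)).
Proof.
move=> ojk.
have ojk2 : odd (j + k + 2) by rewrite addn2 /= negbK.
have q3 : bigo (fun a _ => cmean (T a) (monomial_drift j k cubic a))
    (fun a => eps a ^+ (j + k + 3)).
  rewrite addn3 -addn2; apply: bigo_odd_form; first exact/hform_drift/hform_cubic.
  exact: ojk2.
have q4 : bigo (fun a _ => cmean (T a)
    (monomial_drift j k (fun a t => n4 a t + n5 a t) a))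
    (fun a => eps a ^+ (j + k + 3)).
  apply: bigo_cmean => //; last exact/bigo_drift/bigo_tail4.
  apply: filterS2 z_cont tail4_cont => a cz c4.
  exact: (ccontinuous_drift j k cz (n := fun a t => n4 a t + n5 a t) c4).
apply: bigo_ext (bigoN (bigoD q3 q4)).
apply: filterS2 (moment_identity j k) (cmean_drift_split j k) => a -> -> t _.
ring.
Qed.

Lemma cmean_monomials (c1 c2 c3 c4 : R -> R[i]) j1 k1 j2 k2 j3 k3 j4 k4 :
  \forall a \near F, cmean (T a) (fun t => c1 a * monomial j1 k1 a t +
    c2 a * monomial j2 k2 a t + c3 a * monomial j3 k3 a t +
    c4 a * monomial j4 k4 a t)
  = c1 a * moment j1 k1 a + c2 a * moment j2 k2 a + c3 a * moment j3 k3 a +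
    c4 a * moment j4 k4 a.
Proof.
apply: filterS z_cont => a cz.
have cm j k : ccontinuous (monomial j k a) by exact: ccontinuous_monomial.
have cc (c : R[i]) j k : ccontinuous (fun t => c * monomial j k a t).
  by apply: ccontinuousM => //; exact: ccontinuous_cst.
have cc2 := ccontinuousD (cc (c1 a) j1 k1) (cc (c2 a) j2 k2).
have cc3 := ccontinuousD cc2 (cc (c3 a) j3 k3).
rewrite (cmeanD _ cc3 (cc _ _ _)) (cmeanD _ cc2 (cc _ _ _)).
rewrite (cmeanD _ (cc _ _ _) (cc _ _ _)).
by rewrite !(cmeanZ _ _ (cm _ _)).
Qed.

Lemma bigo_coef_moment (c : R -> R[i]) j k : bigo (fun a _ => c a) (fun=> 1) ->
  j != k -> ~~ odd (j + k) ->
  bigo (fun a _ => c a * moment j k a) (fun a => eps a ^+ (j + k + 2)).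
Proof. by move=> bc jk ejk; apply: bigoMl => //; exact: bigo_even_moment. Qed.

Lemma bigo_moment10 :
  bigo (fun a _ => lam a * moment 1 0 a + B a * moment 1 1 a)
    (fun a => eps a ^+ 4).
Proof.
have h20 : bigo (fun a _ => A a * moment 2 0 a) (fun a => eps a ^+ 4).
  exact: bigo_coef_moment.
have h02 : bigo (fun a _ => C a * moment 0 2 a) (fun a => eps a ^+ 4).
  exact: bigo_coef_moment.
apply: bigo_ext (bigoB (@bigo_odd_moment_equation 1%N 0%N isT) (bigoD h20 h02)).
apply: filterS (cmean_monomials A B C (fun=> 0) 2 0 1 1 0 2 0 0) => a H t _.
have -> : cmean (T a) (monomial_drift 1 0 quadratic a) =
    A a * moment 2 0 a + B a * moment 1 1 a + C a * moment 0 2 a + 0 * moment 0 0 a.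
  rewrite -H; congr cmean; apply/funext => s.
  by rewrite /monomial_drift /quadratic /monomial /= !expr0; ring.
ring.
Qed.

Lemma bigo_moment21 :
  bigo (fun a _ => (2 * lam a + (lam a)^*%C) * moment 2 1 a +
    (2 * B a + (A a)^*%C) * moment 2 2 a) (fun a => eps a ^+ 6).
Proof.
have h31 : bigo (fun a _ => (2 * A a + (B a)^*%C) * moment 3 1 a)
    (fun a => eps a ^+ 6).
  by apply: bigo_coef_moment => //; apply: bigoD; [exact: bigoZ|exact: bigoJ].
have h13 : bigo (fun a _ => (2 * C a) * moment 1 3 a) (fun a => eps a ^+ 6).
  by apply: bigo_coef_moment => //; exact: bigoZ.
have h40 : bigo (fun a _ => (C a)^*%C * moment 4 0 a) (fun a => eps a ^+ 6).
  by apply: bigo_coef_moment => //; exact: bigoJ.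
apply: bigo_ext (bigoB (@bigo_odd_moment_equation 2%N 1%N isT) (bigoD h31 (bigoD h13 h40))).
apply: filterS (cmean_monomials (fun a => 2 * A a + (B a)^*%C)
  (fun a => 2 * B a + (A a)^*%C) (fun a => 2 * C a) (fun a => (C a)^*%C) 3 1 2 2 1 3 4 0).
move=> a H t _.
have -> : cmean (T a) (monomial_drift 2 1 quadratic a) =
    (2 * A a + (B a)^*%C) * moment 3 1 a + (2 * B a + (A a)^*%C) * moment 2 2 a +
    2 * C a * moment 1 3 a + (C a)^*%C * moment 4 0 a.
  rewrite -H; congr cmean; apply/funext => s.
  by rewrite /monomial_drift quadraticJ /quadratic /monomial /= !expr0; ring.
ring.
Qed.

Lemma bigo_moment03 :
  bigo (fun a _ => (lam a)^*%C * moment 0 3 a + (C a)^*%C * moment 2 2 a)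
    (fun a => eps a ^+ 6).
Proof.
have h04 : bigo (fun a _ => (A a)^*%C * moment 0 4 a) (fun a => eps a ^+ 6).
  by apply: bigo_coef_moment => //; exact: bigoJ.
have h13 : bigo (fun a _ => (B a)^*%C * moment 1 3 a) (fun a => eps a ^+ 6).
  by apply: bigo_coef_moment => //; exact: bigoJ.
apply: bigo_ext (bigoB (bigoZ 3^-1 (@bigo_odd_moment_equation 0%N 3%N isT)) (bigoD h04 h13)).
apply: filterS (cmean_monomials (fun a => 3 * (A a)^*%C)
  (fun a => 3 * (B a)^*%C) (fun a => 3 * (C a)^*%C) (fun=> 0) 0 4 1 3 2 2 0 0).
move=> a H t _.
have -> : cmean (T a) (monomial_drift 0 3 quadratic a) =
    3 * (A a)^*%C * moment 0 4 a + 3 * (B a)^*%C * moment 1 3 a +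
    3 * (C a)^*%C * moment 2 2 a + 0 * moment 0 0 a.
  rewrite -H; congr cmean; apply/funext => s.
  by rewrite /monomial_drift quadraticJ /quadratic /monomial /= !expr0; ring.
by field.
Qed.

(** The pair (1, 1) is resonant: its factor is lam + conj lam = 2 mu.  The
equation is therefore needed to order eps^6, and the quartic terms of z'
enter through the odd form conj(z) n4, whose mean is again of that order. *)
Lemma bigo_moment11 :
  let W a := A a * moment 2 1 a + B a * moment 1 2 a + C a * moment 0 3 a +
             D21 a * moment 2 2 a in
  bigo (fun a _ => (lam a + (lam a)^*%C) * moment 1 1 a + (W a + (W a)^*%C))
    (fun a => eps a ^+ 6).
Proof.
move=> W.
pose w a t := monomial 0 1 a t * n a t.
have h31 : bigo (fun a _ => D30 a * moment 3 1 a) (fun a => eps a ^+ 6).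
  exact: bigo_coef_moment.
have h13 : bigo (fun a _ => D12 a * moment 1 3 a) (fun a => eps a ^+ 6).
  exact: bigo_coef_moment.
have h04 : bigo (fun a _ => D03 a * moment 0 4 a) (fun a => eps a ^+ 6).
  exact: bigo_coef_moment.
have f5 : hform 5 (fun a t => monomial 0 1 a t * n4 a t).
  exact: (hform_monomialM 0 1 n4_form).
have h5 := bigo_odd_form f5 isT.
have c5 : \forall a \near F, ccontinuous (fun t => monomial 0 1 a t * n5 a t).
  apply: filterS3 z_cont (ccontinuous_form n4_form) tail4_cont => a cz c4 c5.
  have -> : (fun t => monomial 0 1 a t * n5 a t) =
     (fun t => monomial 0 1 a t * ((n4 a t + n5 a t) + -1 * n4 a t)).
    by apply/funext => t; ring.
  apply: ccontinuousM; first exact: ccontinuous_monomial.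
  apply: ccontinuousD => //; apply: ccontinuousM => //; exact: ccontinuous_cst.
have h6 : bigo (fun a _ => cmean (T a) (fun t => monomial 0 1 a t * n5 a t))
    (fun a => eps a ^+ 6).
  apply: bigo_cmean => //.
  under [X in bigo _ X]eq_fun do rewrite exprS.
  apply: bigoM n5_bd.
  by have := bigo_monomial 0 1; under [X in bigo _ X -> _]eq_fun do rewrite expr1.
have hW : bigo (fun a _ => W a - cmean (T a) (w a)) (fun a => eps a ^+ 6).
  apply: bigo_ext (bigoN (bigoD h31 (bigoD h13 (bigoD h04 (bigoD h5 h6))))).
  apply: filterS3 (filterI (cmean_monomials A B C D21 2 1 1 2 0 3 2 2)
    (cmean_monomials D30 D12 D03 (fun=> 0) 3 1 1 3 0 4 0 0))
    (filterI z_cont n_split) (filterI (ccontinuous_form f5) c5).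
  move=> a [H1 H2] [cz H] [cf5 ca5] t _.
  have -> : cmean (T a) (w a) = W a + (D30 a * moment 3 1 a +
      D12 a * moment 1 3 a + D03 a * moment 0 4 a + 0 * moment 0 0 a) +
      (cmean (T a) (fun t => monomial 0 1 a t * n4 a t) +
       cmean (T a) (fun t => monomial 0 1 a t * n5 a t)).
    rewrite /W -H1 -H2.
    have q1 := ccontinuous_monomials (A a) (B a) (C a) (D21 a) 2 1 1 2 0 3 2 2 cz.
    have q2 := ccontinuous_monomials (D30 a) (D12 a) (D03 a) 0 3 1 1 3 0 4 0 0 cz.
    rewrite -(cmeanD _ cf5 ca5) -(cmeanD _ q1 q2).
    rewrite -(cmeanD _ (ccontinuousD q1 q2) (ccontinuousD cf5 ca5)).
    congr cmean; apply/funext => s.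
    rewrite /w H /quadratic /cubic /monomial !expr0; ring.
  ring.
apply: bigo_ext (bigoD hW (bigoJ hW)).
apply: filterS3 (moment_identity 1 1) z_cont n_cont => a H cz cn t _.
rewrite !mul1r in H.
have cw : ccontinuous (w a).
  by apply: ccontinuousM => //; exact: ccontinuous_monomial.
have -> : (lam a + (lam a)^*%C) * moment 1 1 a = - (cmean (T a) (w a) + (cmean (T a) (w a))^*%C).
  rewrite H -(cmeanJ _ cw) -(cmeanD _ cw (ccontinuousJ cw)).
  congr (- cmean _ _); apply/funext => s.
  rewrite /w /monomial_drift /monomial /= !rmorphM !rmorphXn /= conjcK !expr0; ring.
rewrite rmorphB /=; ring.
Qed.

Context (mu om : R -> R).
Hypothesis lamE : forall a, lam a = mu a +i* om a.

Let E a := `|mu a| * eps a ^+ 4 + eps a ^+ 6.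

Lemma bigo_mu f (k : nat) : bigo f (fun a => eps a ^+ k) ->
  bigo (fun a t => (mu a)%:C * f a t) (fun a => `|mu a| * eps a ^+ k).
Proof.
apply: bigoM; exists 1 => //; apply: filterE => a t _.
by rewrite normcr mul1r.
Qed.

(** The rate mu of growth of the squared radius is balanced by the cubic
coefficient, corrected by the quadratic terms that M 2 1 and M 0 3 carry. *)
Lemma bigo_amplitude : bigo (fun a _ => (mu a)%:C * moment 1 1 a +
    (complex.Re (D21 a) - complex.Im (A a * B a) / om a)%:C * moment 2 2 a)
  (fun a => `|mu a| * eps a ^+ 4 + eps a ^+ 6).
Proof.
have e0 k : \forall a \near F, 0 <= eps a ^+ k.
  by apply: filterS eps01 => a /andP[? _]; exact: exprn_ge0.
have E6 f : bigo f (fun a => eps a ^+ 6) -> bigo f E.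
  apply: bigo_le; apply: filterS (e0 4) => a a4.
  by rewrite /E lerDr mulr_ge0.
have E4 f : bigo f (fun a => eps a ^+ 4) -> bigo (fun a t => (mu a)%:C * f a t) E.
  move=> /bigo_mu; apply: bigo_le; apply: filterS (e0 6) => a a6.
  by rewrite /E lerDl.
have hv : bigo (fun a _ => 'i * (om a)^-1%:C) (fun=> 1).
  apply: bigoZ; exists w0^-1; first by rewrite invr_ge0 ltW.
  apply: filterS lam_gap => a wa t _.
  have {}wa : w0 <= om a by move: wa; rewrite lamE.
  rewrite normcr mulr1 normfV lef_pV2 ?posrE ?normr_gt0 ?gt_eqF//.
  - by rewrite (le_trans wa) ?ler_norm.
  - exact: lt_le_trans wa.
pose r a := (2 * lam a + (lam a)^*%C) * moment 2 1 a +
   (2 * B a + (A a)^*%C) * moment 2 2 a - 3 * (mu a)%:C * moment 2 1 a.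
pose s a := (lam a)^*%C * moment 0 3 a + (C a)^*%C * moment 2 2 a - (mu a)%:C * moment 0 3 a.
have hr : bigo (fun a _ => r a) E.
  apply: bigoB; first exact/E6/bigo_moment21.
  apply: bigo_ext (bigoZ 3 (E4 _ (@bigo_moment 2%N 1%N isT))).
  by apply: filterE => a t _; rewrite mulrA.
have hs : bigo (fun a _ => s a) E.
  apply: bigoB; first exact/E6/bigo_moment03.
  exact: (E4 _ (@bigo_moment 0%N 3%N isT)).
have b1 : bigo (fun a _ => B a + (A a)^*%C) (fun=> 1).
  by apply: bigoD => //; exact: bigoJ.
have b2 : bigo (fun a _ => A a + (B a)^*%C) (fun=> 1).
  by apply: bigoD => //; exact: bigoJ.
apply: bigo_ext (bigoB (bigoZ 2^-1%:C (E6 _ bigo_moment11))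
   (bigoZ 2^-1%:C (bigoMl hv (bigoD
     (bigoB (bigoMl b1 (bigoJ hr)) (bigoMl b2 hr))
     (bigoB (bigoMl C_bd hs) (bigoMl (bigoJ C_bd) (bigoJ hs))))))).
apply: filterS3 lam_gap (momentJ 2 1) (momentJ 2 2).
move=> a wa m12 m22 t _; rewrite -m12 /r /s lamE.
apply: esym; apply: hopf_coefficient_algebra m22.
by move: wa; rewrite lamE /= => wa; rewrite gt_eqF// (lt_le_trans w0_gt0).
Qed.

Context (T0 k0 : R).
Hypothesis T0_ge0 : 0 <= T0.
Hypothesis T_le : \forall a \near F, T a <= T0.
Hypothesis mu_le1 : \forall a \near F, `|mu a| <= 1.
Hypothesis k0_gt0 : 0 < k0.
Hypothesis z_low : \forall a \near F, forall t, 0 <= t <= T a ->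
  k0 * eps a ^+ 2 <= complex.Re (monomial 1 1 a t).

Let V a := `|mu a| * eps a ^+ 2 + eps a ^+ 3.

(** The derivative of |z|^2 contains no term of order eps^2 other than
2 mu |z|^2, and the periods are bounded. *)
Lemma bigo_radius_oscillation :
  bigo (fun a t => monomial 1 1 a t - monomial 1 1 a 0) V.
Proof.
have e0 k : \forall a \near F, 0 <= eps a ^+ k.
  by apply: filterS eps01 => a /andP[? _]; exact: exprn_ge0.
pose d a t := (lam a + (lam a)^*%C) * monomial 1 1 a t + monomial_drift 1 1 n a t.
have hd : bigo d V.
  apply: bigoD.
    have := bigoZ 2 (bigo_mu (bigo_monomial 1 1)) => /(_ FF) H.
    apply: (@bigo_le _ F _ T _ (fun a => `|mu a| * eps a ^+ 2)).
      by apply: filterS (e0 3%N) => a a3; rewrite lerDl.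
    apply: bigo_ext H; apply: filterE => a t _; rewrite lamE mulrA; congr (_ * _).
    by rewrite mulr_natl mulr2n; apply/eqP; rewrite eq_complex /= addr0 subrr !eqxx.
  apply: (@bigo_le _ F _ T _ (fun a => eps a ^+ 3)).
    by apply: filterS (e0 2%N) => a a2; rewrite lerDr mulr_ge0.
  exact: (bigo_drift 1 1 n_eps2).
have [C0 C00 H] := hd.
exists (2 * (T0 * C0)).
  by rewrite !mulr_ge0.
apply: filterS3 (filterI H ode) (filterI T_gt0 T_le) (filterI (e0 2%N) (e0 3%N)).
move=> a [Ha dz] [T1 T2] [e2 e3] t tT.
have V0 : 0 <= V a by apply: addr_ge0 => //; exact: mulr_ge0.
have dm s : is_cderive s (monomial 1 1 a) (d a s).
  have := is_cderiveM (dz s) (is_cderiveJ (dz s)).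
  congr is_cderive; last first.
    by rewrite /d /monomial_drift /monomial rmorphD rmorphM /= !expr0; ring.
apply: le_trans (normc_oscillation (ltW T1) dm Ha tT) _.
by rewrite -!mulrA ler_wpM2l// ler_wpM2r// mulr_ge0.
Qed.

(** The variance of |z|^2 over a period is of the order of the square of its
oscillation. *)
Lemma bigo_variance :
  bigo (fun a _ => moment 2 2 a - moment 1 1 a ^+ 2)
    (fun a => `|mu a| * eps a ^+ 4 + eps a ^+ 6).
Proof.
have hf := bigo_radius_oscillation.
have cf : \forall a \near F, ccontinuous (fun t => monomial 1 1 a t - monomial 1 1 a 0).
  apply: filterS z_cont => a cz; apply: ccontinuousD; last exact: ccontinuous_cst.
  exact: ccontinuous_monomial.
have h1 : bigo (fun a _ => cmean (T a) (fun t => monomial 1 1 a t - monomial 1 1 a 0)) V.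
  exact: bigo_cmean.
have cf2 : \forall a \near F, ccontinuous (fun t => (monomial 1 1 a t - monomial 1 1 a 0) ^+ 2).
  by apply: filterS cf => a; exact: ccontinuousX.
have h2 : bigo (fun a _ => cmean (T a)
    (fun t => (monomial 1 1 a t - monomial 1 1 a 0) ^+ 2)) (fun a => V a ^+ 2).
  by apply: bigo_cmean => //; exact: bigoX.
have h3 : bigo (fun a _ => moment 2 2 a - moment 1 1 a ^+ 2) (fun a => V a ^+ 2).
  apply: bigo_ext (bigoB h2 (bigoX 2 h1)).
  apply: filterS2 z_cont T_gt0 => a cz Ta t _; set c := monomial 1 1 a 0.
  have cm j k : ccontinuous (monomial j k a) by exact: ccontinuous_monomial.
  have cc (x : R[i]) j k : ccontinuous (fun t => x * monomial j k a t).
    by apply: ccontinuousM; [exact: ccontinuous_cst|].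
  have cst x : cmean (T a) (fun=> x) = x.
    by rewrite /cmean !mean_cst//; case: (x).
  rewrite (cmeanD _ (cm 1%N 1%N) (ccontinuous_cst _)) cst.
  have -> : (fun t0 => (monomial 1 1 a t0 - c) ^+ 2) =
     (fun t0 => (monomial 2 2 a t0 + (- (2 * c)) * monomial 1 1 a t0) + c ^+ 2).
    apply/funext => s; rewrite /monomial; ring.
  rewrite (cmeanD _ (ccontinuousD (cm _ _) (cc _ _ _)) (ccontinuous_cst _)).
  rewrite (cmeanD _ (cm _ _) (cc _ _ _)) (cmeanZ _ _ (cm _ _)) cst.
  rewrite -/(moment 1 1 a) -/(moment 2 2 a); ring.
have [C0 C00 H] := h3; exists (C0 * 2); first exact: mulr_ge0.
apply: filterS3 H eps01 mu_le1 => a Ha /andP[e0 e1] m1 t tT.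
rewrite (le_trans (Ha t tT))// -mulrA ler_wpM2l//.
rewrite /V; set m := `|mu a| in m1 *; have m0 : 0 <= m by exact: normr_ge0.
apply: (@le_trans _ _ (2 * (m ^+ 2 * eps a ^+ 4 + eps a ^+ 6))); last first.
  rewrite ler_wpM2l// lerD2r ler_wpM2r ?exprn_ge0// expr2 ler_piMl//.
have := sqr_ge0 (m * eps a ^+ 2 - eps a ^+ 3); lra.
Qed.

Context (kap : R -> R) (kap0 : R).
Hypothesis kap0_gt0 : 0 < kap0.
Hypothesis kap_low : \forall a \near F, kap0 <= `|kap a|.
Hypothesis kapE : bigo (fun a _ => (kap a -
   (complex.Re (D21 a) - complex.Im (A a * B a) / om a))%:C) (fun a => `|mu a|).
Hypothesis eps_small : forall e : R, 0 < e -> \forall a \near F, eps a ^+ 2 <= e.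
Hypothesis kap_bd : bigo (fun a _ => (kap a)%:C) (fun=> 1).

Hypothesis eps_gt0 : \forall a \near F, 0 < eps a.

Let m a := complex.Re (moment 1 1 a).

Lemma moment11_real : \forall a \near F, moment 1 1 a = (m a)%:C.
Proof.
apply: filterS (momentJ 1 1) => a; rewrite /m.
case: (moment 1 1 a) => x y [] yE; congr (_ +i* _); lra.
Qed.

Lemma moment11_low : \forall a \near F, k0 * eps a ^+ 2 <= m a.
Proof.
apply: filterS3 z_low z_cont T_gt0 => a low cz Ta.
rewrite /m /moment /cmean /= -[leLHS](mean_cst Ta).
apply: mean_le => //; first exact: cst_continuous.
by have [] := ccontinuous_monomial 1 1 cz.
Qed.

(** The equation of bigo_amplitude with M 2 2 replaced by (M 1 1)^2 has the factor
M 1 1, which is bounded below by a multiple of eps^2 and can be divided out. *)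
Lemma amplitude_balance : exists2 K : R, 0 <= K & \forall a \near F,
  `|mu a + kap a * m a| <= K * (`|mu a| * eps a ^+ 2 + eps a ^+ 4).
Proof.
pose k' a := complex.Re (D21 a) - complex.Im (A a * B a) / om a.
have k'_bd : bigo (fun a _ => (k' a)%:C) (fun=> 1).
  apply: bigo_ext (bigoB kap_bd (bigo_le mu_le1 kapE)).
  by apply: filterE => a t _; rewrite -rmorphB /=; congr (_%:C); rewrite /k'; ring.
have h11 : bigo (fun a _ => moment 1 1 a) (fun a => eps a ^+ 2).
  apply: bigo_cmean => //; last exact: (bigo_monomial 1 1).
  by apply: filterS z_cont => a; exact: ccontinuous_monomial.
have hE : bigo (fun a _ => (kap a - k' a)%:C * moment 1 1 a ^+ 2)
    (fun a => `|mu a| * eps a ^+ 4 + eps a ^+ 6).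
  apply: (@bigo_le _ F _ T _ (fun a => `|mu a| * (eps a ^+ 2) ^+ 2)).
    apply: filterS eps01 => a /andP[e0 _].
    by rewrite -exprM lerDl exprn_ge0.
  exact: bigoM kapE (bigoX 2 h11).
have : bigo (fun a _ => ((mu a + kap a * m a) * m a)%:C)
    (fun a => `|mu a| * eps a ^+ 4 + eps a ^+ 6).
  apply: bigo_ext (bigoD (bigoB bigo_amplitude (bigoMl k'_bd bigo_variance)) hE).
  apply: filterS moment11_real => a mE t _; rewrite -/(k' a) mE.
  case: (moment 2 2 a) => x y; rewrite !expr2.
  by apply/eqP; rewrite eq_complex /=; apply/andP; split; apply/eqP; ring.
move=> [K K0 H]; exists (K / k0); first by rewrite divr_ge0// ltW.
apply: filterS3 (filterI H T_gt0) moment11_low eps_gt0 => a [Ha Ta] low e0.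
have zT : 0 <= (0 : R) <= T a by rewrite lexx ltW.
move: (Ha 0 zT); rewrite normcr normrM => {}Ha.
have e2 : 0 < eps a ^+ 2 by exact: exprn_gt0.
have m0 : 0 < m a by apply: lt_le_trans low; exact: mulr_gt0.
rewrite mulrAC ler_pdivlMr// -(ler_pM2r e2) -mulrA.
apply: (@le_trans _ _ (`|mu a + kap a * m a| * `|m a|)).
  by rewrite ler_wpM2l// gtr0_norm.
rewrite (le_trans Ha)// -mulrA ler_wpM2l//; lra.
Qed.

Lemma eps_le_mu : exists2 K : R, 0 <= K & \forall a \near F,
  eps a ^+ 2 <= K * `|mu a|.
Proof.
have [K K0 H] := amplitude_balance.
have kk : 0 < kap0 * k0 by exact: mulr_gt0.
exists (2 * (1 + K) / (kap0 * k0)).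
  by apply: divr_ge0; [apply: mulr_ge0 => //; exact: addr_ge0|exact: ltW].
have K1 : 0 < 2 * (1 + K) by rewrite mulr_gt0// ltr_pwDl.
have e0 : 0 < kap0 * k0 / (2 * (1 + K)) by exact: divr_gt0.
apply: filterS3 (filterI H kap_low) (filterI moment11_low eps01) (eps_small e0).
move=> a [Ha Hk] [low /andP[ea0 ea1]]; rewrite ler_pdivlMr// => es.
have e2 : 0 <= eps a ^+ 2 by exact: exprn_ge0.
apply: (amplitude_le kk K0 (m := kap a * m a)).
- by rewrite e2 exprn_ile1.
- rewrite normrM -mulrA; apply: ler_pM => //; first exact: ltW.
    by apply: mulr_ge0 => //; exact: ltW.
  by rewrite (le_trans low)// ler_norm.
- by rewrite -exprM.
- by apply: le_trans es; rewrite mulrC; apply: ler_wpM2l => //; lra.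
Qed.

(** Since lam + conj lam = 2 mu, the quotients B / lam and - B / conj lam differ by
O(mu), which disappears in the error term after multiplication by mu. *)
Lemma bigo_mean : bigo (fun a _ => moment 1 0 a +
    (mu a)%:C * B a / ((lam a)^*%C * (kap a)%:C)) (fun a => mu a ^+ 2).
Proof.
have [C1 C10 H1] := eps_le_mu.
have [C2 C20 H2] := amplitude_balance.
have b4 f : bigo f (fun a => eps a ^+ 4) -> bigo f (fun a => mu a ^+ 2).
  move=> [K K0 H]; exists (K * C1 ^+ 2); first by rewrite mulr_ge0 ?exprn_ge0.
  apply: filterS2 H H1 => a Ha em t tT; rewrite (le_trans (Ha _ tT))//.
  rewrite -mulrA ler_wpM2l// -(@real_normK _ (mu a)) ?num_real// -exprMn.
  by rewrite (exprM _ 2 2) lerXn2r ?nnegrE ?sqr_ge0 ?mulr_ge0.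
have hb : bigo (fun a _ => (mu a + kap a * m a)%:C) (fun a => mu a ^+ 2).
  exists (C2 * (C1 + C1 ^+ 2)).
    by rewrite mulr_ge0// addr_ge0// exprn_ge0.
  apply: filterS2 H1 H2 => a em Ha t _; rewrite normcr (le_trans Ha)//.
  rewrite -mulrA ler_wpM2l// mulrDl lerD//.
    apply: (@le_trans _ _ (`|mu a| * (C1 * `|mu a|))); first exact: ler_wpM2l.
    by rewrite mulrCA -expr2 real_normK ?num_real.
  rewrite -(@real_normK _ (mu a)) ?num_real// -exprMn.
  by rewrite (exprM _ 2 2) lerXn2r ?nnegrE ?sqr_ge0 ?mulr_ge0.
have hk : bigo (fun a _ => (kap a)^-1%:C) (fun=> 1).
  exists kap0^-1; first by rewrite invr_ge0 ltW.
  apply: filterS kap_low => a ka t _; rewrite normcr mulr1 normfV.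
  by rewrite lef_pV2 ?posrE// (lt_le_trans kap0_gt0).
have hl : bigo (fun a _ => (lam a)^-1) (fun=> 1).
  apply: bigo_ext (@bigo_resonance 1%N 0%N isT).
  by apply: filterE => a t _; rewrite mul1r mul0r addr0.
have hm : bigo (fun a _ => (mu a)%:C * (lam a + (lam a)^*%C)) (fun a => mu a ^+ 2).
  exists 2 => //; apply: filterE => a t _.
  have -> : (mu a)%:C * (lam a + (lam a)^*%C) = (2 * mu a ^+ 2)%:C.
    by rewrite lamE; apply/eqP; rewrite eq_complex /=; apply/andP; split;
      apply/eqP; ring.
  by rewrite normcr ger0_norm// mulr_ge0// sqr_ge0.
apply: bigo_ext (bigoD (bigoB (bigoMl hl (b4 _ bigo_moment10))
   (bigoMl (bigoMl hl (bigoMl B_bd hk)) hb))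
   (bigoMl (bigoMl (bigoMl B_bd hk) (bigoMl hl (bigoJ hl))) hm)).
apply: filterS3 moment11_real kap_low (resonance_neq0 (isT : (1%N != 0%N))).
move=> a mE ka l0 t _.
rewrite mul1r mul0r addr0 in l0.
have k0' : (kap a)%:C != 0.
  rewrite eq_complex /= eqxx andbT -normr_gt0; exact: lt_le_trans ka.
have l0' : (lam a)^*%C != 0 by rewrite conjc_eq0.
have -> : (mu a + kap a * m a)%:C = (mu a)%:C + (kap a)%:C * (m a)%:C.
  by apply/eqP; rewrite eq_complex /=; apply/andP; split; apply/eqP; ring.
rewrite mE conjc_inv.
have -> : (kap a)^-1%:C = ((kap a)%:C)^-1 by rewrite fmorphV.
by field; rewrite l0 l0' k0'.
Qed.

End Moments.

(** * Change of scale of the eigenvectors *)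

Lemma sqr_normC (R : realType) (u : R[i]) : `|u| ^+ 2 = u * u^*%C.
Proof. by rewrite normCK. Qed.

Section Scaling.
Context {R : realType} (F : 'cV[R]_2 -> 'cV[R]_2) (lambda : R[i]).
Context (q p : 'cV[R[i]]_2) (s : R[i]) (s_neq0 : s != 0).
Local Notation q' := (s *: q).
Local Notation p' := ((s^-1)^*%C *: p).

Lemma BformZ (a b : R[i]) x y : Bform F (a *: x) (b *: y) = (a * b) *: Bform F x y.
Proof.
apply/colP => m; rewrite !mxE mulr_sumr; apply: eq_bigr => j _.
rewrite mulr_sumr; apply: eq_bigr => k _; rewrite !mxE.
set d := real_complex _; set u := x k 0; set v := y j 0; move: (d _) => e.
by ring.
Qed.

Lemma CformZ (a b c : R[i]) x y u :
  Cform F (a *: x) (b *: y) (c *: u) = (a * b * c) *: Cform F x y u.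
Proof.
apply/colP => m; rewrite !mxE mulr_sumr; apply: eq_bigr => j _.
rewrite mulr_sumr; apply: eq_bigr => k _.
rewrite mulr_sumr; apply: eq_bigr => l _; rewrite !mxE.
set d := real_complex _; set r := x k 0; set v := y j 0; set w := u l 0.
by move: (d _) => e; ring.
Qed.

Lemma innerZ (a b : R[i]) (u v : 'cV[R[i]]_2) :
  inner (a *: u) (b *: v) = a^*%C * b * inner u v.
Proof.
rewrite /inner mulr_sumr; apply: eq_bigr => k _; rewrite !mxE rmorphM /=.
by set x := v k 0; set y := (_ ^*)%R; ring.
Qed.

Lemma conjvZ (a : R[i]) (u : 'cV[R[i]]_2) : conjv (a *: u) = a^*%C *: conjv u.
Proof. by apply/colP => i; rewrite !mxE rmorphM. Qed.

Lemma g20_scale : g20 F q' p' = s * g20 F q p.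
Proof. by rewrite /g20 BformZ innerZ conjcK mulKf. Qed.

Lemma g11_scale : g11 F q' p' = s^*%C * g11 F q p.
Proof. by rewrite /g11 conjvZ BformZ innerZ conjcK mulKf. Qed.

Lemma g02_scale : g02 F q' p' = s^-1 * s^*%C ^+ 2 * g02 F q p.
Proof. by rewrite /g02 conjvZ BformZ innerZ conjcK. Qed.

Lemma g21_scale : g21 F q' p' = s * s^*%C * g21 F q p.
Proof. by rewrite /g21 conjvZ CformZ innerZ conjcK !mulrA mulVf ?mul1r. Qed.

(** The coefficients g20, g11, g21 scale by s, conj s and s (conj s), and |g02|^2 by
(s (conj s))^2 / (s (conj s)); each summand of c1 is multiplied by s (conj s). *)
Lemma c1_scale : c1 F lambda q' p' = s * s^*%C * c1 F lambda q p.
Proof.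
rewrite /c1 g20_scale g11_scale g02_scale g21_scale !sqr_normC.
rewrite !(rmorphM (@conjc R)) /= !conjcK conjc_inv.
have s' : s^*%C != 0 by rewrite conjc_eq0.
set X := (2 * lambda + _) / _; set Y := (2 * _)^-1; set Z := lambda^-1.
by field; rewrite s_neq0 s'.
Qed.

Lemma Re_c1_scale : complex.Re (c1 F lambda q' p') =
  (complex.Re s ^+ 2 + complex.Im s ^+ 2) * complex.Re (c1 F lambda q p).
Proof. by rewrite c1_scale; case: (s) (c1 F lambda q p) => a b [u v] /=; ring. Qed.

(** The quotient g11 / Re c1 is multiplied by 1 / s, which cancels the factor of
q. *)
Lemma Kvec_scale : Kvec F lambda q' p' = Kvec F lambda q p.
Proof.
rewrite /Kvec Re_c1_scale g11_scale.
set w := 2 * g11 F q p / _; set w' := 2 * _ / _.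
have ww : w = w' * s.
  rewrite /w /w' (_ : (_ * complex.Re (c1 _ _ _ _))%:C = s * s^*%C * (complex.Re (c1 F lambda q p))%:C); last first.
    by case: (s) (c1 F lambda q p) => a b [u v]; apply/eqP; rewrite eq_complex /=;
      apply/andP; split; apply/eqP; ring.
  have s' : s^*%C != 0 by rewrite conjc_eq0.
  rewrite !invfM; set X := _^-1; set Y := (real_complex _ _)^-1.
  by field; rewrite s_neq0 s'.
apply/colP => i; rewrite !mxE ww.
by case: (w') (s) (q i 0) => a b [c d] [e g] /=; ring.
Qed.

End Scaling.

(** The two terms of Kvec are the real part of a single complex product. *)
Lemma Kvec_coord (R : realType) (F : 'cV[R]_2 -> 'cV[R]_2) (lambda : R[i])
    (q p : 'cV[R[i]]_2) k :
  Kvec F lambda q p k 0 =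
  - complex.Re (2 * g11 F q p / (lambda^*%C * (complex.Re (c1 F lambda q p))%:C) * q k 0).
Proof.
rewrite /Kvec.
have -> : Num.conj lambda = lambda^*%C by [].
move: (2 * g11 F q p / _) => [w1 w2]; rewrite !mxE.
move: (q k 0) => [u v] /=; ring.
Qed.

(** * Continuity in the parameter and normalised eigenvectors *)

Section ComplexContinuity.
Context {R : realType} (a0 : R).
Implicit Types f g : R -> R[i].

Definition ccont f := (complex.Re (f a) @[a --> a0] --> complex.Re (f a0)) /\
  (complex.Im (f a) @[a --> a0] --> complex.Im (f a0)).

Lemma ccont_cst x : ccont (fun=> x).
Proof. by split; exact: cvg_cst. Qed.

Lemma ccontD f g : ccont f -> ccont g -> ccont (fun a => f a + g a).
Proof.
move=> [rf mf] [rg mg]; split.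
  by under eq_fun do rewrite Re_add; rewrite Re_add; exact: cvgD.
by under eq_fun do rewrite Im_add; rewrite Im_add; exact: cvgD.
Qed.

Lemma ccontM f g : ccont f -> ccont g -> ccont (fun a => f a * g a).
Proof.
move=> [rf mf] [rg mg]; split.
  by under eq_fun do rewrite Re_mul; rewrite Re_mul; apply: cvgB; exact: cvgM.
by under eq_fun do rewrite Im_mul; rewrite Im_mul; apply: cvgD; exact: cvgM.
Qed.

Lemma ccontJ f : ccont f -> ccont (fun a => (f a)^*%C).
Proof.
move=> [rf mf]; split.
  by under eq_fun do rewrite Re_conjc; rewrite Re_conjc.
by under eq_fun do rewrite Im_conjc; rewrite Im_conjc; exact: cvgN.
Qed.

Lemma ccontR (f : R -> R) : {for a0, continuous f} -> ccont (fun a => (f a)%:C).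
Proof. by move=> cf; split => //; exact: cvg_cst. Qed.

Lemma ccontN f : ccont f -> ccont (fun a => - f a).
Proof.
move=> cf; under eq_fun do rewrite -mulN1r.
by apply: ccontM => //; exact: ccont_cst.
Qed.

Lemma ccontV f : f a0 != 0 -> ccont f -> ccont (fun a => (f a)^-1).
Proof.
move=> f0 [rf mf].
have -> : (fun a => (f a)^-1) = (fun a => (f a)^*%C *
    ((complex.Re (f a) ^+ 2 + complex.Im (f a) ^+ 2)^-1)%:C).
  apply/funext => a; case: (f a) => x y /=.
  by apply/eqP; rewrite eq_complex /=; apply/andP; split; apply/eqP; ring.
apply: ccontM; first by apply: ccontJ; split.
apply: ccontR; apply: cvgV.
  rewrite -normc_sqr sqrf_eq0; apply: contra_neq f0.
  exact: ComplexField.Normc.eq0_normc.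
by under eq_fun do rewrite !expr2; rewrite !expr2; apply: cvgD; exact: cvgM.
Qed.

Lemma ccont_bigo (F : set_system R) (FF : Filter F) (T : R -> R) f :
  F `=>` nbhs a0 -> ccont f -> bigo F T (fun a _ => f a) (fun=> 1).
Proof.
move=> Fa0 [rf mf].
exists (`|complex.Re (f a0)| + `|complex.Im (f a0)| + 2).
  by rewrite addr_ge0// addr_ge0.
have /cvgrPdist_lt/(_ _ ltr01) h1 := rf.
have /cvgrPdist_lt/(_ _ ltr01) h2 := mf.
apply: filterS2 (Fa0 _ h1) (Fa0 _ h2) => a /ltW d1 /ltW d2 t _.
rewrite mulr1 (le_trans (normc_le _))//.
have bd (u v : R) : `|u - v| <= 1 -> `|v| <= `|u| + 1.
  by move=> uv; rewrite -lerBlDl (le_trans (lerB_dist _ _))// distrC.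
move: (bd _ _ d1) (bd _ _ d2); lra.
Qed.

End ComplexContinuity.

Section NormalisedEigenvectors.
Context {R : realType}.
Implicit Types (A : 'M[R]_2) (lam : R[i]).

(** The eigenvector with first entry 1 is (1, slope); the conjugates of left0 and
left1 are the entries of the adjoint eigenvector of unit inner product with it. *)
Definition slope A lam : R[i] := (lam - (A 0 0)%:C) / (A 0 1)%:C.
Definition left0 A lam : R[i] := (lam - (A 1 1)%:C) / (lam - lam^*%C).
Definition left1 A lam : R[i] := (A 0 1)%:C / (lam - lam^*%C).

Definition qnorm A lam : 'cV[R[i]]_2 :=
  \col_i (if i == 0 then 1 else slope A lam).
Definition pnorm A lam : 'cV[R[i]]_2 :=
  \col_i (if i == 0 then (left0 A lam)^*%C else (left1 A lam)^*%C).

(** If the entry A 0 1 vanished, the first row of A q = lambda q would force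
q 0 0 = 0, as lambda is not real, and the second row q 1 0 = 0.  Hence q 0 0 is a
legitimate scale; the adjoint equation and <p, q> = 1 then determine p. *)
Lemma eigendata_normalise A (mu om : R) q p : 0 < om ->
  eigendata A (mu +i* om) q p ->
  [/\ A 0 1 != 0, A 0 0 + A 1 1 = 2 * mu,
      A 0 0 * A 1 1 - A 0 1 * A 1 0 = mu ^+ 2 + om ^+ 2 &
      exists2 s, s != 0 & q = s *: qnorm A (mu +i* om) /\
        p = (s^-1)^*%C *: pnorm A (mu +i* om)].
Proof.
move=> om0 [_ _ Aq pA pq].
have q0e := congr1 (fun M : 'cV_2 => M 0 0) Aq.
have q1e := congr1 (fun M : 'cV_2 => M 1 0) Aq.
have p0e := congr1 (fun M : 'rV_2 => M 0 0) pA.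
have p1e := congr1 (fun M : 'rV_2 => M 0 1) pA.
rewrite /= !mxE !sum_ord2 !mxE in q0e q1e p0e p1e.
rewrite /inner sum_ord2 in pq.
have {}p0e := congr1 (@conjc R) p0e; have {}p1e := congr1 (@conjc R) p1e.
rewrite !(rmorphD (@conjc R)) !(rmorphM (@conjc R)) /= ?conjcK in p0e p1e.
move: q0e q1e p0e p1e pq; rewrite /Num.conj /= ?conjcK ?oppr0 ?opprK.
have pcol0 : p 0 0 = ((p 0 0)^*%C)^*%C by rewrite conjcK.
have pcol1 : p 1 0 = ((p 1 0)^*%C)^*%C by rewrite conjcK.
move: pcol0 pcol1; set P0 := (p 0 0)^*%C; set P1 := (p 1 0)^*%C.
move=> pcol0 pcol1 q0e q1e p0e p1e pq.
set lam := mu +i* om in q0e q1e p0e p1e *.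
have {}p1e : P0 * (A 0 1)%:C + P1 * (A 1 1)%:C = lam * P1 := p1e.
have lam_real (x : R) : lam - x%:C != 0.
  by rewrite eq_complex /= subr0 (gt_eqF om0) andbF.
have b0 : A 0 1 != 0.
  apply/negP => /eqP b0; rewrite b0 mul0r addr0 in q0e.
  have q00 : q 0 0 = 0.
    apply/eqP; rewrite -(mulrI_eq0 _ (mulfI (lam_real (A 0 0)))).
    by rewrite mulrBl -q0e subrr.
  have q10 : q 1 0 = 0.
    apply/eqP; rewrite -(mulrI_eq0 _ (mulfI (lam_real (A 1 1)))).
    by rewrite mulrBl -q1e q00 mulr0 add0r subrr.
  by move/eqP: pq; rewrite q00 q10 !mulr0 addr0 eq_sym oner_eq0.
have bC : (A 0 1)%:C != 0 :> R[i] by rewrite eq_complex /= eqxx andbT.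
have q1q0 : q 1 0 = q 0 0 * slope A lam.
  apply: (mulfI bC); rewrite /slope.
  have -> : (A 0 1)%:C * q 1 0 = lam * q 0 0 - (A 0 0)%:C * q 0 0.
    by rewrite -q0e addrAC subrr add0r.
  by field.
have q00 : q 0 0 != 0.
  apply/negP => /eqP q00; rewrite q00 mul0r in q1q0.
  by move/eqP: pq; rewrite q00 q1q0 !mulr0 addr0 eq_sym oner_eq0.
have char : (lam - (A 0 0)%:C) * (lam - (A 1 1)%:C) = (A 0 1 * A 1 0)%:C.
  apply: (mulIf q00); rewrite q1q0 /slope in q1e.
  have -> : (A 0 1 * A 1 0)%:C * q 0 0 = (A 0 1)%:C * ((A 1 0)%:C * q 0 0).
    by rewrite mulrA -rmorphM.
  have -> : (A 1 0)%:C * q 0 0 = (lam - (A 1 1)%:C) *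
     (q 0 0 * ((lam - (A 0 0)%:C) / (A 0 1)%:C)).
    by rewrite mulrBl -q1e addrK.
  by field.
have [trA detA] : A 0 0 + A 1 1 = 2 * mu /\
    A 0 0 * A 1 1 - A 0 1 * A 1 0 = mu ^+ 2 + om ^+ 2.
  case: char => e1 e2.
  have tr : A 0 0 + A 1 1 = 2 * mu.
    apply: (mulfI (lt0r_neq0 om0)); rewrite !subr0 in e2; lra.
  split=> //; rewrite !subr0 in e1.
  have e3 : A 1 1 = 2 * mu - A 0 0 by lra.
  by rewrite e3 in e1 *; lra.
have gap0 : lam - lam^*%C != 0.
  rewrite eq_complex /= opprK negb_and; apply/orP; right.
  by apply: lt0r_neq0; exact: addr_gt0.
have gapE : lam - lam^*%C = (lam - (A 1 1)%:C) + (lam - (A 0 0)%:C).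
  apply/eqP; rewrite eq_complex /=; apply/andP; split; apply/eqP; lra.
have PL : P0 * (A 0 1)%:C = (lam - (A 1 1)%:C) * P1.
  by rewrite mulrBl -p1e [X in _ - X]mulrC addrK.
have P1E : q 0 0 * P1 = left1 A lam.
  apply: (mulIf gap0); rewrite /left1 divfK// gapE.
  apply: (mulfI bC).
  have <- : (A 0 1)%:C * (P0 * q 0 0 + P1 * q 1 0) = (A 0 1)%:C by rewrite pq mulr1.
  have -> : (A 0 1)%:C * (P0 * q 0 0 + P1 * q 1 0) =
    (P0 * (A 0 1)%:C) * q 0 0 + (A 0 1)%:C * P1 * q 1 0 by ring.
  rewrite PL q1q0 /slope.
  by field.
have P0E : q 0 0 * P0 = left0 A lam.
  apply: (mulIf bC); rewrite -mulrA PL mulrCA P1E /left0 /left1; field.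
  by [].
split=> //; exists (q 0 0) => //; split; apply/colP => i; rewrite !mxE.
  by case: (ord2P i) => ->; rewrite ?eqxx ?mulr1 -?q1q0.
case: (ord2P i) => ->; rewrite ?eqxx.
  by rewrite -P0E -(rmorphM (@conjc R)) mulKf// -pcol0.
have -> : (1 == 0 :> 'I_2) = false by [].
by rewrite -P1E -(rmorphM (@conjc R)) mulKf// -pcol1.
Qed.

Section Coordinates.
Context (A : 'M[R]_2) (mu om : R).
Hypothesis om_gt0 : 0 < om.
Hypothesis A01_neq0 : A 0 1 != 0.
Hypothesis A_trace : A 0 0 + A 1 1 = 2 * mu.
Hypothesis A_det : A 0 0 * A 1 1 - A 0 1 * A 1 0 = mu ^+ 2 + om ^+ 2.
Local Notation lam := (mu +i* om).

Lemma om_neq0 : om != 0. Proof. exact: lt0r_neq0. Qed.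

Lemma invc_real (x : R) : (x%:C)^-1 = (x^-1)%:C.
Proof. by rewrite fmorphV. Qed.

Lemma slopeE : slope A lam = ((mu - A 0 0) / A 0 1) +i* (om / A 0 1).
Proof.
rewrite /slope invc_real; apply/eqP; rewrite eq_complex /=.
by apply/andP; split; apply/eqP; ring.
Qed.

Lemma gap_inv : (lam - lam^*%C)^-1 = 0 +i* (- (2 * om)^-1).
Proof.
have g0 : (lam - lam^*%C) != 0.
  rewrite eq_complex /= opprK negb_and; apply/orP; right.
  by apply: lt0r_neq0; exact: addr_gt0.
apply: (mulfI g0); rewrite divff//; apply/eqP; rewrite eq_complex /=.
by apply/andP; split; apply/eqP; field; exact: om_neq0.
Qed.

Lemma left0E : left0 A lam = 2^-1 +i* (- (mu - A 1 1) / (2 * om)).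
Proof.
rewrite /left0 gap_inv; apply/eqP; rewrite eq_complex /=.
by apply/andP; split; apply/eqP; field; exact: om_neq0.
Qed.

Lemma left1E : left1 A lam = 0 +i* (- A 0 1 / (2 * om)).
Proof.
rewrite /left1 gap_inv; apply/eqP; rewrite eq_complex /=.
by apply/andP; split; apply/eqP; field; exact: om_neq0.
Qed.

(** The complex coordinate <p, y> of a real vector y. *)
Definition eigencoord (y0 y1 : R) : R[i] :=
  left0 A lam * y0%:C + left1 A lam * y1%:C.

Lemma eigencoord0 y0 y1 : y0%:C = eigencoord y0 y1 + (eigencoord y0 y1)^*%C.
Proof.
rewrite /eigencoord left0E left1E; apply/eqP; rewrite eq_complex /=.
by apply/andP; split; apply/eqP; field; exact: om_neq0.
Qed.

Lemma eigencoord1 y0 y1 : y1%:C = eigencoord y0 y1 * slope A lam +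
  (eigencoord y0 y1)^*%C * (slope A lam)^*%C.
Proof.
have e : A 1 1 = 2 * mu - A 0 0 by rewrite -A_trace addrC addKr.
rewrite /eigencoord left0E left1E slopeE e; apply/eqP; rewrite eq_complex /=.
by apply/andP; split; apply/eqP; field; rewrite om_neq0 A01_neq0.
Qed.

Lemma eigencoord_linear y0 y1 :
  eigencoord (A 0 0 * y0 + A 0 1 * y1) (A 1 0 * y0 + A 1 1 * y1) =
  lam * eigencoord y0 y1.
Proof.
have e1 : A 0 0 = 2 * mu - A 1 1 by rewrite -A_trace addrK.
have e2 : A 1 0 = (A 0 0 * A 1 1 - mu ^+ 2 - om ^+ 2) / A 0 1.
  by apply: (mulIf A01_neq0); rewrite divfK//;
    rewrite -addrA -opprD -A_det opprB addrC subrK mulrC.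
rewrite /eigencoord left0E left1E e2 e1; apply/eqP; rewrite eq_complex /=.
by apply/andP; split; apply/eqP; field; rewrite ?om_neq0 ?A01_neq0.
Qed.

End Coordinates.

End NormalisedEigenvectors.

(** * Partial derivatives in the state as derivatives in state and parameter *)

Section Slices.
Context {R : realType}.
Local Notation X := ('cV[R]_2 * R)%type.
Implicit Types (g : X -> R) (c w : 'cV[R]_2) (a : R).

Lemma growth_slice g c w a (j : 'I_2) :
  (fun h : R => h^-1 *: (((fun y : 'cV[R]_2 => g (c + y, a)) \o shift w)
     (h *: (delta_mx j 0 : 'cV[R]_2)) - g (c + w, a))) =
  (fun h : R => h^-1 *: ((g \o shift (c + w, a)) (h *: state_axis j) - g (c + w, a))).
Proof.
apply/funext => h /=; congr (_ *: (g _ - _)).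
rewrite /state_axis /state_dir; congr pair => /=.
  by rewrite addrCA.
by rewrite scaler0 add0r.
Qed.

Lemma partial_slice g c w a j :
  partial j (fun y => g (c + y, a)) w = axis_derive j g (c + w, a).
Proof. by rewrite /partial /derive growth_slice axis_deriveE. Qed.

Lemma derivable_slice g c w a (j : 'I_2) : derivable g (c + w, a) (state_axis j) ->
  derivable (fun y => g (c + y, a)) w (delta_mx j 0).
Proof. by rewrite /derivable growth_slice. Qed.

Lemma is_derive_linear_form (A : 'M[R]_2) (m k : 'I_2) w :
  is_derive w (delta_mx k 0 : 'cV[R]_2) (fun y : 'cV[R]_2 => (A *m y) m 0) (A m k).
Proof.
have gr : (fun h : R => h^-1 *: (((fun y : 'cV[R]_2 => (A *m y) m 0) \o shift w)
    (h *: (delta_mx k 0 : 'cV[R]_2)) - (A *m w) m 0)) @ 0^' --> A m k.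
  apply: cvg_near_cst; apply: filterS (nbhs_dnbhs_neq 0) => h h0.
  rewrite /= mulmxDr -scalemxAr !mxE addrK.
  rewrite [_ *: _]mulrA mulVf// mul1r (bigD1 k)//= mxE !eqxx mulr1 big1 ?addr0//.
  by move=> j /negPf jk; rewrite mxE jk mulr0.
by apply: DeriveDef; [apply/cvg_ex; exists (A m k)|exact: cvg_lim gr].
Qed.

Lemma smooth_derivable g n c a v : Cn n.+1 g -> derivable g (c, a) v.
Proof. by move=> [dg _]; apply: diff_derivable. Qed.

Section NonlinearPart.
Context (f : 'cV[R]_2 -> R -> 'cV[R]_2) (c : 'cV[R]_2) (a : R) (m : 'I_2).
Let g (Y : X) := f Y.1 Y.2 m 0.
Hypothesis g_smooth : forall n, Cn n g.
Local Notation Fm := (fun w => nonlinear_part (f ^~ a) c w m 0).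

Lemma jacobian_slice k : jacobian_mx (f ^~ a) c m k = axis_derive k g (c, a).
Proof.
rewrite mxE.
have -> : (fun y => f y a m 0) = (fun y => g (0 + y, a)).
  by apply/funext => y; rewrite /g /= add0r.
by rewrite partial_slice add0r.
Qed.

Lemma derive_slice_const (g' : X -> R) (j : 'I_2) (u : R) :
  (forall n, Cn n g') ->
  partial j (fun w => g' (c + w, a) - u) =
  (fun w => axis_derive j g' (c + w, a)).
Proof.
move=> sg; apply/funext => w.
have dg := derivable_slice (@smooth_derivable g' 0 (c + w) a (state_axis j) (sg 1)).
have [_ E] := is_deriveB (derivableP dg) (is_derive_cst u w (delta_mx j 0)).
by rewrite -[RHS]subr0 -(partial_slice g' c w a j); exact: E.
Qed.

Lemma partial_nonlinear k : partial k Fm =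
  (fun w => axis_derive k g (c + w, a) - axis_derive k g (c, a)).
Proof.
apply/funext => w; rewrite -jacobian_slice.
have dg := derivable_slice (@smooth_derivable g 0 (c + w) a (state_axis k) (g_smooth 1)).
have [_ E] := is_deriveB (derivableP dg)
  (is_derive_linear_form (jacobian_mx (f ^~ a) c) m k w).
have FE : Fm = (fun y => g (c + y, a)) -
    (fun y : 'cV[R]_2 => (jacobian_mx (f ^~ a) c *m y) m 0).
  by apply/funext => y; rewrite /nonlinear_part mxE [X in _ + X = _]mxE.
by rewrite FE -(partial_slice g c w a k); exact: E.
Qed.

Lemma smooth_axis_derive k : forall n, Cn n (axis_derive k g).
Proof. by move=> n; exact: Cn_axis_derive. Qed.

Lemma partial2_nonlinear j k : partial j (partial k Fm) =
  (fun w => axis_derive j (axis_derive k g) (c + w, a)).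
Proof.
rewrite partial_nonlinear.
exact: derive_slice_const j _ (smooth_axis_derive k).
Qed.

Lemma partial3_nonlinear l j k : partial l (partial j (partial k Fm)) 0 =
  axis_derive l (axis_derive j (axis_derive k g)) (c, a).
Proof.
rewrite partial2_nonlinear.
have -> := partial_slice (axis_derive j (axis_derive k g)) c 0 a l.
by rewrite addr0.
Qed.

End NonlinearPart.

End Slices.

(** * Quadratic and cubic coefficients as continuous functions of the parameter *)

Section Coefficients.
Context {R : realType}.
Local Notation X := ('cV[R]_2 * R)%type.

(** Polarisations of binary quadratic and cubic forms.  They use one coefficient
per multiset of indices, since mixed derivatives commute. *)
Definition bilinear2 (d00 d01 d11 : R) (x0 x1 y0 y1 : R[i]) : R[i] :=
  d00%:C * (x0 * y0) + d01%:C * (x0 * y1 + x1 * y0) + d11%:C * (x1 * y1).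

Definition trilinear2 (d000 d001 d011 d111 : R) (x0 x1 y0 y1 u0 u1 : R[i]) : R[i] :=
  d000%:C * (x0 * y0 * u0) +
  d001%:C * (x0 * y0 * u1 + x0 * y1 * u0 + x1 * y0 * u0) +
  d011%:C * (x0 * y1 * u1 + x1 * y0 * u1 + x1 * y1 * u0) +
  d111%:C * (x1 * y1 * u1).

Definition deriv2 (g : X -> R) (j k : 'I_2) : X -> R :=
  axis_derive j (axis_derive k g).
Definition deriv3 (g : X -> R) (l j k : 'I_2) : X -> R :=
  axis_derive l (deriv2 g j k).

Lemma deriv2_swap g j k : Cn 2 g -> deriv2 g j k = deriv2 g k j.
Proof. by move=> g2; apply/funext => Y; rewrite /deriv2 !axis_deriveE derive_swap. Qed.

Lemma deriv3_swap g l j k : Cn 3 g -> deriv3 g l j k = deriv3 g j l k.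
Proof.
by move=> g3; rewrite /deriv3 /deriv2; apply: deriv2_swap; exact: Cn_axis_derive.
Qed.

Lemma deriv3_sym g : Cn 3 g ->
  [/\ deriv3 g 1 0 0 = deriv3 g 0 0 1, deriv3 g 0 1 0 = deriv3 g 0 0 1,
      deriv3 g 1 0 1 = deriv3 g 0 1 1 & deriv3 g 1 1 0 = deriv3 g 0 1 1].
Proof.
move=> g3; have g2 := CnS g3.
have e3 : deriv3 g 1 0 1 = deriv3 g 0 1 1 by exact: deriv3_swap.
have e2 : deriv3 g 0 1 0 = deriv3 g 0 0 1 by rewrite /deriv3 (deriv2_swap 1 0 g2).
split=> //.
  by rewrite (deriv3_swap 1 0 0 g3).
by rewrite -e3 /deriv3 (deriv2_swap 1 0 g2).
Qed.

Lemma taylor_term2E g (b : X) (y : 'cV[R]_2) : Cn 2 g -> taylor_term 2 g b y =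
  deriv2 g 0 0 b * y 0 0 ^+ 2 + 2 * deriv2 g 0 1 b * (y 0 0 * y 1 0) +
  deriv2 g 1 1 b * y 1 0 ^+ 2.
Proof.
move=> g2.
have -> : taylor_term 2 g b y =
    y 0 0 * (y 0 0 * deriv2 g 0 0 b + y 1 0 * deriv2 g 1 0 b) +
    y 1 0 * (y 0 0 * deriv2 g 0 1 b + y 1 0 * deriv2 g 1 1 b).
  by rewrite (taylor_termS 1) (taylor_termS 0 (axis_derive 0 g))
    (taylor_termS 0 (axis_derive 1 g)).
rewrite (deriv2_swap 1 0 g2).
move: (deriv2 g 0 0 b) (deriv2 g 0 1 b) (deriv2 g 1 1 b) => d00 d01 d11.
ring.
Qed.

Lemma taylor_term3E g (b : X) (y : 'cV[R]_2) : Cn 3 g -> taylor_term 3 g b y =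
  deriv3 g 0 0 0 b * y 0 0 ^+ 3 + 3 * deriv3 g 0 0 1 b * (y 0 0 ^+ 2 * y 1 0) +
  3 * deriv3 g 0 1 1 b * (y 0 0 * y 1 0 ^+ 2) + deriv3 g 1 1 1 b * y 1 0 ^+ 3.
Proof.
move=> g3; have [_ e2 _ e4] := deriv3_sym g3.
have D j l k : deriv2 (axis_derive j g) l k = deriv3 g l k j by [].
have Hg j : Cn 2 (axis_derive j g) by exact: Cn_axis_derive.
rewrite (taylor_termS 2) (taylor_term2E _ _ (Hg 0)).
rewrite (taylor_term2E _ _ (Hg 1)) !D e2 e4.
move: (deriv3 g 0 0 0 b) (deriv3 g 0 0 1 b) (deriv3 g 0 1 1 b) (deriv3 g 1 1 1 b).
move=> d0 d1 d2 d3; ring.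
Qed.

Lemma taylor_sum2 g (b : X) (y : 'cV[R]_2) :
  \sum_(d < 2) taylor_term d g b y / d`!%:R = g b + taylor_term 1 g b y.
Proof.
pose t d := taylor_term d g b y.
have -> : \sum_(d < 2) taylor_term d g b y / d`!%:R = \sum_(d < 2) t d / d`!%:R by [].
rewrite -/(t 1%N) -[g b]/(t 0%N).
move: t => t.
by rewrite !big_ord_recr big_ord0 /= add0r !divr1.
Qed.

Lemma taylor_sum5 g (b : X) (y : 'cV[R]_2) :
  \sum_(d < 5) taylor_term d g b y / d`!%:R =
  g b + taylor_term 1 g b y + taylor_term 2 g b y / 2 +
  taylor_term 3 g b y / 6 + taylor_term 4 g b y / 24.
Proof.
pose t d := taylor_term d g b y.
have -> : \sum_(d < 5) taylor_term d g b y / d`!%:R = \sum_(d < 5) t d / d`!%:R by [].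
rewrite -/(t 1%N) -/(t 2%N) -/(t 3%N) -/(t 4%N) -[g b]/(t 0%N).
move: t => t.
by rewrite !big_ord_recr big_ord0 /= add0r !divr1.
Qed.

Section AtPoint.
Context (f : 'cV[R]_2 -> R -> 'cV[R]_2) (c : 'cV[R]_2) (a : R).
Definition component (m : 'I_2) : X -> R := fun Y => f Y.1 Y.2 m 0.
Hypothesis f_smooth : forall m n, Cn n (component m).
Local Notation F := (nonlinear_part (f ^~ a) c).

Lemma BformE x y m : Bform F x y m 0 =
  bilinear2 (deriv2 (component m) 0 0 (c, a)) (deriv2 (component m) 0 1 (c, a))
    (deriv2 (component m) 1 1 (c, a)) (x 0 0) (x 1 0) (y 0 0) (y 1 0).
Proof.
have P j k : partial j (partial k (fun w => F w m 0)) 0 =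
    deriv2 (component m) j k (c, a).
  by rewrite (partial2_nonlinear c a (f_smooth m)) addr0.
rewrite mxE; under eq_bigr => j _ do under eq_bigr => k _ do rewrite P.
rewrite !sum_ord2 (deriv2_swap 1 0 (f_smooth m 2)) /bilinear2.
move: (deriv2 (component m) 0 0 (c, a)) (deriv2 (component m) 0 1 (c, a))
  (deriv2 (component m) 1 1 (c, a)) => d00 d01 d11.
ring.
Qed.

Lemma CformE x y u m : Cform F x y u m 0 =
  trilinear2 (deriv3 (component m) 0 0 0 (c, a)) (deriv3 (component m) 0 0 1 (c, a))
    (deriv3 (component m) 0 1 1 (c, a)) (deriv3 (component m) 1 1 1 (c, a))
    (x 0 0) (x 1 0) (y 0 0) (y 1 0) (u 0 0) (u 1 0).
Proof.
have P l j k : partial l (partial j (partial k (fun w => F w m 0))) 0 =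
    deriv3 (component m) l j k (c, a).
  exact: (partial3_nonlinear c a (f_smooth m)).
have [e1 e2 e3 e4] := deriv3_sym (f_smooth m 3).
rewrite mxE.
under eq_bigr => j _ do under eq_bigr => k _ do under eq_bigr => l _ do rewrite P.
rewrite !sum_ord2 e1 e2 e3 e4 /trilinear2.
move: (deriv3 (component m) 0 0 0 (c, a)) (deriv3 (component m) 0 0 1 (c, a))
  (deriv3 (component m) 0 1 1 (c, a)) (deriv3 (component m) 1 1 1 (c, a)).
move=> d0 d1 d2 d3; ring.
Qed.

End AtPoint.

End Coefficients.

Section Expansion.
Context {R : realType}.
Implicit Types (z Q : R[i]).

Lemma bilinear2_expand (d00 d01 d11 y0 y1 : R) z Q :
  y0%:C = z + z^*%C -> y1%:C = z * Q + z^*%C * Q^*%C ->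
  (d00 * y0 ^+ 2 + 2 * d01 * (y0 * y1) + d11 * y1 ^+ 2)%:C =
  bilinear2 d00 d01 d11 1 Q 1 Q * (z ^+ 2) +
  2 * bilinear2 d00 d01 d11 1 Q 1 Q^*%C * (z * z^*%C) +
  bilinear2 d00 d01 d11 1 Q^*%C 1 Q^*%C * (z^*%C ^+ 2).
Proof.
move=> e0 e1.
have -> : (d00 * y0 ^+ 2 + 2 * d01 * (y0 * y1) + d11 * y1 ^+ 2)%:C =
    d00%:C * y0%:C ^+ 2 + 2 * d01%:C * (y0%:C * y1%:C) + d11%:C * y1%:C ^+ 2.
  rewrite -(rmorph_nat (real_complex R)) !expr2.
  by apply/eqP; rewrite eq_complex /=; apply/andP; split; apply/eqP; ring.
rewrite e0 e1 /bilinear2; ring.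
Qed.

Lemma trilinear2_expand (d0 d1 d2 d3 y0 y1 : R) z Q :
  y0%:C = z + z^*%C -> y1%:C = z * Q + z^*%C * Q^*%C ->
  (d0 * y0 ^+ 3 + 3 * d1 * (y0 ^+ 2 * y1) + 3 * d2 * (y0 * y1 ^+ 2) +
   d3 * y1 ^+ 3)%:C =
  trilinear2 d0 d1 d2 d3 1 Q 1 Q 1 Q * (z ^+ 3) +
  3 * trilinear2 d0 d1 d2 d3 1 Q 1 Q 1 Q^*%C * (z ^+ 2 * z^*%C) +
  3 * trilinear2 d0 d1 d2 d3 1 Q 1 Q^*%C 1 Q^*%C * (z * z^*%C ^+ 2) +
  trilinear2 d0 d1 d2 d3 1 Q^*%C 1 Q^*%C 1 Q^*%C * (z^*%C ^+ 3).
Proof.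
move=> e0 e1.
have -> : (d0 * y0 ^+ 3 + 3 * d1 * (y0 ^+ 2 * y1) + 3 * d2 * (y0 * y1 ^+ 2) +
   d3 * y1 ^+ 3)%:C =
    d0%:C * y0%:C ^+ 3 + 3 * d1%:C * (y0%:C ^+ 2 * y1%:C) +
    3 * d2%:C * (y0%:C * y1%:C ^+ 2) + d3%:C * y1%:C ^+ 3.
  rewrite -(rmorph_nat (real_complex R)) !exprS !expr0.
  by apply/eqP; rewrite eq_complex /=; apply/andP; split; apply/eqP; ring.
rewrite e0 e1 /trilinear2; ring.
Qed.

Definition col2 (u v : R[i]) : 'cV[R[i]]_2 := \col_i (if i == 0 then u else v).

Lemma inner_pnorm (A : 'M[R]_2) (lam : R[i]) (v : 'cV[R[i]]_2) :
  inner (pnorm A lam) v = left0 A lam * v 0 0 + left1 A lam * v 1 0.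
Proof. by rewrite /inner sum_ord2 /Num.conj /= !mxE /= !conjcK. Qed.

Lemma conjv_qnorm (A : 'M[R]_2) (lam : R[i]) :
  conjv (qnorm A lam) = col2 1 (slope A lam)^*%C.
Proof.
by apply/colP => i; rewrite !mxE; case: ifP => // _; rewrite conjc1.
Qed.

(** At lam = i om the real part of c1 is Re (g21 / 2) - Im (g20 g11 / 2) / om: the
terms in |g11|^2 and |g02|^2 are then imaginary.  Off the imaginary axis the
difference is mu times a quantity that stays bounded. *)
Lemma Re_c1_near_axis (mu om : R) (g20 g11 g02 g21 : R[i]) : om != 0 ->
  let lam := mu +i* om in
  let G := g20 * g11 in
  let L := mu ^+ 2 + om ^+ 2 in
  complex.Re ((2 * lam + lam^*%C) / (2 * (lam * lam^*%C)) * g20 * g11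
  + lam^-1 * (g11 * g11^*%C)
  + (2 * (2 * lam - lam^*%C))^-1 * (g02 * g02^*%C)
  + 2^-1 * g21) -
  (complex.Re (g21 / 2) - complex.Im (g20 / 2 * g11) / om) =
  mu * (3 * complex.Re G / (2 * L) + complex.Im G * mu / (2 * om * L) +
    complex.Re (g11 * g11^*%C) / L +
    complex.Re (g02 * g02^*%C) / (2 * (mu ^+ 2 + 9 * om ^+ 2))).
Proof.
move=> om0 lam G L.
have om2 : 0 < om ^+ 2 by rewrite exprn_even_gt0.
have mu2 := sqr_ge0 mu.
have L0 : mu ^+ 2 + om ^+ 2 != 0 by apply: lt0r_neq0; lra.
have L1 : mu ^+ 2 + 9 * om ^+ 2 != 0 by apply: lt0r_neq0; lra.
have e1 : (2 * lam + lam^*%C) / (2 * (lam * lam^*%C)) =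
    (3 * mu / (2 * L)) +i* (om / (2 * L)).
  have lam0 : lam != 0 by rewrite eq_complex /= negb_and om0 orbT.
  have lam0' : lam^*%C != 0 by rewrite conjc_eq0.
  apply: (mulIf (x := 2 * (lam * lam^*%C))).
    by rewrite mulf_neq0 ?mulf_neq0// pnatr_eq0.
  rewrite divfK ?mulf_neq0 ?mulf_neq0 ?pnatr_eq0//.
  rewrite -!(rmorph_nat (real_complex R)) /L.
  by apply/eqP; rewrite eq_complex /=; apply/andP; split; apply/eqP; field.
have e2 : lam^-1 = (mu / L) +i* (- om / L).
  by apply/eqP; rewrite eq_complex /=; apply/andP; split; apply/eqP; rewrite /L; ring.
have e3 : (2 * (2 * lam - lam^*%C))^-1 =
   (mu / (2 * (mu ^+ 2 + 9 * om ^+ 2))) +i* (- (3 * om) / (2 * (mu ^+ 2 + 9 * om ^+ 2))).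
  have e : 2 * (2 * lam - lam^*%C) = (2 * mu) +i* (6 * om).
    rewrite -!(rmorph_nat (real_complex R)).
    by apply/eqP; rewrite eq_complex /=; apply/andP; split; apply/eqP; ring.
  have d0 : (2 * mu) +i* (6 * om) != 0.
    by rewrite eq_complex /= negb_and !mulf_eq0 !pnatr_eq0 (negPf om0) orbT.
  rewrite e; apply: (mulfI d0); rewrite divff//.
  by apply/eqP; rewrite eq_complex /=; apply/andP; split; apply/eqP; field.
have e4 : (2 : R[i])^-1 = (2^-1)%:C.
  by rewrite -(rmorph_nat (real_complex R)) fmorphV.
rewrite {}e1 {}e2 {}e3 {}e4 {}/G {}/L.
case: g20 g11 g02 g21 => [a1 a2] [b1 b2] [c1 c2] [d1 d2] /=.
field; rewrite ?om0 ?L0 ?L1//.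
Qed.

End Expansion.

Section ParameterContinuity.
Context {R : realType} (a0 : R).
Implicit Types (u v : R -> R[i]).

Lemma ccontB u v : ccont a0 u -> ccont a0 v -> ccont a0 (fun a => u a - v a).
Proof. by move=> cu cv; apply: ccontD => //; exact: ccontN. Qed.

Lemma ccont_bilinear2 (d0 d1 d2 : R -> R) (x0 x1 y0 y1 : R -> R[i]) :
  {for a0, continuous d0} -> {for a0, continuous d1} -> {for a0, continuous d2} ->
  ccont a0 x0 -> ccont a0 x1 -> ccont a0 y0 -> ccont a0 y1 ->
  ccont a0 (fun a => bilinear2 (d0 a) (d1 a) (d2 a) (x0 a) (x1 a) (y0 a) (y1 a)).
Proof.
move=> c0 c1 c2 cx0 cx1 cy0 cy1.
apply: ccontD; [apply: ccontD|]; apply: ccontM; try exact: ccontR.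
- exact: ccontM.
- by apply: ccontD; exact: ccontM.
- exact: ccontM.
Qed.

Lemma ccont_trilinear2 (d0 d1 d2 d3 : R -> R) (x0 x1 y0 y1 u0 u1 : R -> R[i]) :
  {for a0, continuous d0} -> {for a0, continuous d1} ->
  {for a0, continuous d2} -> {for a0, continuous d3} ->
  ccont a0 x0 -> ccont a0 x1 -> ccont a0 y0 -> ccont a0 y1 ->
  ccont a0 u0 -> ccont a0 u1 ->
  ccont a0 (fun a => trilinear2 (d0 a) (d1 a) (d2 a) (d3 a)
    (x0 a) (x1 a) (y0 a) (y1 a) (u0 a) (u1 a)).
Proof.
move=> c0 c1 c2 c3 cx0 cx1 cy0 cy1 cu0 cu1.
have c3M (f g h : R -> R[i]) : ccont a0 f -> ccont a0 g -> ccont a0 h ->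
    ccont a0 (fun a => f a * g a * h a).
  by move=> cf cg ch; apply: ccontM => //; exact: ccontM.
apply: ccontD; [apply: ccontD; [apply: ccontD|]|]; apply: ccontM;
  try exact: ccontR.
- exact: c3M.
- by apply: ccontD; [apply: ccontD|]; exact: c3M.
- by apply: ccontD; [apply: ccontD|]; exact: c3M.
- exact: c3M.
Qed.

End ParameterContinuity.

(** * The family of cycles at a Hopf point *)

Section HopfFamily.
Context {R : realType}.
Local Notation X := ('cV[R]_2 * R)%type.
Context (f : 'cV[R]_2 -> R -> 'cV[R]_2) (f_smooth : smooth_family f).
Context (alphas : R) (J : set R) (J_open : open J) (J_alphas : J alphas).
Context (x0 : R -> 'cV[R]_2).
Hypothesis x0_cont : forall alpha, J alpha -> {for alpha, continuous x0}.
Hypothesis x0_equil : forall alpha, J alpha -> f (x0 alpha) alpha = 0.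
Context (mu omega : R -> R).
Hypothesis omega_gt0 : forall alpha, J alpha -> 0 < omega alpha.

Definition jac alpha := jacobian_mx (f ^~ alpha) (x0 alpha).
Definition nlin alpha := nonlinear_part (f ^~ alpha) (x0 alpha).
Definition lam alpha := mu alpha +i* omega alpha.

(* The consequences of the eigenvalue equations that involve neither q nor p. *)
Hypothesis jac01 : forall alpha, J alpha -> jac alpha 0 1 != 0.
Hypothesis jac_trace : forall alpha, J alpha ->
  jac alpha 0 0 + jac alpha 1 1 = 2 * mu alpha.
Hypothesis jac_det : forall alpha, J alpha ->
  jac alpha 0 0 * jac alpha 1 1 - jac alpha 0 1 * jac alpha 1 0 =
  mu alpha ^+ 2 + omega alpha ^+ 2.
Hypothesis mu_alphas : mu alphas = 0.
Hypothesis mu_cont : {for alphas, continuous mu}.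

Definition qn alpha := qnorm (jac alpha) (lam alpha).
Definition pn alpha := pnorm (jac alpha) (lam alpha).
Definition slp alpha := slope (jac alpha) (lam alpha).
Definition l0 alpha := left0 (jac alpha) (lam alpha).
Definition l1 alpha := left1 (jac alpha) (lam alpha).
Definition kap alpha := complex.Re (c1 (nlin alpha) (lam alpha) (qn alpha) (pn alpha)).
Hypothesis kap_alphas : kap alphas != 0.

Lemma component_smooth (m : 'I_2) n : Cn n (component f m).
Proof. by apply: (@Cn_component _ _ n (fun Y : X => f Y.1 Y.2)); exact: f_smooth. Qed.

Lemma branch_cvg : (x0 alpha, alpha) @[alpha --> alphas] --> (x0 alphas, alphas).
Proof.
move=> P [[U V] /= [U0 V0] UV].
have h1 : nbhs alphas (x0 @^-1` U) by exact: (x0_cont J_alphas U0).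
exact: (@filterS2 _ (nbhs alphas) _ (x0 @^-1` U) V _
  (fun a Ua Va => UV (x0 a, a) (conj Ua Va)) h1 V0).
Qed.

Lemma branch_continuous (h : X -> R) : Cn 0 h ->
  {for alphas, continuous (fun alpha => h (x0 alpha, alpha))}.
Proof. by move=> ch; exact: cvg_comp branch_cvg (ch _). Qed.

Lemma jac_axis alpha m k :
  jac alpha m k = axis_derive k (component f m) (x0 alpha, alpha).
Proof. exact: jacobian_slice. Qed.

Lemma jac_cont m k : {for alphas, continuous (fun alpha => jac alpha m k)}.
Proof.
have -> : (fun alpha => jac alpha m k) =
    (fun alpha => axis_derive k (component f m) (x0 alpha, alpha)).
  by apply/funext => alpha; rewrite jac_axis.
by apply: branch_continuous; apply: Cn_axis_derive; exact: component_smooth.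
Qed.

Lemma near_J : \forall alpha \near alphas, J alpha.
Proof. exact: open_nbhs_nbhs. Qed.

(** The determinant of the Jacobian matrix is mu^2 + omega^2, and omega is positive. *)
Lemma omega_cont : {for alphas, continuous omega}.
Proof.
pose d alpha := jac alpha 0 0 * jac alpha 1 1 - jac alpha 0 1 * jac alpha 1 0
  - mu alpha ^+ 2.
have dE alpha : J alpha -> omega alpha = Num.sqrt (d alpha).
  move=> Ja; rewrite /d jac_det// addrC addKr sqrtr_sqr ger0_norm// ltW//.
  exact: omega_gt0.
have cd : {for alphas, continuous d}.
  apply: cvgB; last by apply: cvgM; exact: mu_cont.
  by apply: cvgB; apply: cvgM; exact: jac_cont.
have cs : {for alphas, continuous (fun alpha => Num.sqrt (d alpha))}.
  by apply: continuous_comp => //; exact: sqrt_continuous.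
suff : omega a @[a --> alphas] --> omega alphas by [].
rewrite (dE _ J_alphas).
apply: cvg_trans cs; apply: near_eq_cvg.
by apply: filterS near_J => alpha Ja; rewrite dE.
Qed.

Lemma lam_ccont : ccont alphas lam.
Proof. by split; [exact: mu_cont|exact: omega_cont]. Qed.

Lemma omega_alphas : 0 < omega alphas. Proof. exact: omega_gt0. Qed.

Lemma slp_ccont : ccont alphas slp.
Proof.
apply: ccontM; first by apply: ccontB; [exact: lam_ccont|exact/ccontR/jac_cont].
apply: ccontV; last exact/ccontR/jac_cont.
by rewrite eq_complex /= eqxx andbT jac01.
Qed.

Lemma gap_ccont : ccont alphas (fun alpha => (lam alpha - (lam alpha)^*%C)^-1).
Proof.
apply: ccontV; last by apply: ccontB; [|apply: ccontJ]; exact: lam_ccont.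
rewrite eq_complex /= opprK negb_and; apply/orP; right.
by apply: lt0r_neq0; apply: addr_gt0; exact: omega_alphas.
Qed.

Lemma l0_ccont : ccont alphas l0.
Proof.
apply: ccontM; last exact: gap_ccont.
by apply: ccontB; [exact: lam_ccont|exact/ccontR/jac_cont].
Qed.

Lemma l1_ccont : ccont alphas l1.
Proof. by apply: ccontM; [exact/ccontR/jac_cont|exact: gap_ccont]. Qed.

(** Second and third derivatives of the component m of f at the equilibrium,
polarised and evaluated at the vectors (1, u), (1, v) and (1, w). *)
Definition B2 alpha m (u v : R[i]) : R[i] :=
  let g := component f m in let b := (x0 alpha, alpha) in
  bilinear2 (deriv2 g 0 0 b) (deriv2 g 0 1 b) (deriv2 g 1 1 b) 1 u 1 v.

Definition C3 alpha m (u v w : R[i]) : R[i] :=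
  let g := component f m in let b := (x0 alpha, alpha) in
  trilinear2 (deriv3 g 0 0 0 b) (deriv3 g 0 0 1 b) (deriv3 g 0 1 1 b)
    (deriv3 g 1 1 1 b) 1 u 1 v 1 w.

(** Inner products of the adjoint eigenvector with the vector-valued forms; at the
slope of q and its conjugate they are the coefficients g20, g11, g02 and g21. *)
Definition pB alpha u v := l0 alpha * B2 alpha 0 u v + l1 alpha * B2 alpha 1 u v.
Definition pC alpha u v w :=
  l0 alpha * C3 alpha 0 u v w + l1 alpha * C3 alpha 1 u v w.

Lemma deriv2_cont m j k : {for alphas, continuous
  (fun alpha => deriv2 (component f m) j k (x0 alpha, alpha))}.
Proof.
by apply: branch_continuous; do 2 apply: Cn_axis_derive; exact: component_smooth.
Qed.

Lemma deriv3_cont m l j k : {for alphas, continuous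
  (fun alpha => deriv3 (component f m) l j k (x0 alpha, alpha))}.
Proof.
by apply: branch_continuous; do 3 apply: Cn_axis_derive; exact: component_smooth.
Qed.

Lemma pB_ccont (u v : R -> R[i]) : ccont alphas u -> ccont alphas v ->
  ccont alphas (fun alpha => pB alpha (u alpha) (v alpha)).
Proof.
move=> cu cv; apply: ccontD; apply: ccontM; rewrite ?/B2;
  try exact: l0_ccont; try exact: l1_ccont;
  apply: ccont_bilinear2 => //; try exact: deriv2_cont; exact: ccont_cst.
Qed.

Lemma pC_ccont (u v w : R -> R[i]) :
  ccont alphas u -> ccont alphas v -> ccont alphas w ->
  ccont alphas (fun alpha => pC alpha (u alpha) (v alpha) (w alpha)).
Proof.
move=> cu cv cw; apply: ccontD; apply: ccontM; rewrite ?/C3;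
  try exact: l0_ccont; try exact: l1_ccont;
  apply: ccont_trilinear2 => //; try exact: deriv3_cont; exact: ccont_cst.
Qed.

Lemma g20E alpha : g20 (nlin alpha) (qn alpha) (pn alpha) =
  pB alpha (slp alpha) (slp alpha).
Proof.
rewrite /g20 inner_pnorm !(BformE _ _ component_smooth) /pB /B2.
by rewrite !mxE.
Qed.

Lemma g11E alpha : g11 (nlin alpha) (qn alpha) (pn alpha) =
  pB alpha (slp alpha) (slp alpha)^*%C.
Proof.
rewrite /g11 inner_pnorm !(BformE _ _ component_smooth) /pB /B2 conjv_qnorm.
by rewrite !mxE.
Qed.

Lemma g02E alpha : g02 (nlin alpha) (qn alpha) (pn alpha) =
  pB alpha (slp alpha)^*%C (slp alpha)^*%C.
Proof.
rewrite /g02 inner_pnorm !(BformE _ _ component_smooth) /pB /B2 conjv_qnorm.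
by rewrite !mxE.
Qed.

Lemma g21E alpha : g21 (nlin alpha) (qn alpha) (pn alpha) =
  pC alpha (slp alpha) (slp alpha) (slp alpha)^*%C.
Proof.
rewrite /g21 inner_pnorm !(CformE _ _ component_smooth) /pC /C3 conjv_qnorm.
by rewrite !mxE.
Qed.

Local Notation G20 alpha := (pB alpha (slp alpha) (slp alpha)).
Local Notation G11 alpha := (pB alpha (slp alpha) (slp alpha)^*%C).
Local Notation G02 alpha := (pB alpha (slp alpha)^*%C (slp alpha)^*%C).
Local Notation G21 alpha := (pC alpha (slp alpha) (slp alpha) (slp alpha)^*%C).

Lemma kapE alpha : kap alpha = complex.Re
  ((2 * lam alpha + (lam alpha)^*%C) / (2 * (lam alpha * (lam alpha)^*%C)) *
     G20 alpha * G11 alpha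
  + (lam alpha)^-1 * (G11 alpha * (G11 alpha)^*%C)
  + (2 * (2 * lam alpha - (lam alpha)^*%C))^-1 * (G02 alpha * (G02 alpha)^*%C)
  + 2^-1 * G21 alpha).
Proof. by rewrite /kap /c1 g20E g11E g02E g21E !sqr_normC. Qed.

Lemma G_ccont : [/\ ccont alphas (fun a => G20 a), ccont alphas (fun a => G11 a),
  ccont alphas (fun a => G02 a) & ccont alphas (fun a => G21 a)].
Proof.
have cs := slp_ccont; have cs' := ccontJ slp_ccont.
by split; [exact: pB_ccont|exact: pB_ccont|exact: pB_ccont|exact: pC_ccont].
Qed.

(** The value that Re c1 would have with the same quadratic and cubic coefficients
and lambda replaced by i omega; it is the coefficient of bigo_amplitude. *)
Definition kap_axis alpha := complex.Re (G21 alpha / 2) -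
  complex.Im (G20 alpha / 2 * G11 alpha) / omega alpha.

Definition kap_defect alpha :=
  let G := G20 alpha * G11 alpha in
  let L := mu alpha ^+ 2 + omega alpha ^+ 2 in
  3 * complex.Re G / (2 * L) +
  complex.Im G * mu alpha / (2 * omega alpha * L) +
  complex.Re (G11 alpha * (G11 alpha)^*%C) / L +
  complex.Re (G02 alpha * (G02 alpha)^*%C) / (2 * (mu alpha ^+ 2 + 9 * omega alpha ^+ 2)).

Lemma kap_split alpha : J alpha ->
  kap alpha - kap_axis alpha = mu alpha * kap_defect alpha.
Proof.
move=> Ja; rewrite kapE; apply: Re_c1_near_axis.
by apply: lt0r_neq0; exact: omega_gt0.
Qed.

Lemma kap_defect_cont : {for alphas, continuous kap_defect}.
Proof.
have [c20 c11 c02 _] := G_ccont.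
have [rG iG] := ccontM c20 c11.
have [r11 _] := ccontM c11 (ccontJ c11).
have [r02 _] := ccontM c02 (ccontJ c02).
have cm2 : mu a ^+ 2 @[a --> alphas] --> mu alphas ^+ 2 by apply: cvgM; exact: mu_cont.
have co2 : omega a ^+ 2 @[a --> alphas] --> omega alphas ^+ 2.
  by apply: cvgM; exact: omega_cont.
have c (k : R) : (fun=> k) @ alphas --> k by exact: cvg_cst.
have o0 := omega_alphas.
have L0 : mu alphas ^+ 2 + omega alphas ^+ 2 != 0.
  by rewrite mu_alphas expr0n add0r; apply: lt0r_neq0; exact: exprn_gt0.
have L1 : mu alphas ^+ 2 + 9 * omega alphas ^+ 2 != 0.
  rewrite mu_alphas expr0n add0r mulf_neq0 ?pnatr_eq0//.
  by apply: lt0r_neq0; exact: exprn_gt0.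
have cL : mu a ^+ 2 + omega a ^+ 2 @[a --> alphas] -->
    mu alphas ^+ 2 + omega alphas ^+ 2 by exact: cvgD.
have cL1 : mu a ^+ 2 + 9 * omega a ^+ 2 @[a --> alphas] -->
    mu alphas ^+ 2 + 9 * omega alphas ^+ 2.
  by apply: cvgD => //; apply: cvgM => //; exact: c.
apply: cvgD; [apply: cvgD; [apply: cvgD|]|].
- apply: cvgM; first by apply: cvgM; [exact: c|exact: rG].
  apply: cvgV; first by rewrite mulf_neq0 ?pnatr_eq0.
  by apply: cvgM; [exact: c|exact: cL].
- apply: cvgM; first by apply: cvgM; [exact: iG|exact: mu_cont].
  apply: cvgV; first by rewrite !mulf_neq0 ?pnatr_eq0// lt0r_neq0.
  apply: cvgM; last exact: cL.
  by apply: cvgM; [exact: c|exact: omega_cont].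
- by apply: cvgM; [exact: r11|exact: cvgV].
- apply: cvgM; first exact: r02.
  apply: cvgV; first by rewrite mulf_neq0 ?pnatr_eq0.
  by apply: cvgM; [exact: c|exact: cL1].
Qed.

Lemma kap_cont : {for alphas, continuous kap}.
Proof.
have [c20 c11 c02 c21] := G_ccont.
have cl := lam_ccont; have cl' := ccontJ lam_ccont.
have c2 : ccont alphas (fun=> 2) by exact: ccont_cst.
have l0 : lam alphas != 0.
  by rewrite eq_complex /= negb_and (gt_eqF omega_alphas) orbT.
have l0' : (lam alphas)^*%C != 0 by rewrite conjc_eq0.
have -> : kap = (fun a => complex.Re
  ((2 * lam a + (lam a)^*%C) / (2 * (lam a * (lam a)^*%C)) * G20 a * G11 a
  + (lam a)^-1 * (G11 a * (G11 a)^*%C)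
  + (2 * (2 * lam a - (lam a)^*%C))^-1 * (G02 a * (G02 a)^*%C)
  + 2^-1 * G21 a)) by apply/funext => a; exact: kapE.
suff [] : ccont alphas (fun a =>
  ((2 * lam a + (lam a)^*%C) / (2 * (lam a * (lam a)^*%C)) * G20 a * G11 a
  + (lam a)^-1 * (G11 a * (G11 a)^*%C)
  + (2 * (2 * lam a - (lam a)^*%C))^-1 * (G02 a * (G02 a)^*%C)
  + 2^-1 * G21 a)) by [].
apply: ccontD; last by apply: ccontM => //; exact: ccont_cst.
apply: ccontD; [apply: ccontD|].
- apply: ccontM => //; apply: ccontM => //; apply: ccontM.
    by apply: ccontD => //; exact: ccontM.
  apply: ccontV; first by rewrite !mulf_neq0// pnatr_eq0.
  by apply: ccontM => //; exact: ccontM.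
- apply: ccontM; first exact: ccontV.
  by apply: ccontM => //; exact: ccontJ.
- apply: ccontM; last by apply: ccontM => //; exact: ccontJ.
  apply: ccontV; last first.
    by apply: ccontM => //; apply: ccontB => //; exact: ccontM.
  rewrite mulf_neq0 ?pnatr_eq0//.
  rewrite -(rmorph_nat (real_complex R)) eq_complex /= negb_and; apply/orP; right.
  rewrite !mul0r addr0 opprK; apply: lt0r_neq0.
  by have := omega_alphas; lra.
Qed.

Context (I : set R) (x : R -> R -> 'cV[R]_2) (T : R -> R).
Hypothesis cycles : hopf_cycles f x0 omega alphas I x T.

(* At alphas itself the cycle degenerates to the equilibrium and eps vanishes. *)
Local Notation F_ := (within I (alphas^')).
Local Notation bigo := (bigo F_ T).

Lemma F_nbhs : F_ `=>` nbhs alphas.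
Proof. by move=> P /nbhs_dnbhs h; apply: (filterS _ h) => b Pb _. Qed.

Lemma F_I : \forall a \near F_, I a /\ a != alphas.
Proof. by apply: filterS (nbhs_dnbhs_neq alphas) => a aa Ia. Qed.

Lemma F_J : \forall a \near F_, J a.
Proof. by apply: F_nbhs; exact: near_J. Qed.

Lemma F_bigo c : ccont alphas c -> bigo (fun a _ => c a) (fun=> 1).
Proof. by apply: ccont_bigo; exact: F_nbhs. Qed.

Definition y a t := x a t - x0 a.
Definition z a t := eigencoord (jac a) (mu a) (omega a) (y a t 0 0) (y a t 1 0).
(** The nonlinear part of f along the cycle. *)
Definition remainder a t m :=
  f (x a t) a m 0 - (jac a m 0 * y a t 0 0 + jac a m 1 * y a t 1 0).
(** The nonlinear part of the equation for z. *)
Definition n a t :=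
  eigencoord (jac a) (mu a) (omega a) (remainder a t 0) (remainder a t 1).

Lemma y0E a t : J a -> (y a t 0 0)%:C = z a t + (z a t)^*%C.
Proof. by move=> Ja; apply: eigencoord0; exact: omega_gt0. Qed.

Lemma y1E a t : J a -> (y a t 1 0)%:C = z a t * slp a + (z a t)^*%C * (slp a)^*%C.
Proof.
by move=> Ja; apply: eigencoord1; [exact: omega_gt0|exact: jac01|exact: jac_trace].
Qed.

Lemma F_orbit : \forall a \near F_, limit_cycle (f ^~ a) (x a) (T a) /\
  surrounds (x a) (T a) (x0 a).
Proof.
by case: cycles => H _ _ _; apply: filterS F_I => a [Ia aa]; exact: H.
Qed.

Lemma F_solution : \forall a \near F_, [/\ 0 < T a,
  forall t : R, is_derive t 1 (x a) (f (x a t) a) & forall t, x a (t + T a) = x a t].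
Proof. by apply: filterS F_orbit => a [[[T0 dx xT _] _] _]. Qed.

Lemma is_derive_y (a t : R) (m : 'I_2) : is_derive t 1 (x a) (f (x a t) a) ->
  is_derive t 1 (fun s => y a s m 0) (f (x a t) a m 0).
Proof.
move=> dx; have h := is_deriveB (is_derive_coord m dx) (is_derive_cst (x0 a m 0) t 1).
rewrite subr0 in h.
by have -> : (fun s => y a s m 0) = (fun s => x a s m 0) - cst (x0 a m 0) by
  apply/funext => s; rewrite /y !mxE.
Qed.

(** The left eigenvector property turns the linear part into lam z. *)
Lemma z_ode : \forall a \near F_, forall t, is_cderive t (z a) (lam a * z a t + n a t).
Proof.
apply: filterS2 F_J F_solution => a Ja [_ dx _] t.
have H (c0 c1 : R[i]) : is_cderive t (fun s => c0 * (y a s 0 0)%:C + c1 * (y a s 1 0)%:C)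
   (c0 * (f (x a t) a 0 0)%:C + c1 * (f (x a t) a 1 0)%:C).
  have K c m : is_cderive t (fun s => c * (y a s m 0)%:C) (c * (f (x a t) a m 0)%:C).
    rewrite -[X in is_cderive _ _ X]add0r -[X in X + _](mul0r (y a t m 0)%:C).
    apply: is_cderiveM; first exact: is_cderive_cst.
    by apply: is_cderiveR; exact: is_derive_y.
  exact: is_cderiveD.
have -> : lam a * z a t + n a t = l0 a * (f (x a t) a 0 0)%:C + l1 a * (f (x a t) a 1 0)%:C.
  rewrite /z -(eigencoord_linear (omega_gt0 Ja) (jac01 Ja) (jac_trace Ja) (jac_det Ja)).
  rewrite /n /remainder /eigencoord.
  rewrite -/(l0 a) -/(l1 a) !(rmorphB (real_complex R)); ring.
exact: H.
Qed.

Lemma z_per : \forall a \near F_, z a (T a) = z a 0.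
Proof.
apply: filterS F_solution => a [_ _ xT].
by rewrite /z /y -{1 2}[T a]add0r xT.
Qed.

Lemma T_gt0 : \forall a \near F_, 0 < T a.
Proof. by apply: filterS F_solution => a []. Qed.

Lemma z_cont : \forall a \near F_, ccontinuous (z a).
Proof. by apply: filterS z_ode => a; exact: is_cderive_continuous. Qed.

Lemma x_cont : \forall a \near F_, continuous (x a).
Proof.
apply: filterS F_solution => a [_ dx _] t; apply: differentiable_continuous.
by apply/derivable1_diffP; case: (dx t).
Qed.

Lemma remainder_cont m : \forall a \near F_, continuous (fun t => remainder a t m).
Proof.
apply: filterS x_cont => a cx.
have cy j : continuous (fun t => y a t j 0).
  move=> t; rewrite /y; under eq_fun do rewrite !mxE.
  apply: cvgB; last exact: cvg_cst.
  apply: (@continuous_comp _ _ _ (x a) (fun M : 'cV[R]_2 => M j 0)); first exact: cx.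
  exact: coord_continuous.
have cJ j : continuous (fun t => jac a m j * y a t j 0).
  by move=> t; apply: cvgM; [exact: cvg_cst|exact: cy].
have cf : continuous (fun t => component f m (x a t, a)).
  move=> t; have h : continuous (component f m) by exact: (component_smooth m 0).
  apply: (@continuous_comp _ _ _ (fun s => (x a s, a)) (component f m)); last exact: h.
  move=> P [[U V] /= [U0 V0] UV].
  exact: (@filterS _ (nbhs t) _ (x a @^-1` U) _
    (fun s Us => UV (x a s, a) (conj Us (nbhs_singleton V0))) (cx t U U0)).
move=> t; apply: cvgB; first exact: cf.
by apply: cvgD; exact: cJ.
Qed.

Lemma n_cont : \forall a \near F_, ccontinuous (n a).
Proof.
apply: filterS2 (remainder_cont 0) (remainder_cont 1) => a c0 c1.
by apply: ccontinuousD; apply: ccontinuousM; try exact: ccontinuous_cst;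
  exact: ccontinuousR.
Qed.

Lemma y_small (e : R) : 0 < e -> \forall a \near F_, forall t, `|y a t| < e.
Proof.
case: cycles => _ _ H _ /H h.
by apply: filterS2 F_I (F_nbhs h) => a [Ia _]; exact.
Qed.

Lemma F_cvg_dist (V : normedModType R) (g : R -> V) (e : R) : 0 < e ->
  g a @[a --> alphas] --> g alphas -> \forall a \near F_, `|g alphas - g a| < e.
Proof. by move=> e0 /cvgrPdist_lt /(_ e e0) h; exact: F_nbhs. Qed.

Lemma omega_low : \forall a \near F_, omega alphas / 2 <= omega a.
Proof.
have e0 : 0 < omega alphas / 2 by rewrite divr_gt0 ?omega_alphas.
apply: filterS (F_cvg_dist e0 omega_cont) => a.
move=> /ltW; rewrite ler_norml => /andP[_]; lra.
Qed.

Lemma mu_small (e : R) : 0 < e -> \forall a \near F_, `|mu a| <= e.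
Proof.
move=> e0; apply: filterS (F_cvg_dist e0 mu_cont) => a.
by rewrite mu_alphas sub0r normrN => /ltW.
Qed.

(** The period is close to 2 pi / omega, and omega a >= omega alphas / 2 near alphas. *)
Definition T0 := 2 * pi / (omega alphas / 2) + 1.

Lemma T0_ge0 : 0 <= T0.
Proof.
rewrite addr_ge0// divr_ge0 ?mulr_ge0 ?pi_ge0//.
exact: ltW omega_alphas.
Qed.

Lemma T_le : \forall a \near F_, T a <= T0.
Proof.
case: cycles => _ _ _ /cvgr0_norm_lt /(_ 1 ltr01) h.
apply: filterS2 omega_low h => a oa.
move=> /ltW; rewrite ler_norml => /andP[_].
rewrite lerBlDr addrC => /le_trans; apply.
rewrite lerD2r ler_wpM2l ?mulr_ge0 ?pi_ge0//.
have o0 : 0 < omega alphas / 2 by rewrite divr_gt0 ?omega_alphas.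
by rewrite lef_pV2 ?posrE// (lt_le_trans o0).
Qed.

Lemma F_bound c : ccont alphas c ->
  exists2 C : R, 0 <= C & \forall a \near F_, normc (c a) <= C.
Proof.
move=> /F_bigo[C C0 H]; exists C => //.
apply: filterS2 T_gt0 H => a Ta /(_ 0); rewrite lexx ltW// mulr1.
exact.
Qed.

Lemma y_le_z : exists2 K : R, 0 <= K &
  \forall a \near F_, forall t, `|y a t| <= K * normc (z a t).
Proof.
have [C C0 H] := F_bound slp_ccont.
exists (2 + 2 * C); first by lra.
apply: filterS2 F_J H => a Ja Ha t.
rewrite (le_trans (norm_le_coords _))// mulrDl lerD//.
  rewrite -normcr y0E// (le_trans (le_normcD _ _))// normc_conj.
  by rewrite mulr_natl mulr2n.
rewrite -normcr y1E// (le_trans (le_normcD _ _))// (ComplexField.Normc.normcM (z a t)).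
rewrite (ComplexField.Normc.normcM (z a t)^*%C) !normc_conj.
by have := ler_wpM2l (normc_ge0 (z a t)) Ha; lra.
Qed.

Lemma taylor_along N m : exists2 C : R, 0 <= C & \forall a \near F_, forall t,
  `|f (x a t) a m 0 - \sum_(d < N) taylor_term d (component f m) (x0 a, a) (y a t) / d`!%:R|
    <= C * `|y a t| ^+ N.
Proof.
have [C [r [C0 r0 H]]] := taylor_expansion (x0 alphas, alphas) (component_smooth m N).
exists C => //.
apply: filterS2 (F_cvg_dist r0 branch_cvg) (y_small r0) => a ar yr t.
have := H _ _ ar (yr t).
have -> : (x0 a, a) + state_dir (y a t) = (x a t, a).
  by rewrite /state_dir /y; congr pair; rewrite /= ?addr0// addrC subrK.
exact.
Qed.

Lemma taylor_low a t m : J a ->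
  component f m (x0 a, a) = 0 /\
  taylor_term 1 (component f m) (x0 a, a) (y a t) =
    jac a m 0 * y a t 0 0 + jac a m 1 * y a t 1 0.
Proof.
move=> Ja; split; first by rewrite /component /= x0_equil// mxE.
by rewrite taylor_termS /= !jac_axis; congr (_ + _); rewrite mulrC.
Qed.

(** The Taylor polynomial of degree 1 at the equilibrium is the linear part. *)
Lemma remainder_bound2 m : exists2 C : R, 0 <= C & \forall a \near F_, forall t,
  `|remainder a t m| <= C * `|y a t| ^+ 2.
Proof.
have [C C0 H] := taylor_along 2 m; exists C => //.
apply: filterS2 F_J H => a Ja Ha t.
have [e0 e1] := taylor_low t m Ja.
suff -> : remainder a t m = f (x a t) a m 0 -
  \sum_(d < 2) taylor_term d (component f m) (x0 a, a) (y a t) / d`!%:R by exact: Ha.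
by rewrite taylor_sum2 e0 e1 add0r.
Qed.

Definition tail a t m := remainder a t m
  - (taylor_term 2 (component f m) (x0 a, a) (y a t) / 2 +
     taylor_term 3 (component f m) (x0 a, a) (y a t) / 6 +
     taylor_term 4 (component f m) (x0 a, a) (y a t) / 24).

Lemma tail_bound5 m : exists2 C : R, 0 <= C & \forall a \near F_, forall t,
  `|tail a t m| <= C * `|y a t| ^+ 5.
Proof.
have [C C0 H] := taylor_along 5 m; exists C => //.
apply: filterS2 F_J H => a Ja Ha t.
have [e0 e1] := taylor_low t m Ja.
suff -> : tail a t m = f (x a t) a m 0 -
  \sum_(d < 5) taylor_term d (component f m) (x0 a, a) (y a t) / d`!%:R by exact: Ha.
rewrite taylor_sum5 e0 e1 /tail /remainder.
move: (taylor_term 2 _ _ _) (taylor_term 3 _ _ _) (taylor_term 4 _ _ _) => t2 t3 t4.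
move: (_ + _) (f _ _ _ _) => t1 u.
by rewrite add0r !opprD !addrA.
Qed.

Definition covector a (r : 'I_2 -> R) : R[i] := l0 a * (r 0)%:C + l1 a * (r 1)%:C.

Lemma covector_bound (r : R -> R -> 'I_2 -> R) k :
  (forall m, exists2 C : R, 0 <= C &
     \forall a \near F_, forall t, `|r a t m| <= C * `|y a t| ^+ k) ->
  exists2 C : R, 0 <= C &
     \forall a \near F_, forall t, normc (covector a (r a t)) <= C * `|y a t| ^+ k.
Proof.
move=> rb.
have [L0 L00 H0] := F_bound l0_ccont; have [L1 L10 H1] := F_bound l1_ccont.
have [C0 C00 G0] := rb 0; have [C1 C10 G1] := rb 1.
exists (L0 * C0 + L1 * C1); first by rewrite addr_ge0// mulr_ge0.
apply: filterS2 (filterI H0 H1) (filterI G0 G1) => a [h0 h1] [g0 g1] t.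
rewrite (le_trans (le_normcD _ _))// mulrDl lerD//.
  by rewrite (ComplexField.Normc.normcM (l0 a)) normcr -mulrA ler_pM ?normc_ge0.
by rewrite (ComplexField.Normc.normcM (l1 a)) normcr -mulrA ler_pM ?normc_ge0.
Qed.

Lemma n_le : exists2 C : R, 0 <= C & \forall a \near F_, forall t,
  normc (n a t) <= C * `|y a t| ^+ 2.
Proof. by apply: covector_bound; exact: remainder_bound2. Qed.

(** A quadratic bound on n becomes linear with a small constant, as the cycles
shrink to the equilibrium; this is the form required by the Gronwall estimate. *)
Lemma n_small : \forall a \near F_, forall t, normc (n a t) <= normc (z a t) / 4.
Proof.
have [C C0 H] := n_le; have [K K0 G] := y_le_z.
have e0 : 0 < (4 * (C * K + 1))^-1.
  by rewrite invr_gt0 mulr_gt0// ltr_wpDl ?mulr_ge0.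
apply: filterS3 H G (y_small e0) => a Ha Ga ya t.
rewrite (le_trans (Ha t))// expr2 mulrA.
apply: (@le_trans _ _ (C * (4 * (C * K + 1))^-1 * (K * normc (z a t)))).
  by apply: ler_pM; rewrite ?mulr_ge0// ler_wpM2l// ltW.
have -> : C * (4 * (C * K + 1))^-1 * (K * normc (z a t)) =
    normc (z a t) / 4 * (C * K / (C * K + 1)).
  by field; apply: lt0r_neq0; rewrite ltr_wpDl ?mulr_ge0.
rewrite -[leRHS]mulr1 ler_wpM2l//.
  by rewrite divr_ge0// normc_ge0.
by rewrite ler_pdivrMr ?mul1r ?lerDl// ltr_wpDl ?mulr_ge0.
Qed.

Definition radius2 a t := normc (z a t) ^+ 2.
(** Defined from the value at time 0 and enlarged by the Gronwall factor, so that
it dominates |z| over the whole period. *)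
Definition eps a := Num.sqrt (expR T0 * radius2 a 0).

Lemma radius2_ge0 a t : 0 <= radius2 a t. Proof. exact: sqr_ge0. Qed.

Lemma eps_ge0 a : 0 <= eps a. Proof. exact: sqrtr_ge0. Qed.

Lemma eps_sqr a : eps a ^+ 2 = expR T0 * radius2 a 0.
Proof. by rewrite sqr_sqrtr// mulr_ge0 ?expR_ge0 ?radius2_ge0. Qed.

Lemma radius2_gronwall : \forall a \near F_, forall t, 0 <= t <= T a ->
  radius2 a t <= eps a ^+ 2 /\ eps a ^+ 2 <= expR T0 ^+ 2 * radius2 a t.
Proof.
have e4 : 0 < 4^-1 :> R by rewrite invr_gt0.
apply: filterS3 (filterI z_ode n_small) (mu_small e4) (filterI T_gt0 T_le) =>
  a [dz nz] mua [Ta0 TaT] t tT.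
have dr (s : R) : is_derive s 1 (radius2 a)
    (2 * complex.Re ((z a s)^*%C * (lam a * z a s + n a s))).
  exact: is_derive_sqr_normc.
have b s : `|2 * complex.Re ((z a s)^*%C * (lam a * z a s + n a s))| <= radius2 a s.
  have -> : complex.Re ((z a s)^*%C * (lam a * z a s + n a s)) =
      mu a * radius2 a s + complex.Re ((z a s)^*%C * n a s).
    rewrite /radius2 normc_sqr /lam.
    move: (z a s) (n a s) => [u1 u2] [v1 v2] /=; ring.
  have h1 : `|complex.Re ((z a s)^*%C * n a s)| <= radius2 a s / 4.
    apply: le_trans (normr_Re_le _) _.
    rewrite (ComplexField.Normc.normcM (z a s)^*%C) normc_conj /radius2 expr2 -mulrA.
    by apply: ler_wpM2l; [exact: normc_ge0|exact: nz].
  have h2 : `|mu a * radius2 a s| <= radius2 a s / 4.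
    rewrite normrM (ger0_norm (radius2_ge0 a s)) mulrC.
    by apply: ler_wpM2l; [exact: radius2_ge0|exact: mua].
  rewrite normrM ger0_norm//.
  have := ler_normD (mu a * radius2 a s) (complex.Re ((z a s)^*%C * n a s)).
  have := radius2_ge0 a s; lra.
have [l u] := gronwall dr (fun s _ => b s) tT.
have eT : expR (T a) <= expR T0 by rewrite ler_expR.
rewrite eps_sqr; split.
  by apply: le_trans l _; apply: ler_wpM2r; first exact: radius2_ge0.
rewrite expr2 -mulrA; apply: ler_wpM2l; first exact: expR_ge0.
by apply: le_trans u _; apply: ler_wpM2r; first exact: radius2_ge0.
Qed.

Lemma z_eps : bigo z eps.
Proof.
exists 1 => //; apply: filterS radius2_gronwall => a H t /H[h _].
rewrite mul1r -(@ler_pXn2r _ 2)// nnegrE ?normc_ge0 ?eps_ge0//.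
Qed.

Lemma z_low : \forall a \near F_, forall t, 0 <= t <= T a ->
  (expR T0 ^+ 2)^-1 * eps a ^+ 2 <= complex.Re (monomial z 1 1 a t).
Proof.
apply: filterS radius2_gronwall => a H t /H[_ h].
rewrite mulrC ler_pdivrMr ?exprn_gt0 ?expR_gt0// mulrC (le_trans h)// ler_wpM2l ?sqr_ge0//.
rewrite /monomial /radius2 !expr1 normc_sqr.
by move: (z a t) => [u v] /=; rewrite mulrN opprK !expr2.
Qed.

Lemma z_le_y : exists2 K : R, 0 <= K &
  \forall a \near F_, forall t, normc (z a t) <= K * `|y a t| ^+ 1.
Proof.
apply: (@covector_bound (fun a t m => y a t m 0) 1) => m; exists 1 => //.
by apply: filterE => a t; rewrite mul1r expr1; exact: coord_le_norm.
Qed.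

Lemma eps_small (e : R) : 0 < e -> \forall a \near F_, eps a ^+ 2 <= e.
Proof.
move=> e0; have [K K0 H] := z_le_y.
pose e1 := Num.sqrt (e / (expR T0 * (K ^+ 2 + 1))).
have d0 : 0 < expR T0 * (K ^+ 2 + 1).
  by rewrite mulr_gt0 ?expR_gt0// ltr_wpDl ?sqr_ge0.
have e10 : 0 < e1 by rewrite sqrtr_gt0 divr_gt0.
apply: filterS2 H (y_small e10) => a Ha ya.
rewrite eps_sqr /radius2.
have h1 : normc (z a 0) ^+ 2 <= K ^+ 2 * e1 ^+ 2.
  rewrite -exprMn lerXn2r ?nnegrE ?normc_ge0 ?mulr_ge0 ?(ltW e10)//.
  by rewrite (le_trans (Ha 0))// ler_wpM2l// expr1 ltW.
have h2 : K ^+ 2 * e1 ^+ 2 <= (K ^+ 2 + 1) * e1 ^+ 2.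
  by rewrite ler_wpM2r ?sqr_ge0// lerDl.
apply: (@le_trans _ _ (expR T0 * ((K ^+ 2 + 1) * e1 ^+ 2))).
  by apply: ler_wpM2l; [exact: expR_ge0|exact: le_trans h1 h2].
rewrite mulrA sqr_sqrtr; last by rewrite divr_ge0// ltW.
by rewrite mulrC divfK// lt0r_neq0.
Qed.

Lemma eps01 : \forall a \near F_, 0 <= eps a <= 1.
Proof.
apply: filterS (eps_small ltr01) => a e1; rewrite eps_ge0/=.
by rewrite -(@ler_pXn2r _ 2) ?nnegrE ?eps_ge0// expr1n.
Qed.

(** A curve that winds around the equilibrium does not pass through it. *)
Lemma eps_gt0 : \forall a \near F_, 0 < eps a.
Proof.
apply: filterS2 F_J F_orbit => a Ja [_ [rho [theta [_ rho0 H _]]]].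
rewrite sqrtr_gt0 mulr_gt0 ?expR_gt0// /radius2 exprn_gt0// lt_neqAle normc_ge0 andbT eq_sym.
apply/negP => /eqP /ComplexField.Normc.eq0_normc zz.
have e0 : y a 0 0 0 = 0.
  by apply: (@complexI R); rewrite y0E// zz conjc0 addr0.
have e1 : y a 0 1 0 = 0.
  by apply: (@complexI R); rewrite y1E// zz conjc0 !mul0r addr0.
move: e0 e1; rewrite /y H !mxE /=.
move=> /eqP; rewrite mulf_eq0 gt_eqF//= => /eqP c0.
move=> /eqP; rewrite mulf_eq0 gt_eqF//= => /eqP s0.
have := cos2Dsin2 (theta 0); rewrite c0 s0 expr0n addr0 => /eqP.
by rewrite eq_sym oner_eq0.
Qed.

(** Each coordinate of y is a form of degree 1 in z and conj z. *)
Lemma hform_taylor_term d (g : X -> R) : Cn d g ->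
  hform F_ T z d (fun a t => (taylor_term d g (x0 a, a) (y a t))%:C).
Proof.
elim: d g => [|d IH] g gd.
  exact: (hform_coef z (F_bigo (ccontR (branch_continuous gd)))).
have h0 := IH _ (Cn_axis_derive 0 gd); have h1 := IH _ (Cn_axis_derive 1 gd).
have bs := F_bigo slp_ccont.
apply: hform_ext (hform_add (hform_add (hform_z h0) (hform_zbar h0))
  (hform_add (hformZ bs (hform_z h1)) (hformZ (bigoJ bs) (hform_zbar h1)))); apply: filterS F_J => a Ja t.
have E (u v : R) : (y a t 0 0 * u + y a t 1 0 * v)%:C =
    (z a t + (z a t)^*%C) * u%:C + (z a t * slp a + (z a t)^*%C * (slp a)^*%C) * v%:C.
  by rewrite -y0E// -y1E// rmorphD !rmorphM.
rewrite taylor_termS E.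
move: (_%:C) (_%:C) (z a t) (slp a) => u v w s.
ring.
Qed.

Definition tailed a t m := taylor_term 4 (component f m) (x0 a, a) (y a t) / 24.
Definition n4 a t := covector a (tailed a t).
Definition n5 a t := covector a (tail a t).

Lemma n4_form : hform F_ T z 4 n4.
Proof.
have h m : hform F_ T z 4 (fun a t => (tailed a t m)%:C).
  apply: hform_ext (hform_scale (24^-1)%:C (hform_taylor_term (component_smooth m 4))).
  by apply: filterE => a t; rewrite /tailed (rmorphM (real_complex R)) mulrC.
by apply: hform_ext (hform_add (hformZ (F_bigo l0_ccont) (h 0))
  (hformZ (F_bigo l1_ccont) (h 1))); exact: filterE.
Qed.

Lemma n5_bd : bigo n5 (fun a => eps a ^+ 5).
Proof.
have [C C0 H] := covector_bound tail_bound5.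
have [K K0 G] := y_le_z; have [E E0 Ez] := z_eps.
exists (C * (K * E) ^+ 5); first by rewrite mulr_ge0// exprn_ge0// mulr_ge0.
apply: filterS3 H G Ez => a Ha Ga Ea t tT.
apply: le_trans (Ha t) _; rewrite -mulrA; apply: ler_wpM2l => //.
rewrite -exprMn lerXn2r ?nnegrE ?mulr_ge0 ?eps_ge0//.
by rewrite (le_trans (Ga t))// -mulrA ler_wpM2l// Ea.
Qed.

Definition cA a := G20 a / 2.
Definition cB a := G11 a.
Definition cC a := G02 a / 2.
Definition d30 a := pC a (slp a) (slp a) (slp a) / 6.
Definition d21 a := G21 a / 2.
Definition d12 a := pC a (slp a) (slp a)^*%C (slp a)^*%C / 2.
Definition d03 a := pC a (slp a)^*%C (slp a)^*%C (slp a)^*%C / 6.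

Lemma invc_nat k : ((k%:R : R)^-1)%:C = (k%:R : R[i])^-1.
Proof. by rewrite fmorphV rmorph_nat. Qed.

Lemma n_split : \forall a \near F_, forall t,
  n a t = quadratic z cA cB cC a t + (cubic z d30 d21 d12 d03 a t + (n4 a t + n5 a t)).
Proof.
apply: filterS F_J => a Ja t.
have [e0 e1] := (y0E t Ja, y1E t Ja).
have T2 m := taylor_term2E (x0 a, a) (y a t) (component_smooth m 2).
have T3 m := taylor_term3E (x0 a, a) (y a t) (component_smooth m 3).
have E m : (remainder a t m)%:C =
   (2^-1 * (B2 a m (slp a) (slp a) * z a t ^+ 2 +
      2 * B2 a m (slp a) (slp a)^*%C * (z a t * (z a t)^*%C) +
      B2 a m (slp a)^*%C (slp a)^*%C * (z a t)^*%C ^+ 2)) +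
   (6^-1 * (C3 a m (slp a) (slp a) (slp a) * z a t ^+ 3 +
      3 * C3 a m (slp a) (slp a) (slp a)^*%C * (z a t ^+ 2 * (z a t)^*%C) +
      3 * C3 a m (slp a) (slp a)^*%C (slp a)^*%C * (z a t * (z a t)^*%C ^+ 2) +
      C3 a m (slp a)^*%C (slp a)^*%C (slp a)^*%C * (z a t)^*%C ^+ 3)) +
   ((tailed a t m)%:C + (tail a t m)%:C).
  rewrite /B2 /C3 -(bilinear2_expand _ _ _ e0 e1) -(trilinear2_expand _ _ _ _ e0 e1).
  rewrite -T2 -T3 /tailed /tail.
  rewrite -!invc_nat.
  move: (remainder a t m) (taylor_term 2 _ _ _) (taylor_term 3 _ _ _)
    (taylor_term 4 _ _ _) => r t2 t3 t4.
  rewrite -!(rmorphM (real_complex R)) -!(rmorphD (real_complex R)).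
  by congr (_%:C); ring.
rewrite /n4 /n5 /covector /n /eigencoord -/(l0 a) -/(l1 a) !E.
rewrite /quadratic /cubic /monomial /cA /cB /cC /d30 /d21 /d12 /d03 /pB /pC.
move: (B2 a) (C3 a) (l0 a) (l1 a) (slp a) (z a t) => b c u0 u1 s w.
move: (b 0 s s) (b 1 s s) (b 0 s s^*%C) (b 1 s s^*%C) (b 0 s^*%C s^*%C) (b 1 s^*%C s^*%C).
move: (c 0 s s s) (c 1 s s s) (c 0 s s s^*%C) (c 1 s s s^*%C) (c 0 s s^*%C s^*%C) (c 1 s s^*%C s^*%C)
  (c 0 s^*%C s^*%C s^*%C) (c 1 s^*%C s^*%C s^*%C) => k1 k2 k3 k4 k5 k6 k7 k8 k9 k10 k11 k12 k13 k14.
move: (tailed a t 0)%:C (tailed a t 1)%:C (tail a t 0)%:C (tail a t 1)%:C (w^*%C) => h1 h2 h3 h4 v.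
by field; rewrite ?pnatr_eq0.
Qed.

Lemma lam_gap : \forall a \near F_, omega alphas / 2 <= complex.Im (lam a).
Proof. exact: omega_low. Qed.

Lemma kap_low : \forall a \near F_, `|kap alphas| / 2 <= `|kap a|.
Proof.
have e0 : 0 < `|kap alphas| / 2 by rewrite divr_gt0// normr_gt0.
apply: filterS (F_cvg_dist e0 kap_cont) => a.
move: (kap alphas) (kap a) => u v h.
by have := ler_normD (u - v) v; rewrite subrK; lra.
Qed.

Lemma kap_bigo : bigo (fun a _ => (kap a - (complex.Re (d21 a) -
  complex.Im (cA a * cB a) / omega a))%:C) (fun a => `|mu a|).
Proof.
have [C C0 H] := F_bound (ccontR kap_defect_cont).
exists C => //; apply: filterS2 F_J H => a Ja Ha t _.
rewrite -[complex.Re (d21 a) - _]/(kap_axis a) (kap_split Ja) normcr normrM mulrC.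
by apply: ler_wpM2r => //; rewrite -normcr.
Qed.

(** The hypotheses of bigo_mean hold along the cycles. *)
Lemma moment10_bigo : bigo (fun a _ => moment T z 1 0 a +
  (mu a)%:C * G11 a / ((lam a)^*%C * (kap a)%:C)) (fun a => mu a ^+ 2).
Proof.
have [c20 c11 c02 c21] := G_ccont.
have cs := slp_ccont; have cs' := ccontJ slp_ccont.
have ci k : ccont alphas (fun=> (k%:R : R[i])^-1) by exact: ccont_cst.
have b20 : bigo (fun a _ => cA a) (fun=> 1) by apply: F_bigo; exact: ccontM.
have b11 : bigo (fun a _ => cB a) (fun=> 1) by exact: F_bigo.
have b02 : bigo (fun a _ => cC a) (fun=> 1) by apply: F_bigo; exact: ccontM.
have b30 : bigo (fun a _ => d30 a) (fun=> 1).
  by apply: F_bigo; apply: ccontM (ci _); exact: pC_ccont.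
have b21 : bigo (fun a _ => d21 a) (fun=> 1) by apply: F_bigo; exact: ccontM.
have b12 : bigo (fun a _ => d12 a) (fun=> 1).
  by apply: F_bigo; apply: ccontM (ci _); exact: pC_ccont.
have b03 : bigo (fun a _ => d03 a) (fun=> 1).
  by apply: F_bigo; apply: ccontM (ci _); exact: pC_ccont.
have bk : bigo (fun a _ => (kap a)%:C) (fun=> 1).
  by apply: F_bigo; apply: ccontR; exact: kap_cont.
have o0 : 0 < omega alphas / 2 by rewrite divr_gt0// omega_alphas.
have k0 : 0 < `|kap alphas| / 2 by rewrite divr_gt0// normr_gt0.
have e0 : 0 < (expR T0 ^+ 2)^-1 by rewrite invr_gt0 exprn_gt0// expR_gt0.
exact: (bigo_mean T_gt0 eps01 z_eps z_per z_cont n_cont z_ode o0 lam_gap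
  b20 b11 b02 b30 b21 b12 b03 n4_form n5_bd n_split (fun=> erefl) T0_ge0 T_le
  (mu_small ltr01) e0 z_low k0 kap_low kap_bigo eps_small bk eps_gt0).
Qed.

Lemma qn0 a : qn a 0 0 = 1. Proof. by rewrite mxE. Qed.
Lemma qn1 a : qn a 1 0 = slp a. Proof. by rewrite mxE. Qed.

Lemma yE a t k : J a ->
  (y a t k 0)%:C = qn a k 0 * z a t + (qn a k 0)^*%C * (z a t)^*%C.
Proof.
move=> Ja; case: (ord2P k) => ->; rewrite ?qn0 ?qn1.
  by rewrite y0E// conjc1 !mul1r.
by rewrite y1E// mulrC [X in _ + X]mulrC.
Qed.

(** The vector y is z q plus its conjugate. *)
Lemma time_average_moment : \forall a \near F_, forall k,
  (time_average (x a) (T a) - x0 a) k 0 =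
  2 * complex.Re (qn a k 0 * moment T z 1 0 a).
Proof.
apply: filterS3 (filterI F_J T_gt0) z_cont x_cont => a [Ja Ta] cz cx k.
have cxk : continuous (fun t => x a t k 0).
  move=> t; apply: (@continuous_comp _ _ _ (x a) (fun M : 'cV[R]_2 => M k 0)).
    exact: cx.
  exact: coord_continuous.
have -> : (time_average (x a) (T a) - x0 a) k 0 = mean (T a) (fun t => y a t k 0).
  rewrite !mxE -/(mean (T a) (fun t => x a t k 0)).
  have -> : (fun t => y a t k 0) = (fun t => x a t k 0 + - x0 a k 0).
    by apply/funext => t; rewrite /y !mxE.
  rewrite meanD ?mean_cst//.
  by move=> t; exact: cvg_cst.
have cz' := ccontinuousJ cz.
have cc c : ccontinuous (fun=> c) := ccontinuous_cst c.
have -> : mean (T a) (fun t => y a t k 0) =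
    complex.Re (cmean (T a) (fun t => qn a k 0 * z a t + (qn a k 0)^*%C * (z a t)^*%C)).
  by rewrite /=; congr mean; apply/funext => t; rewrite -yE.
rewrite cmeanD//; try exact: ccontinuousM.
rewrite !cmeanZ// cmeanJ//.
have -> : moment T z 1 0 a = cmean (T a) (z a).
  by congr cmean; apply/funext => t; rewrite /monomial expr1 expr0 mulr1.
move: (cmean _ _) (qn a k 0) => [u1 u2] [v1 v2] /=; ring.
Qed.

Lemma Kvec_normalised a k : Kvec (nlin a) (lam a) (qn a) (pn a) k 0 =
  - complex.Re (2 * G11 a / ((lam a)^*%C * (kap a)%:C) * qn a k 0).
Proof. by rewrite Kvec_coord g11E. Qed.

Lemma mean_asymptotics : exists2 C : R, 0 <= C & \forall a \near F_,
  `|time_average (x a) (T a) - x0 a - mu a *: Kvec (nlin a) (lam a) (qn a) (pn a)|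
    <= C * mu a ^+ 2.
Proof.
have [C C0 H] := moment10_bigo; have [S S0 HS] := F_bound slp_ccont.
exists (2 * C + 2 * S * C); first by have := mulr_ge0 S0 C0; lra.
apply: filterS3 (filterI time_average_moment T_gt0) H HS => a [tm Ta] Ha Sa.
have {}Ha := Ha 0 _; rewrite lexx ltW// in Ha; have {}Ha := Ha isT.
have c k : (time_average (x a) (T a) - x0 a -
    mu a *: Kvec (nlin a) (lam a) (qn a) (pn a)) k 0 =
  2 * complex.Re (qn a k 0 * (moment T z 1 0 a +
      (mu a)%:C * G11 a / ((lam a)^*%C * (kap a)%:C))).
  have -> : (time_average (x a) (T a) - x0 a -
      mu a *: Kvec (nlin a) (lam a) (qn a) (pn a)) k 0 =
    (time_average (x a) (T a) - x0 a) k 0 -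
      mu a * Kvec (nlin a) (lam a) (qn a) (pn a) k 0 by rewrite !mxE.
  rewrite tm Kvec_normalised -!mulrA.
  rewrite -(rmorph_nat (real_complex R)).
  move: (_^-1) (G11 a) (qn a k 0) (moment _ _ _ _ _) => [w1 w2] [g1 g2] [v1 v2] [m1 m2] /=.
  ring.
have b k : `|(time_average (x a) (T a) - x0 a -
    mu a *: Kvec (nlin a) (lam a) (qn a) (pn a)) k 0| <=
    2 * (normc (qn a k 0) * (C * mu a ^+ 2)).
  rewrite c normrM ger0_norm// ler_wpM2l// (le_trans (normr_Re_le _))//.
  by rewrite (ComplexField.Normc.normcM (qn a k 0)) ler_wpM2l ?normc_ge0.
apply: le_trans (norm_le_coords _) _.
have b0 := b 0; have b1 := b 1.
have e0 : normc (qn a 0 0) = 1 by rewrite qn0 normcr normr1.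
have e1 : normc (qn a 1 0) = normc (slp a) by rewrite qn1.
have m2 : 0 <= C * mu a ^+ 2 by rewrite mulr_ge0// sqr_ge0.
rewrite e0 mul1r in b0; rewrite e1 in b1.
have s1 := ler_wpM2r m2 Sa.
have -> : (2 * C + 2 * S * C) * mu a ^+ 2 =
  2 * (C * mu a ^+ 2) + 2 * (S * (C * mu a ^+ 2)) by ring.
by apply: lerD => //; lra.
Qed.

End HopfFamily.

Lemma time_average_cst (R : realType) (u : R -> 'cV[R]_2) (c : 'cV[R]_2) (T : R) :
  0 < T -> (forall t, u t = c) -> time_average u T = c.
Proof.
move=> T0 uc; apply/colP => k; rewrite !mxE -/(mean T (fun t => u t k 0)).
have -> : (fun t => u t k 0) = (fun=> c k 0) by apply/funext => t; rewrite uc.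
exact: mean_cst.
Qed.

Theorem mainTheorem1 (R : realType)
  (f : 'cV[R]_2 -> R -> 'cV[R]_2) (f_smooth : smooth_family f)
  (alphas : R) (J : set R)
  (J_open : open J) (J_itv : is_interval J) (J_alphas : J alphas)
  (x0 : R -> 'cV[R]_2)
  (x0_cont : forall alpha, J alpha -> {for alpha, continuous x0})
  (x0_equil : forall alpha, J alpha -> f (x0 alpha) alpha = 0)
  (mu omega : R -> R) (q p : R -> 'cV[R[i]]_2) :
  let A := fun alpha => jacobian_mx (f ^~ alpha) (x0 alpha) in
  let F := fun alpha => nonlinear_part (f ^~ alpha) (x0 alpha) in
  let lambda := fun alpha => mu alpha +i* omega alpha in
  let c := fun alpha => c1 (F alpha) (lambda alpha) (q alpha) (p alpha) in
  let K := fun alpha => Kvec (F alpha) (lambda alpha) (q alpha) (p alpha) in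
  forall
  (omega_gt0 : forall alpha, J alpha -> 0 < omega alpha)
  (eig : forall alpha, J alpha ->
     eigendata (A alpha) (lambda alpha) (q alpha) (p alpha))
  (hopf : hopf_codim1 mu omega c alphas)
  (Itilde : set R) (Itilde_sub : Itilde `<=` J)
  (Itilde_itv : one_sided_interval alphas Itilde)
  (x : R -> R -> 'cV[R]_2) (T : R -> R)
  (cycles : hopf_cycles f x0 omega alphas Itilde x T),
  let mean := mean_state x0 Itilde x T in
  ((fun alpha => mean alpha - x0 alpha - mu alpha *: K alpha)
     =O_ (within Itilde (nbhs alphas)) (fun alpha => mu alpha ^+ 2)) /\
  (forall alpha, J alpha -> ~ Itilde alpha -> mean alpha - x0 alpha = 0).
Proof.
Proof.
move=> A F lambda c K omega_gt0 eig hopf Itilde Itilde_sub Itilde_itv x T cycles mean.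
split; last first.
  by move=> alpha _ nI; rewrite /mean /mean_state memNset// subrr.
have [mu0 _ mu_der _ c_neq0] := hopf.
have norm_data alpha Ja := eigendata_normalise (omega_gt0 alpha Ja) (eig alpha Ja).
have A01 alpha : J alpha -> jac f x0 alpha 0 1 != 0.
  by move=> Ja; have [] := norm_data alpha Ja.
have trA alpha : J alpha ->
    jac f x0 alpha 0 0 + jac f x0 alpha 1 1 = 2 * mu alpha.
  by move=> Ja; have [] := norm_data alpha Ja.
have detA alpha : J alpha ->
    jac f x0 alpha 0 0 * jac f x0 alpha 1 1 - jac f x0 alpha 0 1 * jac f x0 alpha 1 0 =
    mu alpha ^+ 2 + omega alpha ^+ 2.
  by move=> Ja; have [] := norm_data alpha Ja.
have KE alpha : J alpha -> K alpha =
    Kvec (nlin f x0 alpha) (lam mu omega alpha) (qn f x0 mu omega alpha) (pn f x0 mu omega alpha).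
  move=> Ja; have [_ _ _ [s s0 [eq ep]]] := norm_data alpha Ja.
  by rewrite /K eq ep Kvec_scale.
have kap_neq0 : kap f x0 mu omega alphas != 0.
  have [_ _ _ [s s0 [eq ep]]] := norm_data alphas J_alphas.
  move: c_neq0; rewrite /c eq ep Re_c1_scale// mulf_eq0 negb_or => /andP[_].
  exact.
have mu_cont : {for alphas, continuous mu}.
  by apply: differentiable_continuous; exact/derivable1_diffP.
have [C C0 H] := mean_asymptotics f_smooth J_open J_alphas x0_cont x0_equil
  omega_gt0 A01 trA detA mu0 mu_cont kap_neq0 cycles.
apply/eqO_exP; exists (C + 1); first by rewrite ltr_wpDl.
have h : \forall a \near alphas, a != alphas -> Itilde a ->
    `|time_average (x a) (T a) - x0 a - mu a *: Kvec (nlin f x0 a)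
        (lam mu omega a) (qn f x0 mu omega a) (pn f x0 mu omega a)| <= C * mu a ^+ 2.
  exact: H.
rewrite /within /=; apply: filterS h => a Ha Ia.
rewrite /mean /mean_state mem_set//.
(* At alphas the cycle is the equilibrium and mu vanishes. *)
have [->|aa] := eqVneq a alphas.
  have [_ [T0 xc] _ _] := cycles.
  by rewrite mu0 (time_average_cst T0 xc) scale0r subr0 subrr normr0 mulr_ge0// addr_ge0.
rewrite KE; last exact: Itilde_sub.
apply: le_trans (Ha aa Ia) _; rewrite ger0_norm ?sqr_ge0//.
by rewrite ler_wpM2r ?sqr_ge0// lerDl.
Qed.
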